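(* Let $\mathbb{K}$ be an algebraically closed field of characteristic zero and let $X=X_\sigma$ be a non-degenerate affine toric variety over $\mathbb{K}$ with acting torus $T=(\mathbb{K}^{\times})^n$, corresponding to a rational polyhedral cone $\sigma\subset N_{\mathbb{Q}}$, where $N\simeq\mathbb{Z}^n$. Let $v_1,\dots,v_r$ be the primitive vectors on the rays of $\sigma$ and $D_1,\dots,D_r$ the corresponding $T$-invariant prime divisors. Then the following conditions are equivalent: (1) the automorphism group $\mathrm{Aut}(X)$ is connected; (2) all automorphisms of the Cox ring $R(X)$ that normalize the $\mathrm{Cl}(X)$-grading preserve this grading, i.e. $\widetilde{\mathrm{Aut}}(R(X))=\mathrm{Ker}\,\gamma$; (3) there is no linear operator $L\in\mathrm{GL}_n(\mathbb{Z})$ (acting on $N\simeq \mathbb{Z}^n$) with $L(\sigma)=\sigma$ such that $L(v_i)=v_j$ but $[D_i]\neq[D_j]$ in $\mathrm{Cl}(X)$ for some $i,j$.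
   Context: Connectedness of $\mathrm{Aut}(X)$. $\mathrm{Aut}(X)$ is the group of regular automorphisms of $X$. For an irreducible affine algebraic variety $S$, a map $S\to\mathrm{Aut}(X)$, $s\mapsto\phi_s$, is called an algebraic family if $S\times X\to X$, $(s,x)\mapsto\phi_s(x)$, is a morphism of algebraic varieties. $\mathrm{Aut}(X)$ is called connected if for every $g\in\mathrm{Aut}(X)$ there is an algebraic family (with some irreducible affine $S$) in $\mathrm{Aut}(X)$ containing both $g$ and the identity automorphism. Toric notation. $N$ is the lattice of one-parameter subgroups of $T$, $M=\mathrm{Hom}(N,\mathbb{Z})$ the lattice of characters, $N_{\mathbb{Q}}=N\otimes\mathbb{Q}$, $M_{\mathbb{Q}}=M\otimes\mathbb{Q}$. Toric varieties are normal and irreducible; an affine toric variety has the form $X_\sigma=\mathrm{Spec}(\mathbb{K}[\sigma^\vee\cap M])$ for a (strongly convex) rational polyhedral cone $\sigma\subset N_{\mathbb{Q}}$ with dual cone $\sigma^\vee\subset M_{\mathbb{Q}}$. It is non-degenerate if every invertible regular function on it is constant; equivalently $\sigma$ is full-dimensional. To each ray of $\sigma$ with primitive (shortest nonzero integer) vector $v_i$ corresponds a prime $T$-invariant divisor $D_i$, the closure of the corresponding $T$-orbit. The divisor class group $\mathrm{Cl}(X)$ is the quotient of the free abelian group on $D_1,\dots,D_r$ by the subgroup of all $\mathrm{div}(\chi^m)=\sum_{i=1}^r\langle v_i,m\rangle D_i$, $m\in M$; $[D]$ denotes the class of $D$. Cox ring. The Cox ring of $X$ is the polynomial ring $R(X)=\mathbb{K}[T_1,\dots,T_r]$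 with the $\mathrm{Cl}(X)$-grading $R(X)=\bigoplus_{u\in\mathrm{Cl}(X)}R(X)_u$ determined by $\deg(T_i)=[D_i]$. Put $$\widetilde{\mathrm{Aut}}(R(X))=\{\phi\in\mathrm{Aut}(R(X))\mid \exists\,\phi_0\in\mathrm{Aut}(\mathrm{Cl}(X)):\ \phi(R(X)_u)=R(X)_{\phi_0(u)}\ \forall u\in\mathrm{Cl}(X)\},$$ where $\mathrm{Aut}(R(X))$ is the group of $\mathbb{K}$-algebra automorphisms, and let $\gamma:\widetilde{\mathrm{Aut}}(R(X))\to\mathrm{Aut}(\mathrm{Cl}(X))$ be the homomorphism $\phi\mapsto\phi_0$. *)

(* Defs.v *)
From HB Require Import structures.
From mathcomp Require Import all_boot all_order all_algebra.
From mathcomp Require Import finmap.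
From mathcomp Require Import mpoly.
From mathcomp Require boolp.
From mathcomp Require Import (canonicals) monalg.

Set Implicit Arguments.
Unset Strict Implicit.
Unset Printing Implicit Defensive.

Import Order.TTheory GRing.Theory Num.Theory.
Local Open Scope ring_scope.
Local Open Scope quotient_scope.

(* The semigroup algebra K[S] of an additive commutative monoid S: finitely
   supported functions S -> K with the convolution product. The ring structure
   that the library puts on {malg K[S]} is restricted to monoids without
   invertible elements, which is not the case of the dual of a cone that is not
   full-dimensional. *)
Definition semigroup_alg (K : comNzRingType) (S : nmodType) : Type :=
  monalg.malg S K.

Section SemigroupAlgebra.
Variables (K : comNzRingType) (S : nmodType).

Local Notation A := (monalg.malg S K).
Local Notation coef := (@monalg.mcoeff S K).
Local Notation supp := (@monalg.msupp S K).
Local Notation term := (@monalg.mkmalgU S K).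

Implicit Types (f g h : A) (a b : S).

Definition sgone : A := term 0 1.
Definition sgmul f g : A :=
  \sum_(a <- supp f) \sum_(b <- supp g) term (a + b) (coef a f * coef b g).

Lemma sgmulw (d1 d2 : {fset S}) f g :
  (supp f `<=` d1)%fset -> (supp g `<=` d2)%fset ->
  sgmul f g = \sum_(a <- d1) \sum_(b <- d2) term (a + b) (coef a f * coef b g).
Proof.
move=> le1 le2; rewrite /sgmul (big_fset_incl _ le1) /=.
  apply/eq_bigr=> a _; apply/big_fset_incl => // b _ /monalg.mcoeff_outdom ->.
  by rewrite mulr0 monalg.monalgU0.
move=> a _ /monalg.mcoeff_outdom fa.
by rewrite big1 => // b _; rewrite fa mul0r monalg.monalgU0.
Qed.

Lemma sgmulC : commutative sgmul.
Proof.
move=> f g; rewrite /sgmul exchange_big /=; apply/eq_bigr=> b _.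
by apply/eq_bigr=> a _; rewrite addrC mulrC.
Qed.

Lemma sgmulDl : left_distributive sgmul +%R.
Proof.
move=> f g h.
have lef := fsubsetUl (supp f) (supp g); have leg := fsubsetUr (supp f) (supp g).
have leh := fsubset_refl (supp h).
rewrite (sgmulw (monalg.msuppD_le f g) leh) (sgmulw lef leh) (sgmulw leg leh).
rewrite -big_split /=; apply/eq_bigr=> a _.
rewrite -big_split /=; apply/eq_bigr=> b _.
by rewrite monalg.mcoeffD mulrDl monalg.monalgUD.
Qed.

Lemma sgmulDr : right_distributive sgmul +%R.
Proof. by move=> f g h; rewrite sgmulC sgmulDl !(sgmulC f). Qed.

Lemma sgmul0 : left_zero 0 sgmul.
Proof. by move=> f; rewrite /sgmul monalg.msupp0 big_seq_fset0. Qed.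

Lemma sgmulr0 : right_zero 0 sgmul.
Proof. by move=> f; rewrite sgmulC sgmul0. Qed.

Lemma sgmulUU a b (c d : K) :
  sgmul (term a c) (term b d) = term (a + b) (c * d).
Proof.
by rewrite (sgmulw monalg.msuppU_le monalg.msuppU_le) !big_seq_fset1
           !monalg.mcoeffUU.
Qed.

Lemma sgE f : f = \sum_(a <- supp f) term a (coef a f) :> A.
Proof. exact: monalg.monalgE. Qed.

Lemma sgmul_suml (I : Type) (s : seq I) (F : I -> A) g :
  sgmul (\sum_(i <- s) F i) g = \sum_(i <- s) sgmul (F i) g.
Proof. exact: (big_morph (sgmul^~ g) (fun _ _ => sgmulDl _ _ _) (sgmul0 g)). Qed.

Lemma sgmul_sumr (I : Type) (s : seq I) (F : I -> A) g :
  sgmul g (\sum_(i <- s) F i) = \sum_(i <- s) sgmul g (F i).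
Proof. exact: (big_morph (sgmul g) (fun _ _ => sgmulDr _ _ _) (sgmulr0 g)). Qed.

Lemma sgmul1 : left_id sgone sgmul.
Proof.
move=> f; rewrite {1}[f]sgE sgmul_sumr [RHS]sgE.
by apply/eq_bigr=> a _; rewrite sgmulUU add0r mul1r.
Qed.

Lemma sgmulA : associative sgmul.
Proof.
move=> f g h; rewrite [f]sgE !sgmul_suml; apply/eq_bigr=> a _.
rewrite [g]sgE sgmul_suml !sgmul_sumr sgmul_suml; apply/eq_bigr=> b _.
rewrite [h]sgE !sgmul_sumr; apply/eq_bigr=> c _.
by rewrite !sgmulUU addrA mulrA.
Qed.

Lemma sgone_neq0 : sgone != 0.
Proof.
apply/eqP=> /(congr1 (coef 0)); rewrite monalg.mcoeffUU monalg.mcoeff0.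
by apply/eqP; rewrite oner_eq0.
Qed.

Lemma sgmulZ (c : K) f : sgmul (term 0 c) f = c *: f.
Proof.
rewrite (sgmulw monalg.msuppU_le (fsubset_refl (supp f))) big_seq_fset1.
by apply/eq_bigr=> a _; rewrite monalg.mcoeffUU add0r.
Qed.

Lemma sgscaleAl (c : K) f g : c *: sgmul f g = sgmul (c *: f) g.
Proof. by rewrite -!sgmulZ sgmulA. Qed.

Local Notation B := (semigroup_alg K S).
HB.instance Definition _ := GRing.Lmodule.copy B A.
HB.instance Definition _ := GRing.Zmodule_isComNzRing.Build B
  sgmulA sgmulC sgmul1 sgmulDl sgone_neq0.
HB.instance Definition _ := GRing.Lmodule_isLalgebra.Build K B sgscaleAl.
HB.instance Definition _ := GRing.Lalgebra_isComAlgebra.Build K B.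

End SemigroupAlgebra.

Section Varieties.
Variable K : closedFieldType.

(* A set of points together with its regular functions. *)
Record variety := Variety {
  point :> Type;
  regular : (point -> K) -> Prop
}.

(* A closed embedding in affine k-space identifies the regular functions with
   the restrictions of polynomials. *)
Definition affine_variety (V : variety) : Prop :=
  exists (k : nat) (e : V -> 'I_k -> K) (I : {mpoly K[k]} -> Prop),
    [/\ injective e,
        forall y : 'I_k -> K,
          (exists x, e x = y) <-> (forall p, I p -> p.@[y] = 0)
      & forall f : V -> K,
          regular f <-> exists p : {mpoly K[k]}, forall x, f x = p.@[e x]].

Definition zariski_closed (V : variety) (Z : V -> Prop) : Prop :=
  exists F : (V -> K) -> Prop,
    (forall f, F f -> regular f)
    /\ (forall x, Z x <-> forall f, F f -> f x = 0).

Definition irreducible_variety (V : variety) : Prop :=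
  inhabited V
  /\ (forall Z1 Z2 : V -> Prop, zariski_closed Z1 -> zariski_closed Z2 ->
        (forall x, Z1 x \/ Z2 x) -> (forall x, Z1 x) \/ (forall x, Z2 x)).

(* K[V x W] is the tensor product of K[V] and K[W]. *)
Definition product_variety (V W : variety) : variety :=
  @Variety (V * W)%type (fun f =>
    exists (k : nat) (g : 'I_k -> V -> K) (h : 'I_k -> W -> K),
      [/\ forall i, regular (g i), forall i, regular (h i)
        & forall x, f x = \sum_i g i x.1 * h i x.2]).

Definition is_morphism (V W : variety) (phi : V -> W) : Prop :=
  forall f : W -> K, regular f -> regular (f \o phi).

Definition is_automorphism (V : variety) (phi : V -> V) : Prop :=
  is_morphism phi
  /\ exists psi : V -> V,
       [/\ is_morphism psi, cancel phi psi & cancel psi phi].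

Definition algebraic_family (S V : variety) (phi : S -> V -> V) : Prop :=
  (forall s, is_automorphism (phi s))
  /\ @is_morphism (product_variety S V) V (fun x => phi x.1 x.2).

Definition Aut_connected (V : variety) : Prop :=
  forall g : V -> V, is_automorphism g ->
  exists S : variety,
    [/\ affine_variety S, irreducible_variety S
      & exists phi : S -> V -> V, algebraic_family phi
          /\ exists s0 s1 : S, phi s0 =1 id /\ phi s1 =1 g].

Definition nondegenerate_variety (V : variety) : Prop :=
  forall f g : V -> K, regular f -> regular g -> (forall x, f x * g x = 1) ->
  exists c : K, forall x, f x = c.

(* Over an algebraically closed field the closed points of Spec A, for A
   finitely generated, are the K-algebra morphisms A -> K. *)
Definition spec (A : comAlgType K) : variety :=
  @Variety {lrmorphism A -> K^o} (fun f =>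
    exists a : A, forall x : {lrmorphism A -> K^o}, f x = x a).

End Varieties.

Section Cones.
Variable n : nat.

(* N = 'cV[int]_n and M = 'rV[int]_n; similarly for N_Q and M_Q. *)
Definition pairing (R : pzRingType) (m : 'rV[R]_n) (x : 'cV[R]_n) : R :=
  (m *m x) 0 0.

Definition toNQ (x : 'cV[int]_n) : 'cV[rat]_n := map_mx intr x.
Definition toMQ (m : 'rV[int]_n) : 'rV[rat]_n := map_mx intr m.

Variable sigma : 'cV[rat]_n -> Prop.

(* Generators in N_Q can be rescaled to lie in N. *)
Definition polyhedral : Prop :=
  exists (k : nat) (g : 'I_k -> 'cV[rat]_n),
    forall x, sigma x <->
      exists c : 'I_k -> rat, (forall i, 0 <= c i) /\ x = \sum_i c i *: g i.

Definition strongly_convex : Prop :=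
  forall x, sigma x -> sigma (- x) -> x = 0.

Definition dual_cone (u : 'rV[rat]_n) : Prop :=
  forall x, sigma x -> 0 <= pairing u x.

Definition is_face (tau : 'cV[rat]_n -> Prop) : Prop :=
  exists2 u, dual_cone u & forall x, tau x <-> sigma x /\ pairing u x = 0.

(* One-dimensional faces; those of a strongly convex cone are half-lines. *)
Definition is_ray (rho : 'cV[rat]_n -> Prop) : Prop :=
  is_face rho
  /\ exists2 w : 'cV[rat]_n, w != 0 &
       forall x, rho x <-> exists2 c : rat, 0 <= c & x = c *: w.

(* The shortest nonzero vector of N on a half-line rho. *)
Definition is_primitive_vector (rho : 'cV[rat]_n -> Prop) (w : 'cV[int]_n)
    : Prop :=
  [/\ rho (toNQ w), w != 0
    & forall w', rho (toNQ w') -> w' != 0 ->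
        exists2 c : rat, 1 <= c & toNQ w' = c *: toNQ w].

Definition lists_primitive_vectors (r : nat) (v : 'I_r -> 'cV[int]_n) : Prop :=
  [/\ injective v,
      forall i, exists2 rho, is_ray rho & is_primitive_vector rho (v i)
    & forall rho, is_ray rho -> exists i, is_primitive_vector rho (v i)].

Definition stabilizes_cone (L : 'M[int]_n) : Prop :=
  forall x, sigma x <-> exists2 y, sigma y & x = map_mx intr L *m y.

Definition dual_semigroup : {pred 'rV[int]_n} :=
  fun m => boolp.asbool (dual_cone (toMQ m)).

Lemma dual_semigroup_addr_closed : Algebra.addumagma_closed dual_semigroup.
Proof.
split=> [|m m' /boolp.asboolP hm /boolp.asboolP hm']; apply/boolp.asboolP.
  by move=> x _; rewrite /pairing /toMQ map_mx0 mul0mx mxE.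
move=> x sx; rewrite /pairing /toMQ map_mxD mulmxDl mxE.
by apply: addr_ge0; [apply: hm | apply: hm'].
Qed.

HB.instance Definition _ :=
  Algebra.isAddClosed.Build _ dual_semigroup dual_semigroup_addr_closed.

Definition dual_monoid : Type := {m : 'rV[int]_n | m \in dual_semigroup}.
HB.instance Definition _ := SubType.on dual_monoid.
HB.instance Definition _ := Choice.on dual_monoid.
HB.instance Definition _ := Algebra.SubChoice_isSubNmodule.Build _ _ dual_monoid
  dual_semigroup_addr_closed.

End Cones.

Definition toric_variety (K : closedFieldType) (n : nat)
    (sigma : 'cV[rat]_n -> Prop) : variety K :=
  spec (semigroup_alg K (dual_monoid sigma)).

Section ClassGroup.
Variables (n r : nat) (v : 'I_r -> 'cV[int]_n).

(* 'rV[int]_r is the free abelian group on D_1, ..., D_r. *)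
Definition prime_div (i : 'I_r) : 'rV[int]_r := delta_mx 0 i.

Definition div_chi (m : 'rV[int]_n) : 'rV[int]_r :=
  \sum_i pairing m (v i) *: prime_div i.

Definition principal : {pred 'rV[int]_r} :=
  fun D => boolp.asbool (exists m, D = div_chi m).

Lemma principal_zmod_closed : zmod_closed principal.
Proof.
split=> [|D D' /boolp.asboolP[m ->] /boolp.asboolP[m' ->]]; apply/boolp.asboolP.
  by exists 0; rewrite /div_chi big1 // => i _; rewrite /pairing mul0mx mxE scale0r.
exists (m - m'); rewrite /div_chi -sumrB; apply: eq_bigr => i _.
by rewrite /pairing mulmxBl !mxE scalerBl.
Qed.

HB.instance Definition _ :=
  GRing.isZmodClosed.Build _ principal principal_zmod_closed.

Definition Cl : zmodType := Quotient.quot principal.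

Definition divclass (D : 'rV[int]_r) : Cl := \pi_(Quotient.quot principal) D.

Variable K : fieldType.

(* The Cox ring is {mpoly K[r]}; this is its homogeneous component of degree u
   for the grading deg T_i = [D_i]. *)
Definition cox_component (u : Cl) (p : {mpoly K[r]}) : Prop :=
  forall m : 'X_{1..r}, m \in msupp p ->
    \sum_(i < r) divclass (prime_div i) *+ m i = u.

(* phi0 is the image of phi under gamma. *)
Definition is_gamma (phi : {lrmorphism {mpoly K[r]} -> {mpoly K[r]}})
    (phi0 : {additive Cl -> Cl}) : Prop :=
  bijective phi0
  /\ (forall u q, cox_component (phi0 u) q <->
        exists2 p, cox_component u p & q = phi p).

Definition in_Aut_tilde (phi : {lrmorphism {mpoly K[r]} -> {mpoly K[r]}})
    : Prop :=
  bijective phi /\ exists phi0, is_gamma phi phi0.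

Definition in_Ker_gamma (phi : {lrmorphism {mpoly K[r]} -> {mpoly K[r]}})
    : Prop :=
  bijective phi /\ is_gamma phi idfun.

End ClassGroup.

(* Main.v *)
(* Write A for the algebra of X, R for the Cox ring, and embed A in R as the
   component of degree 0 by sending the character m to the monomial with
   exponents <v_i, m>.

   Lifting. An automorphism a of A sends characters to elements of R.  Because R
   is factorial and the valuation of A along a prime of R is essential, a prime
   dividing the image of some character has on all of them a valuation
   proportional to one of the <v_j, ->.  Hence the image of m factors as
   c(m) * prod_j F_j ^ <v_j, m>, and a extends to an automorphism of R, which
   normalizes the grading.

   (3) => (2). The linear part of an automorphism of R normalizing the grading is
   invertible, so some permutation p of the variables occurs in it; it
   satisfies [D_(p i)] = phi_0 [D_i], and therefore comes from an element of
   GL_n(Z) that permutes the rays.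

   (2) => (1). The lift Phi of an automorphism preserves the degrees, so that
   conjugating by dilations and interpolating linearly between the linear part
   and the identity gives a family of graded automorphisms of R over an open
   subset of the affine line.  It joins Phi to the identity and descends to A.

   (1) => (3). Lift the members of a family.  The permutation of the classes
   [D_i] by a lift is detected by bilinear identities between leading
   coefficients of the images of characters.  These are closed conditions on the
   parameter; the finitely many closed sets, one for each permutation, cover the
   irreducible parameter space, so one permutation works for all members,
   among which are the identity and the given symmetry. *)
Require Import Defs.
From HB Require Import structures.
From mathcomp Require Import all_boot all_order all_algebra finmap perm mpoly.
From mathcomp Require Import ring.
From mathcomp Require boolp.
From mathcomp Require Import (canonicals) monalg.

Set Implicit Arguments.
Unset Strict Implicit.
Unset Printing Implicit Defensive.

Import Order.TTheory GRing.Theory Num.Theory.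
Local Open Scope ring_scope.
Local Open Scope quotient_scope.

(** * Factorial polynomial rings *)

(** Lifts to the Cox ring are made one automorphism at a time and are determined only up to
    rescaling the variables, so a family on [X] does not come with an algebraic family of lifts. For
    this reason (1) => (3) never varies a lift with the parameter: it uses identities that involve
    [iota \o phi] alone, and lifts only serve to prove them. The obstacle there is a variable of
    class 0, whose image may have a nonzero constant term hiding its linear part; an image of any
    other degree has none, because constants have degree 0. Test characters therefore avoid the
    variables of class 0, and preservation of class 0 is carried along as a separate condition. The
    permutation itself is not canonical: only the classes [D (s i)] matter. Convexity enters mainly
    through two facts: some monomial of degree 0 omits exactly one prescribed variable ([v_facet]),
    and some character is 1 on a prescribed ray ([v_primitive]). Together they let every degree be
    reached while avoiding one variable. Non-degeneracy enters as [v_full]: a character is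
    determined by its values on the rays. *)

Section MpolyMorphisms.

Lemma mpoly_rmorph_ext (n : nat) (R : comNzRingType) (B : nzRingType)
    (f g : {rmorphism {mpoly R[n]} -> B}) :
  (forall c, f c%:MP = g c%:MP) -> (forall i, f 'X_i = g 'X_i) -> f =1 g.
Proof.
move=> fgC fgX; elim/mpolyind=> [|c m p _ _ IHp]; first by rewrite !rmorph0.
rewrite !rmorphD IHp -mul_mpolyC !rmorphM fgC; congr (_ * _ + _).
rewrite mpolyXE_id !rmorph_prod; apply: eq_bigr => i _.
by rewrite !rmorphXn fgX.
Qed.

Lemma mpoly_lrmorph_ext (n : nat) (R : comNzRingType) (B : algType R)
    (f g : {lrmorphism {mpoly R[n]} -> B}) :
  (forall i, f 'X_i = g 'X_i) -> f =1 g.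
Proof.
move=> fgX; apply: mpoly_rmorph_ext => // c.
have E (h : {lrmorphism {mpoly R[n]} -> B}) : h c%:MP = c%:A.
  by rewrite -[c%:MP]mulr1 mul_mpolyC linearZ rmorph1.
exact: etrans (E f) (esym (E g)).
Qed.

Variables (n : nat) (R : comNzRingType) (B : comAlgType R) (h : 'I_n -> B).

Definition msubst : {mpoly R[n]} -> B := mmap (in_alg B) h.

Lemma msubst_is_scalable : scalable msubst.
Proof. by move=> c p; rewrite /msubst mmapZ /= -scalerAl mul1r. Qed.

HB.instance Definition _ := GRing.RMorphism.copy msubst (mmap (in_alg B) h).
HB.instance Definition _ :=
  GRing.isScalable.Build R {mpoly R[n]} B *:%R msubst msubst_is_scalable.

Lemma msubstX i : msubst 'X_i = h i.
Proof. by rewrite /msubst mmapX mmap1U. Qed.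

Lemma msubstXm m : msubst 'X_[m] = \prod_(i < n) h i ^+ m i.
Proof. by rewrite /msubst mmapX. Qed.

End MpolyMorphisms.

(** * Gauss's theorem on polynomials over a factorial domain *)

Section Factorial.

Definition divides (R : idomainType) (x y : R) := exists z, y = x * z.

Definition prime_elt (R : idomainType) (p : R) :=
  [/\ p != 0, p \isn't a GRing.unit
    & forall a b, divides p (a * b) -> divides p a \/ divides p b].

(** Asking for prime factors rather than irreducible ones makes uniqueness of the factorization
    automatic. *)
Definition factorial_domain (R : idomainType) :=
  forall x : R, x != 0 -> exists (u : R) (s : seq R),
    [/\ u \is a GRing.unit, forall p : R, p \in s -> prime_elt p
      & x = u * \prod_(p <- s) p].

Lemma dividesMl (R : idomainType) (x y z : R) :
  divides x y -> divides x (y * z).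
Proof. by case=> w ->; exists (w * z); rewrite mulrA. Qed.

Lemma dividesMr (R : idomainType) (x y z : R) :
  divides x y -> divides x (z * y).
Proof. by rewrite mulrC; apply: dividesMl. Qed.

Lemma dividesD (R : idomainType) (x y z : R) :
  divides x y -> divides x z -> divides x (y + z).
Proof. by case=> a -> [b ->]; exists (a + b); rewrite mulrDr. Qed.

Lemma dividesN (R : idomainType) (x y : R) : divides x y -> divides x (- y).
Proof. by case=> a ->; exists (- a); rewrite mulrN. Qed.

Lemma divides_addr (R : idomainType) (x y z : R) :
  divides x z -> divides x (y + z) -> divides x y.
Proof.
by move=> dxz dxyz; rewrite -(addrK z y); apply/dividesD=> //; apply/dividesN.
Qed.

Lemma divides_sum (R : idomainType) (x : R) (I : eqType) (s : seq I) F :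
  (forall i, i \in s -> divides x (F i)) -> divides x (\sum_(i <- s) F i).
Proof.
elim: s => [|i s IHs] dF; first by rewrite big_nil; exists 0; rewrite mulr0.
rewrite big_cons; apply: dividesD; first by apply: dF; rewrite mem_head.
by apply: IHs => j js; apply: dF; rewrite inE js orbT.
Qed.

Lemma divides_unitr (R : idomainType) (x u : R) :
  divides x u -> u \is a GRing.unit -> x \is a GRing.unit.
Proof. by case=> y -> ; rewrite unitrM => /andP[]. Qed.

Lemma prime_eltM (R : idomainType) (p a b : R) :
  prime_elt p -> divides p (a * b) -> divides p a \/ divides p b.
Proof. by case=> _ _; apply. Qed.

Lemma prime_elt_prod (R : idomainType) (p : R) (I : eqType) (s : seq I) F :
  prime_elt p -> divides p (\prod_(i <- s) F i) ->
  exists2 i : I, i \in s & divides p (F i).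
Proof.
case=> _ pU pP; elim: s => [|i s IHs].
  by rewrite big_nil => /divides_unitr /(_ (unitr1 _)); rewrite (negPf pU).
rewrite big_cons => /pP[dpi | /IHs[j js dpj]]; first by exists i; rewrite ?mem_head.
by exists j; rewrite // inE js orbT.
Qed.

Lemma prime_elt_exp (R : idomainType) (p x : R) k :
  prime_elt p -> divides p (x ^+ k) -> divides p x.
Proof.
case=> _ pU pP; elim: k => [|k IHk].
  by rewrite expr0 => /divides_unitr /(_ (unitr1 _)); rewrite (negPf pU).
by rewrite exprS => /pP[].
Qed.

Lemma prime_elt_sym (R : idomainType) (p q : R) :
  prime_elt p -> prime_elt q -> divides p q -> divides q p.
Proof.
case=> p0 pU _ [q0 qU qP] [x def_q].
have /qP[//|[y def_x]] : divides q (p * x) by exists 1; rewrite -def_q mulr1.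
case/negP: pU; apply/unitrP; exists y.
suff E : p * y = 1 by rewrite mulrC.
by apply: (mulfI q0); rewrite mulr1 mulrCA -def_x -def_q.
Qed.

Lemma factorial_isom (A B : idomainType) (f : {rmorphism A -> B})
    (g : {rmorphism B -> A}) :
  cancel f g -> cancel g f -> factorial_domain B -> factorial_domain A.
Proof.
move=> fK gK facB x x0.
have fx0 : f x != 0 by rewrite -(inj_eq (can_inj gK)) fK rmorph0.
have [u [s [uU sP fxE]]] := facB _ fx0.
exists (g u), (map g s); split; first exact: rmorph_unit.
  move=> p /mapP[q /sP[q0 qU qP] ->]; split.
  - by rewrite -(inj_eq (can_inj fK)) gK rmorph0.
  - by apply: contra qU => /(rmorph_unit f); rewrite gK.
  - move=> a b [c abE].
    have /qP[[d dE]|[d dE]] : divides q (f a * f b).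
    + by exists (f c); rewrite -rmorphM abE rmorphM gK.
    + by left; exists (g d); rewrite -rmorphM -dE fK.
    + by right; exists (g d); rewrite -rmorphM -dE fK.
by rewrite big_map -rmorph_prod -rmorphM -fxE fK.
Qed.

Variable R : idomainType.
Implicit Types (p q : R) (f g h : {poly R}).

Lemma divides_polyC p f : (forall i, divides p f`_i) -> divides p%:P f.
Proof.
move=> dp; have [h hE] := boolp.choice dp.
exists (\poly_(i < size f) h i); apply/polyP=> i.
rewrite coefCM coef_poly; case: ltnP => [_|le_f]; first exact: hE.
by rewrite mulr0 nth_default.
Qed.

Lemma dividesC p f i : divides p%:P f -> divides p f`_i.
Proof. by case=> g ->; exists g`_i; rewrite coefCM. Qed.

Lemma divides_lead_coef p f : f != 0 -> divides p (lead_coef f) ->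
  exists2 f' : {poly R}, (size f' < size f)%N & divides p%:P (f - f').
Proof.
move=> f0 df; pose t := lead_coef f *: 'X^((size f).-1); exists (f - t).
  rewrite -[ltnRHS](prednK (n := size f)) ?lt0n ?size_poly_eq0 //.
  apply/leq_sizeP => j le_j; rewrite coefB coefZ coefXn.
  case: ltngtP le_j => // [lt_j _|<- _]; last by rewrite mulr1 subrr.
  by rewrite mulr0 subr0 nth_default // -(prednK (n := size f)) ?lt0n ?size_poly_eq0.
rewrite opprB addrC subrK; apply: divides_polyC => i.
by rewrite coefZ; apply: dividesMl.
Qed.

Lemma prime_polyC p : prime_elt p -> prime_elt p%:P.
Proof.
case=> p0 pU pP; split; first by rewrite polyC_eq0.
  by rewrite poly_unitE coefC eqxx negb_and pU orbT.
move=> f g; have [k] := ubnP (size f + size g); elim: k f g => // k IHk f g le_k.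
have d0 : divides p%:P 0 by exists 0; rewrite mulr0.
have [->|f0] := eqVneq f 0; first by left.
have [->|g0] := eqVneq g 0; first by right.
move=> dfg.
have /pP[df|dg] : divides p (lead_coef f * lead_coef g).
- by rewrite -lead_coefM; apply: dividesC.
- have [f' lt_f dff'] := divides_lead_coef f0 df.
  have [||df'|dg] := IHk f' g; last by right.
  + by rewrite -ltnS (leq_trans _ le_k) // ltnS ltn_add2r.
  + apply: divides_addr (dividesMl g dff') _.
    by rewrite -mulrDl addrC subrK.
  + by left; rewrite -(subrK f' f); apply: dividesD.
- have [g' lt_g dgg'] := divides_lead_coef g0 dg.
  have [||df|dg'] := IHk f g'; [| |by left|].
  + by rewrite -ltnS (leq_trans _ le_k) // ltnS ltn_add2l.
  + apply: divides_addr (dividesMr f dgg') _.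
    by rewrite -mulrDr addrC subrK.
  + by right; rewrite -(subrK g' g); apply: dividesD.
Qed.

Lemma scale_polyI p : p != 0 -> injective ( *:%R p : {poly R} -> {poly R}).
Proof.
by move=> p0 f g; rewrite -!mul_polyC; apply: mulfI; rewrite polyC_eq0.
Qed.

(** Stated through primes so that contents and gcds can be avoided. Over a field there are no primes
    and every polynomial qualifies. *)
Definition primitive_poly f := forall p, prime_elt p -> ~ divides p%:P f.

Hypothesis factR : factorial_domain R.

(** A prime constant dividing [f] divides its leading coefficient, so it is associated to one of the
    finitely many prime factors there; dividing it out removes that factor, and the induction is on
    their number. *)
Lemma primitive_part f : f != 0 ->
  exists c g, [/\ c != 0, primitive_poly g & f = c *: g].
Proof.
move=> f0; have lc0 : lead_coef f != 0 by rewrite lead_coef_eq0.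
have [u [s [uU sP lcE]]] := factR lc0.
elim: {s}(size s) {-2}s (erefl (size s)) u f uU sP lcE f0 {lc0} => [|k IHk] s sz_s u f uU sP lcE f0.
  exists 1, f; split=> [||]; rewrite ?oner_neq0 ?scale1r // => p [_ pU _] /dividesC dp.
  move: lcE; rewrite (size0nil sz_s) big_nil mulr1 => lcE.
  by case/negP: pU; apply: divides_unitr uU; rewrite -lcE; apply: dp.
have [prim_f|] := boolp.pselect (primitive_poly f).
  by exists 1, f; split; rewrite ?oner_neq0 ?scale1r.
move=> /boolp.existsNP[p] /boolp.not_implyP[pP] /boolp.contrapT dpf.
have [p0 pU pprime] := pP.
have /pprime[/divides_unitr/(_ uU)|] : divides p (u * \prod_(q <- s) q).
- by rewrite -lcE; apply: dividesC.
- by rewrite (negPf pU).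
case/(prime_elt_prod pP) => q qs dpq.
have [d qE] := prime_elt_sym pP (sP q qs) dpq.
case: dpf => f1 fE; have f10 : f1 != 0.
  by apply: contraNneq f0 => f10; rewrite fE f10 mulr0.
have dU : d \is a GRing.unit.
  case: dpq => e eE; apply/unitrP; exists e; suff E : d * e = 1 by rewrite mulrC.
  have q0 : q != 0 by case: (sP q qs).
  by apply: (mulfI q0); rewrite mulrA -qE -eE mulr1.
have sz' : size (rem q s) = k by rewrite size_rem // sz_s.
have [|x /mem_rem/sP|||c [g [c0 gP f1E]]] // := IHk (rem q s) sz' (u * d^-1) f1.
- by rewrite unitrM uU unitrV.
- apply: (mulfI p0); move: lcE; rewrite fE lead_coefM lead_coefC => ->.
  rewrite (big_rem q) //= qE -[LHS]mul1r -(mulrV dU); ring.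
- by exists (p * c), g; split; rewrite ?mulf_neq0 // fE f1E mul_polyC scalerA.
Qed.

(** Prime factors of [c] are removed one at a time: such a prime divides [d%:P * g], not the
    primitive [g], hence [d]. Once [c] is a unit, a remaining prime factor of [d] would divide
    [f]. *)
Lemma primitive_cancel c d f g : c != 0 -> d != 0 ->
  primitive_poly f -> primitive_poly g -> c *: f = d *: g ->
  exists2 u, u \is a GRing.unit & f = u *: g.
Proof.
move=> c0 d0 fP gP cfE.
have [u [s [uU sP cE]]] := factR c0.
have {c0 cE cfE} : (u * \prod_(p <- s) p) *: f = d *: g by rewrite -cE.
elim: s d d0 sP => [|p s IHs] d d0 sP.
  rewrite big_nil mulr1 => ufE.
  have [w [t [wU tP dE]]] := factR d0.
  case: t tP dE => [|q t] tP dE.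
    exists (u^-1 * d); first by rewrite dE big_nil mulr1 unitrM unitrV uU.
    by rewrite -scalerA -ufE scalerA mulVr // scale1r.
  have qP : prime_elt q by apply: tP; rewrite mem_head.
  case: (fP q qP); exists (u^-1 *: ((w * \prod_(j <- t) j) *: g)).
  rewrite -scalerAr mul_polyC [q *: (_ *: _)]scalerA mulrCA.
  by rewrite -[q * _](big_cons _ _ q t xpredT id) -dE -ufE scalerA mulVr // scale1r.
have pP : prime_elt p by apply: sP; rewrite mem_head.
rewrite big_cons => pE.
have : divides p%:P (d%:P * g).
  exists ((u * \prod_(j <- s) j) *: f).
  by rewrite !mul_polyC -pE scalerA mulrCA.
case/(prime_eltM (prime_polyC pP)) => [/(dividesC 0)|/(gP p pP)//].
rewrite coefC eqxx => -[e dE]; apply: (IHs e).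
- by apply: contraNneq d0 => e0; rewrite dE e0 mulr0.
- by move=> q qs; apply: sP; rewrite inE qs orbT.
have p0 : p != 0 by case: pP.
apply: (scale_polyI p0).
by rewrite !scalerA -dE -pE mulrCA.
Qed.

(* [%|] on [{poly R}] is divisibility over the fraction field of [R]. *)
Lemma primitive_dvdp f g : primitive_poly f -> f %| g -> divides f g.
Proof.
move=> fP /Pdiv.WeakIdomain.dvdpP[[/= c h] c0 cgE].
have [u [s [uU sP cE]]] := factR c0.
have {c0 cE cgE} : (u * \prod_(p <- s) p) *: g = h * f by rewrite -cE.
elim: s h sP => [|p s IHs] h sP.
  rewrite big_nil mulr1 => ugE; exists (u^-1 *: h).
  by rewrite -scalerAr mulrC -ugE scalerA mulVr // scale1r.
have pP : prime_elt p by apply: sP; rewrite mem_head.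
have p0 : p != 0 by case: pP.
rewrite big_cons => pE.
have : divides p%:P (h * f).
  by exists ((u * \prod_(j <- s) j) *: g); rewrite mul_polyC -pE scalerA mulrCA.
case/(prime_eltM (prime_polyC pP)) => [[k hE]|/(fP p pP)//].
apply: (IHs k) => [q qs|]; first by apply: sP; rewrite inE qs orbT.
by apply: (scale_polyI p0); rewrite !scalerA mulrCA pE hE mul_polyC -scalerAl.
Qed.

(** [irreducible_poly] refers to the fraction field, where [f] is coprime to any [a] that it does
    not divide; primitivity brings the resulting divisibility back to [R]. *)
Lemma prime_irreducible f : primitive_poly f -> irreducible_poly f -> prime_elt f.
Proof.
move=> fP irr_f; have [sz_f irr] := irr_f; split.
- exact: irredp_neq0.
- by rewrite poly_unitE; case: eqP sz_f => // ->.
move=> a b [k abE].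
have [dfa|ndfa] := boolP (f %| a); first by left; apply: primitive_dvdp.
right; apply: primitive_dvdp => //.
have cop : coprimep f a.
  apply/Pdiv.CommonIdomain.coprimepP => d ddf dda.
  rewrite -size_poly_eq1; apply/negPn/negP => /irr/(_ ddf) dE.
  by case/negP: ndfa; rewrite -(eqp_dvdl _ dE).
by rewrite -(Gauss_dvdpr _ cop) abE dvdp_mulr.
Qed.

(** A proper divisor over the fraction field gives [c *: f = h * g]. After passing to primitive
    parts, [primitive_cancel] turns this into a factorization over [R] up to a unit, with factors of
    smaller degree. *)
Lemma primitive_prod f : primitive_poly f -> f != 0 ->
  exists (u : {poly R}) (s : seq {poly R}),
    [/\ u \is a GRing.unit, forall p : {poly R}, p \in s -> prime_elt p
      & f = u * \prod_(p <- s) p].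
Proof.
have [k] := ubnP (size f); elim: k f => // k IHk f le_k fP f0.
have [sz1|sz_f] := leqP (size f) 1.
  have [c c0 fE] : exists2 c, c != 0 & f = c%:P.
    by apply/size_poly1P; rewrite eqn_leq sz1 size_poly_gt0.
  have [u [s [uU sP cE]]] := factR c0.
  case: s sP cE => [|p s] sP cE.
    exists f, [::]; split; rewrite ?big_nil ?mulr1 //.
    by rewrite fE cE big_nil mulr1; apply: rmorph_unit.
  case: (fP p); first by apply: sP; rewrite mem_head.
  exists (u * \prod_(j <- s) j)%:P.
  by rewrite fE cE big_cons -polyCM mulrCA.
have [irr_f|nirr] := boolp.pselect (irreducible_poly f).
  exists 1, [:: f]; split; rewrite ?unitr1 ?big_seq1 ?mul1r // => p.
  by rewrite inE => /eqP->; apply: prime_irreducible.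
have [g [sz_g dgf ngf]] : exists g, [/\ size g != 1%N, g %| f & ~ (g %= f)].
  apply: boolp.contrapT => H; apply: nirr; split=> // g sz_g dgf.
  by apply: boolp.contrapT => ngf; apply: H; exists g.
have g0 : g != 0 by apply: contraTneq dgf => ->; rewrite dvd0p.
have /Pdiv.WeakIdomain.dvdpP[[/= c h] c0 cfE] := dgf.
have h0 : h != 0.
  by apply: contraNneq f0 => h0; move/eqP: cfE; rewrite h0 mul0r -mul_polyC mulf_eq0 polyC_eq0 (negPf c0).
have [c1 [g' [c10 gP gE]]] := primitive_part g0.
have [c2 [h' [c20 hP hE]]] := primitive_part h0.
have gh'P : primitive_poly (g' * h').
  by move=> p pP /(prime_eltM (prime_polyC pP))[dg|dh]; [apply: gP dg|apply: hP dh].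
have [|u uU fE] := primitive_cancel c0 (mulf_neq0 c20 c10) fP gh'P.
  by rewrite cfE gE hE -!mul_polyC polyCM; ring.
have sz_g' : size g' = size g by rewrite gE size_scale.
have sz_h' : size h' = size h by rewrite hE size_scale.
have sz_gh : size f = (size g + size h).-1.
  by rewrite -(size_scale f c0) cfE size_mul // addnC.
have g1 : (1 < size g)%N by rewrite ltn_neqAle eq_sym sz_g size_poly_gt0.
have gf : (size g < size f)%N.
  rewrite ltn_neqAle dvdp_leq // andbT; apply/negP => /eqP eq_sz.
  by apply: ngf; rewrite -dvdp_size_eqp // eq_sz.
have lt_h : (size h < size f)%N by rewrite sz_gh; case: (size g) g1 => [|[|m]] //= _; rewrite ltnS leq_addl.
have g'0 : g' != 0 by rewrite -size_poly_gt0 sz_g' size_poly_gt0.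
have h'0 : h' != 0 by rewrite -size_poly_gt0 sz_h' size_poly_gt0.
have [|u1 [s1 [u1U s1P g'E]]] := IHk g' _ gP g'0.
  by rewrite sz_g' (leq_trans gf).
have [|u2 [s2 [u2U s2P h'E]]] := IHk h' _ hP h'0.
  by rewrite sz_h' (leq_trans lt_h).
exists (u%:P * (u1 * u2)), (s1 ++ s2); split.
- by rewrite !unitrM u1U u2U rmorph_unit.
- by move=> p; rewrite mem_cat => /orP[/s1P|/s2P].
- by rewrite fE big_cat /= {1}g'E {1}h'E -mul_polyC; ring.
Qed.

Lemma factorial_poly : factorial_domain {poly R}.
Proof.
move=> f f0; have [c [g [c0 gP fE]]] := primitive_part f0.
have g0 : g != 0 by apply: contraNneq f0 => g0; rewrite fE g0 scaler0.
have [u [s [uU sP gE]]] := primitive_prod gP g0.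
have [w [t [wU tP cE]]] := factR c0.
exists (w%:P * u), (map polyC t ++ s); split.
- by rewrite unitrM uU rmorph_unit.
- move=> p; rewrite mem_cat => /orP[/mapP[q /tP qP ->]|/sP//].
  exact: prime_polyC.
- rewrite fE big_cat big_map /= {1}gE cE -mul_polyC polyCM rmorph_prod; ring.
Qed.

End Factorial.

(** * Factoriality of polynomial rings over a field *)

Section MpolyFactorial.

Variable K : fieldType.

Lemma factorial_field : factorial_domain K.
Proof.
by move=> x x0; exists x, [::]; split; rewrite ?big_nil ?mulr1 ?unitfE.
Qed.

Section Univariate.
Variable n : nat.

(** Made to be the inverse of [muni], so that factoriality passes to one more variable. *)
Let unmulti : {poly {mpoly K[n]}} -> {mpoly K[n.+1]} :=
  horner_eval 'X_ord_max \o map_poly (@mwiden n K).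

HB.instance Definition _ := GRing.RMorphism.on unmulti.

Lemma muniX (i : 'I_n) :
  muni ('X_(widen_ord (leqnSn n) i) : {mpoly K[n.+1]}) = ('X_i)%:P.
Proof.
rewrite /muni mmapX mmap1U; case: splitP => [j eq_j|j] /=.
  by congr ('X__)%:P; apply/val_inj; exact/esym/eq_j.
by move=> E; have := ltn_ord i; rewrite E ltnNge leq_addr.
Qed.

Lemma muniXmax : muni ('X_ord_max : {mpoly K[n.+1]}) = 'X.
Proof.
rewrite /muni mmapX mmap1U; case: splitP => [j eq_j|j] //=.
by have := ltn_ord j; rewrite -eq_j ltnn.
Qed.

Lemma unmultiC c : unmulti c%:P = mwiden c.
Proof. by rewrite /unmulti /= map_polyC /horner_eval hornerC. Qed.

Lemma muniK : cancel (@muni n K) unmulti.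
Proof.
apply: (@mpoly_rmorph_ext _ _ _ (unmulti \o @muni n K) idfun) => [c|i] /=.
  by rewrite muniC unmultiC mwidenC.
have [j ->|->] := unliftP ord_max i; last first.
  by rewrite muniXmax /unmulti /= map_polyX /horner_eval hornerX.
have -> : lift ord_max j = widen_ord (leqnSn n) j.
  by apply: val_inj; rewrite /= /bump leqNgt ltn_ord.
by rewrite muniX unmultiC mwidenX mnmwiden1.
Qed.

Lemma unmultiK : cancel unmulti (@muni n K).
Proof.
have muni_widen : forall c, muni (mwiden c) = c%:P :> {poly {mpoly K[n]}}.
  apply: (@mpoly_rmorph_ext _ _ _ (@muni n K \o @mwiden n K) polyC) => [c|i] /=.
    by rewrite mwidenC muniC.
  by rewrite mwidenX mnmwiden1 muniX.
elim/poly_ind => [|p c IHp]; first by rewrite !rmorph0.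
rewrite !rmorphD !rmorphM /= IHp unmultiC muni_widen.
by rewrite /unmulti /= map_polyX /horner_eval hornerX muniXmax.
Qed.

Lemma factorial_mpolyS :
  factorial_domain {mpoly K[n]} -> factorial_domain {mpoly K[n.+1]}.
Proof.
by move=> factn; apply: (factorial_isom muniK unmultiK); apply: factorial_poly.
Qed.

End Univariate.

Lemma factorial_mpoly n : factorial_domain {mpoly K[n]}.
Proof.
elim: n => [|n IHn]; last exact: factorial_mpolyS.
have mpoly0K : cancel (@mcoeff 0 K 0%MM) (@mpolyC 0 K) .
  move=> p; apply/esym/msize1_polyC; rewrite msizeE.
  by apply/bigmax_leqP_seq => m _ _; rewrite mdegE big_ord0.
by apply: (factorial_isom mpoly0K _ factorial_field) => c /=; rewrite mpolyCK.
Qed.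

Variable n : nat.
Implicit Types (p q : {mpoly K[n]}).

Lemma mpoly_unitP p : reflect (exists2 c, c != 0 & p = c%:MP) (p \is a GRing.unit).
Proof.
rewrite -[_ \is a _]/((p == (p@_0)%:MP) && (p@_0 \is a GRing.unit)).
apply: (iffP andP) => [[/eqP-> ]|[c c0 ->]]; last by rewrite mpolyCK eqxx unitfE.
by rewrite mpolyCK unitfE; exists p@_0.
Qed.

Lemma ex_prime_divisor p : p != 0 -> p \isn't a GRing.unit ->
  exists2 q, prime_elt q & divides q p.
Proof.
move=> p0 pU; have [u [s [uU sP pE]]] := factorial_mpoly p0.
case: s sP pE => [|q s] sP pE; first by rewrite pE big_nil mulr1 uU in pU.
exists q; first by apply: sP; rewrite mem_head.
by exists (u * \prod_(j <- s) j); rewrite pE big_cons mulrCA.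
Qed.

(** A prime is not constant, so dividing by it lowers the total degree and the process stops. *)
Lemma prime_elt_valuation q p : prime_elt q -> p != 0 ->
  exists k, exists2 g, p = q ^+ k * g & ~ divides q g.
Proof.
move=> qP; have [q0 qU _] := qP; have [k] := ubnP (msize p).
elim: k p => // k IHk p le_k p0.
have [[g pE]|ndq] := boolp.pselect (divides q p); last first.
  by exists 0%N, p; rewrite ?expr0 ?mul1r.
have g0 : g != 0 by apply: contraNneq p0 => g0; rewrite pE g0 mulr0.
have sz_q : (1 < msize q)%N.
  rewrite ltn_neqAle lt0n msize_poly_eq0 q0 andbT eq_sym.
  by apply: contra qU => /msize_poly1P ?; apply/mpoly_unitP.
have [|j [h gE ndh]] := IHk g _ g0.
  rewrite -ltnS (leq_trans _ le_k) // pE msizeM // ltnS.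
  by case: (msize q) sz_q => [|[|a]] //= _; rewrite addSn /= ltnS leq_addl.
by exists j.+1, h; rewrite // pE gE exprS mulrA.
Qed.

End MpolyFactorial.

(** * Rational cones *)

Section Pairing.
Variables (n : nat) (R : comPzRingType).
Implicit Types (u w : 'rV[R]_n) (x y : 'cV[R]_n).

Lemma pairingDl u w x : pairing (u + w) x = pairing u x + pairing w x.
Proof. by rewrite /pairing mulmxDl mxE. Qed.

Lemma pairingDr u x y : pairing u (x + y) = pairing u x + pairing u y.
Proof. by rewrite /pairing mulmxDr mxE. Qed.

Lemma pairingNl u x : pairing (- u) x = - pairing u x.
Proof. by rewrite /pairing mulNmx mxE. Qed.

Lemma pairingNr u x : pairing u (- x) = - pairing u x.
Proof. by rewrite /pairing mulmxN mxE. Qed.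

Lemma pairingBl u w x : pairing (u - w) x = pairing u x - pairing w x.
Proof. by rewrite pairingDl pairingNl. Qed.

Lemma pairingZl c u x : pairing (c *: u) x = c * pairing u x.
Proof. by rewrite /pairing -scalemxAl mxE. Qed.

Lemma pairingZr c u x : pairing u (c *: x) = c * pairing u x.
Proof. by rewrite /pairing -scalemxAr mxE. Qed.

Lemma pairing0l x : pairing 0 x = 0.
Proof. by rewrite /pairing mul0mx mxE. Qed.

Lemma pairing0r u : pairing u 0 = 0.
Proof. by rewrite /pairing mulmx0 mxE. Qed.

Lemma pairing_suml (I : Type) (s : seq I) F x :
  pairing (\sum_(i <- s) F i) x = \sum_(i <- s) pairing (F i) x.
Proof.
by apply: (big_morph (fun u => pairing u x)) => [u w|]; rewrite ?pairingDl ?pairing0l.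
Qed.

Lemma pairing_sumr (I : Type) (s : seq I) F u :
  pairing u (\sum_(i <- s) F i) = \sum_(i <- s) pairing u (F i).
Proof. by apply: big_morph => [x y|]; rewrite ?pairingDr ?pairing0r. Qed.

Lemma pairingMnl u x k : pairing (u *+ k) x = pairing u x *+ k.
Proof. by elim: k => [|k IHk]; rewrite ?mulr0n ?pairing0l // !mulrS pairingDl IHk. Qed.

Lemma pairing_delta k x : pairing (delta_mx 0 k) x = x k 0.
Proof.
by rewrite /pairing -rowE mxE.
Qed.

End Pairing.

(** * Finitely generated cones and Farkas' lemma *)

Section Farkas.
Variables (F : realFieldType) (n : nat).
Implicit Types (s t : seq 'cV[F]_n) (g h x y : 'cV[F]_n) (u : 'rV[F]_n).

(** One coefficient is split off per generator so that induction on the list applies; [in_cone_sum]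
    recovers the usual nonnegative combinations. *)
Fixpoint in_cone s x : Prop :=
  if s is g :: s' then exists2 c : F, 0 <= c & in_cone s' (x - c *: g)
  else x = 0.

Lemma in_cone0 s : in_cone s 0.
Proof. by elim: s => //= g s IHs; exists 0; rewrite // scale0r subr0. Qed.

Lemma in_coneD s x y : in_cone s x -> in_cone s y -> in_cone s (x + y).
Proof.
elim: s x y => [|g s IHs] x y /=; first by move=> -> ->; rewrite addr0.
move=> [c c0 cx] [d d0 dy]; exists (c + d); first exact: addr_ge0.
by rewrite scalerDl opprD addrACA; apply: IHs.
Qed.

Lemma in_coneZ s a x : 0 <= a -> in_cone s x -> in_cone s (a *: x).
Proof.
move=> a0; elim: s x => [|g s IHs] x /=; first by move=> ->; rewrite scaler0.
move=> [c c0 cx]; exists (a * c); first exact: mulr_ge0.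
by rewrite -scalerA -scalerBr; apply: IHs.
Qed.

Lemma in_cone_cons s g x : in_cone s x -> in_cone (g :: s) x.
Proof. by exists 0; rewrite // scale0r subr0. Qed.

Lemma mem_in_cone s g : g \in s -> in_cone s g.
Proof.
elim: s => // h s IHs; rewrite inE => /orP[/eqP->|/IHs]; last exact: in_cone_cons.
by exists 1; rewrite // scale1r subrr; apply: in_cone0.
Qed.

Lemma in_cone_sub s t x :
  (forall g, g \in s -> in_cone t g) -> in_cone s x -> in_cone t x.
Proof.
elim: s x => [|g s IHs] x st /=; first by move=> ->; apply: in_cone0.
move=> [c c0 cx]; rewrite -(subrK (c *: g) x); apply: in_coneD.
  by apply: IHs cx => h hs; apply: st; rewrite inE hs orbT.
by apply: in_coneZ => //; apply: st; rewrite mem_head.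
Qed.

Lemma in_cone_pairing_ge0 s u x :
  (forall g, g \in s -> 0 <= pairing u g) -> in_cone s x -> 0 <= pairing u x.
Proof.
elim: s x => [|g s IHs] x us /=; first by move=> ->; rewrite pairing0r.
move=> [c c0 /IHs cx]; rewrite -(subrK (c *: g) x) pairingDr pairingZr.
apply: addr_ge0; first by apply: cx => h hs; apply: us; rewrite inE hs orbT.
by apply: mulr_ge0 => //; apply: us; rewrite mem_head.
Qed.

Lemma in_cone_sum (I : eqType) (r : seq I) (g : I -> 'cV[F]_n) x : uniq r ->
  in_cone [seq g i | i <- r] x <->
  exists c : I -> F, (forall i, 0 <= c i) /\ x = \sum_(i <- r) c i *: g i.
Proof.
elim: r x => [|i r IHr] x /=.
  move=> _; split=> [->|[c [_ ->]]]; last by rewrite big_nil.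
  by exists (fun=> 0); rewrite big_nil.
move=> /andP[ir ur]; split=> [[c c0 /(IHr _ ur)[d [d0 dE]]]|[c [c0 ->]]].
  exists (fun j => if j == i then c else d j).
  split=> [j|]; first by case: eqP.
  rewrite big_cons eqxx -(subrK (c *: g i) x) addrC; congr (_ + _).
  rewrite dE; apply: eq_big_seq => j jr.
  by case: eqP ir => // <-; rewrite jr.
exists (c i) => //; apply/(IHr _ ur); exists c; split=> //.
by rewrite big_cons addrAC subrr add0r.
Qed.

(* Induction on the generators: if a functional [u] separating [x] from the
   cone over [s] is negative on the next generator [g], project along [g] to
   the hyperplane [u = 0]. *)
Lemma farkas s x :
  in_cone s x \/
  exists u, (forall g, g \in s -> 0 <= pairing u g) /\ pairing u x < 0.
Proof.
elim: {s}(size s) {-2}s (erefl (size s)) x => [|k IHk] s sz_s x.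
  rewrite (size0nil sz_s) /=.
  have [->|x0] := eqVneq x 0; first by left.
  right; have [i xi0] : exists i, x i 0 != 0.
    apply/existsP; apply: contraNT x0; rewrite negb_exists => /forallP x0.
    by apply/eqP/matrixP=> i j; rewrite ord1 mxE; apply/eqP/negbNE/x0.
  exists (- x i 0 *: delta_mx 0 i); split=> //.
  by rewrite pairingZl pairing_delta mulNr oppr_lt0 -expr2 exprn_even_gt0.
case: s sz_s => // g s [sz_s].
have [xs|[u [us ux]]] := IHk s sz_s x; first by left; apply: in_cone_cons.
have [ug|ug] := lerP 0 (pairing u g).
  right; exists u; split=> // h; rewrite inE => /orP[/eqP->//|]; exact: us.
pose pr y := y - (pairing u y / pairing u g) *: g.
have [|xs|[w [ws wx]]] := IHk (map pr s) _ (pr x); first by rewrite size_map.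
  left; rewrite -(subrK ((pairing u x / pairing u g) *: g) x); apply: in_coneD.
    apply: in_cone_sub xs => y /mapP[h hs ->]; apply: in_coneD.
      by apply: mem_in_cone; rewrite inE hs orbT.
    rewrite -scaleNr; apply: in_coneZ; last by apply: mem_in_cone; rewrite mem_head.
    by rewrite oppr_ge0 mulr_ge0_le0 ?us // invr_le0 ltW.
  apply: in_coneZ; last by apply: mem_in_cone; rewrite mem_head.
  by rewrite mulr_le0 ?invr_le0 // ltW.
right; pose w' := w - (pairing w g / pairing u g) *: u.
have w'E y : pairing w' y = pairing w (pr y).
  rewrite /w' /pr pairingBl pairingDr pairingNr pairingZl pairingZr.
  by congr (_ - _); rewrite mulrAC [RHS]mulrAC [pairing u y * _]mulrC.
exists w'; rewrite w'E; split=> // h; rewrite inE => /orP[/eqP->|hs].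
  by rewrite w'E /pr divff ?lt_eqF // scale1r subrr pairing0r.
by rewrite w'E; apply: ws; apply: map_f.
Qed.

Definition pointed s := forall x, in_cone s x -> in_cone s (- x) -> x = 0.

Definition irredundant s := forall g, g \in s -> ~ in_cone (rem g s) g.

Lemma in_cone_rem s g x : g \in s -> in_cone s x ->
  exists2 c : F, 0 <= c & in_cone (rem g s) (x - c *: g).
Proof.
move=> gs xs; suff: in_cone (g :: rem g s) x by [].
by apply: in_cone_sub xs => h; rewrite (perm_mem (perm_to_rem gs)); apply: mem_in_cone.
Qed.

(** This makes [g] span an extreme ray. For each other generator [h], Farkas' lemma separates [- h]
    from the cone generated by [g], [- g] and the rest; having both signs forces the functional to
    vanish on [g]. Summing over [h] gives strict positivity. *)
Lemma facet_functional s g : pointed s -> irredundant s -> g \in s ->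
  exists u, pairing u g = 0 /\ forall h, h \in rem g s -> 0 < pairing u h.
Proof.
move=> s_pointed s_irr gs.
have one h : h \in rem g s -> exists u,
    [/\ pairing u g = 0, forall h', h' \in rem g s -> 0 <= pairing u h'
      & 0 < pairing u h].
  move=> hs; have [/=|[u [us ux]]] := farkas [:: g, - g & rem g s] (- h).
    move=> [a a0 [b b0]]; set y := _ - _ => yt; exfalso.
    have E : (b - a) *: g = h + y.
      by rewrite /y scalerBl scalerN opprK; apply/matrixP=> i j; rewrite !mxE; ring.
    have ht : in_cone (rem g s) h by apply: mem_in_cone.
    (* A positive coefficient puts [g] in the cone of the others; otherwise [- h] lies in the cone,
       so [h = 0] by pointedness. Both contradict irredundance. *)
    have [ab|ab] := ltrP 0 (b - a).
      apply: (s_irr g gs).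
      suff: in_cone (rem g s) (((b - a)^-1 * (b - a)) *: g).
        by rewrite mulVf ?lt0r_neq0 // scale1r.
      rewrite -scalerA E.
      by apply: in_coneZ; [rewrite invr_ge0 ltW|apply: in_coneD].
    have h_s : h \in s by apply: mem_rem hs.
    have subs x : in_cone (rem g s) x -> in_cone s x.
      by apply: in_cone_sub => x' /mem_rem; apply: mem_in_cone.
    have h0 : h = 0.
      apply: s_pointed; first exact: mem_in_cone.
      have -> : - h = y + (- (b - a)) *: g.
        by rewrite scaleNr E opprD addrC subrK.
      apply: in_coneD; first exact: subs.
      by apply: in_coneZ; [rewrite oppr_ge0|apply: mem_in_cone].
    by apply: (s_irr h h_s); rewrite h0; apply: in_cone0.
  exists u; split.
  - apply/eqP; rewrite eq_le us ?mem_head // andbT -oppr_ge0 -pairingNr.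
    by apply: us; rewrite !inE eqxx orbT.
  - by move=> h' h's; apply: us; rewrite !inE h's !orbT.
  - by rewrite -oppr_lt0 -pairingNr.
suff [u [u1 u2 u3]] : exists u, [/\ pairing u g = 0,
    forall h, h \in rem g s -> 0 <= pairing u h
    & forall h, h \in rem g s -> 0 < pairing u h] by exists u.
have : {subset rem g s <= rem g s} by [].
elim: {1 4}(rem g s) => [|h t IHt] sub_t.
  by exists 0; split=> // [|h _]; rewrite ?pairing0l.
have [|u [u1 u2 u3]] := IHt; first by move=> x xt; apply: sub_t; rewrite inE xt orbT.
have [|w [w1 w2 w3]] := one h; first by apply: sub_t; rewrite mem_head.
exists (u + w); split=> [|x xt|x]; first by rewrite pairingDl u1 w1 addr0.
  by rewrite pairingDl addr_ge0 ?u2 ?w2.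
rewrite inE pairingDl => /orP[/eqP->|xt].
  by apply: ltr_wpDl => //; apply/u2/sub_t; rewrite mem_head.
by apply: ltr_wpDr; [apply/w2/sub_t; rewrite inE xt orbT|apply: u3].
Qed.

Lemma in_cone_eq0 s u x : (forall h, h \in s -> 0 < pairing u h) ->
  in_cone s x -> pairing u x = 0 -> x = 0.
Proof.
elim: s x => [|g s IHs] x us //= [c c0 cx] ux.
have us' h : h \in s -> 0 < pairing u h by move=> hs; apply: us; rewrite inE hs orbT.
have ug : 0 < pairing u g by apply: us; rewrite mem_head.
have := in_cone_pairing_ge0 (fun h hs => ltW (us' h hs)) cx.
rewrite pairingDr pairingNr pairingZr ux sub0r oppr_ge0 pmulr_lle0 // => c0'.
have {c0 c0'} c0 : c = 0 by apply/eqP; rewrite eq_le c0 c0'.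
by move: cx; rewrite c0 scale0r subr0 => /IHs; apply.
Qed.

Lemma ex_irredundant s :
  exists2 t, irredundant t & forall x, in_cone s x <-> in_cone t x.
Proof.
have [k] := ubnP (size s); elim: k s => // k IHk s le_k.
have [irr_s|] := boolp.pselect (irredundant s); first by exists s.
move=> /boolp.existsNP[g] /boolp.not_implyP[gs] /boolp.contrapT gsg.
have [|t irr_t tE] := IHk (rem g s).
  by rewrite size_rem // -ltnS prednK // lt0n size_eq0; case: s gs {gsg le_k}.
exists t => // x; rewrite -tE; split; last first.
  by apply: in_cone_sub => h /mem_rem; apply: mem_in_cone.
apply: in_cone_sub => h; rewrite (perm_mem (perm_to_rem gs)) inE.
by case/orP=> [/eqP->//|]; apply: mem_in_cone.
Qed.

End Farkas.

(** * Rays and dual semigroup of a rational cone *)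

Section RationalCone.

Lemma pairing_toQ n (m : 'rV[int]_n) (x : 'cV[int]_n) :
  pairing (toMQ m) (toNQ x) = (pairing m x)%:~R.
Proof. by rewrite /pairing /toMQ /toNQ -map_mxM mxE. Qed.

Lemma toNQ_inj n : injective (@toNQ n).
Proof.
move=> x y /matrixP E; apply/matrixP=> i j.
by have := E i j; rewrite !mxE => /intr_inj.
Qed.

Lemma toNQ_eq0 n (x : 'cV[int]_n) : (toNQ x == 0) = (x == 0).
Proof. by rewrite -(inj_eq (@toNQ_inj n)) /toNQ map_mx0. Qed.

Lemma clear_denominators n (u : 'rV[rat]_n) :
  exists (d : nat) (m : 'rV[int]_n), (0 < d)%N /\ toMQ m = d%:R *: u.
Proof.
pose D := \prod_k denq (u 0 k).
have D0 : 0 < D by apply: prodr_gt0 => k _; apply: denq_gt0.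
exists `|D|%N, (\row_k (numq (u 0 k) * \prod_(l | l != k) denq (u 0 l))); split.
  by rewrite absz_gt0 gt_eqF.
apply/rowP=> k; rewrite !mxE -[u 0 k in RHS]divq_num_den.
have -> : `|D|%N%:R = D%:~R :> rat by rewrite -[D in RHS]gtz0_abs.
have -> : D = denq (u 0 k) * \prod_(l | l != k) denq (u 0 l) by rewrite /D (bigD1 k).
rewrite !intrM; set P := (\prod_(_ < _ | _) _)%:~R.
by field; rewrite intr_eq0 denq_eq0.
Qed.

Variables (n : nat) (sigma : 'cV[rat]_n -> Prop).
Hypothesis sigma_polyhedral : polyhedral sigma.
Hypothesis sigma_strongly_convex : strongly_convex sigma.
Variables (r : nat) (v : 'I_r -> 'cV[int]_n).
Hypothesis v_rays : lists_primitive_vectors sigma v.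

Let V := [seq toNQ (v i) | i <- enum 'I_r].

Lemma ray_sub rho x : is_ray sigma rho -> rho x -> sigma x.
Proof. by case=> -[u _ uE] _ /uE[]. Qed.

(** Each vector is a multiple of the other by a factor at least 1; the two factors have product 1,
    so both are 1. *)
Lemma primitive_vector_unique rho rho' w w' :
  is_ray sigma rho' -> is_primitive_vector rho w ->
  is_primitive_vector rho' w' -> rho (toNQ w') -> w = w'.
Proof.
move=> [_ [h h0 hE]] [rw w0 wP] [rw' w'0 w'P] rww'.
have [c c1 w'E] := wP _ rww' w'0.
have c0 : 0 < c by apply: lt_le_trans c1.
have wE' : toNQ w = c^-1 *: toNQ w' by rewrite w'E scalerA mulVf ?scale1r ?gt_eqF.
have [|d d1 wE] := w'P w _ w0.
  have /hE[a a0 aE] := rw'; apply/hE; exists (c^-1 * a).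
    by rewrite mulr_ge0 // invr_ge0 ltW.
  by rewrite wE' aE scalerA.
have cd1 : c * d = 1.
  apply/eqP; rewrite -subr_eq0; move: (toNQ_eq0 w'); rewrite (negPf w'0).
  move/negbT; apply: contraNT => cd; have : (c * d - 1) *: toNQ w' = 0.
    by rewrite scalerBl scale1r -scalerA -wE -w'E subrr.
  by move/eqP; rewrite scaler_eq0 (negPf cd).
have c_1 : c = 1.
  by apply/eqP; rewrite eq_le c1 andbT -cd1 ler_peMr // ltW.
by apply: toNQ_inj; rewrite w'E c_1 scale1r.
Qed.

Lemma sigma_v i : sigma (toNQ (v i)).
Proof. by case: v_rays => _ /(_ i)[rho ray_rho [rho_v _ _]] _; apply: ray_sub rho_v. Qed.

(** In an irredundant generating family each generator spans a ray, by [facet_functional], hence is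
    a positive multiple of some [v i]. *)
Lemma cone_generated x : sigma x <-> in_cone V x.
Proof.
have [k [g gE]] := sigma_polyhedral.
have gE' y : sigma y <-> in_cone [seq g i | i <- enum 'I_k] y.
  rewrite gE; rewrite in_cone_sum ?enum_uniq //.
  by split=> -[c [c0 ->]]; exists c; rewrite big_enum.
have [t irr_t tE] := ex_irredundant [seq g i | i <- enum 'I_k].
have {}tE y : sigma y <-> in_cone t y by rewrite gE' tE.
have t_pointed : pointed t.
  by move=> y /tE sy /tE sNy; apply: sigma_strongly_convex.
have ray h : h \in t -> is_ray sigma (fun y => exists2 c : rat, 0 <= c & y = c *: h).
  move=> ht; have h0 : h != 0.
    by apply/eqP=> h0; apply: (irr_t h ht); rewrite h0; apply: in_cone0.
  split; last by exists h.
  have [u [uh ut]] := facet_functional t_pointed irr_t ht.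
  have ut_ge0 h' : h' \in t -> 0 <= pairing u h'.
    rewrite (perm_mem (perm_to_rem ht)) inE => /orP[/eqP->|/ut/ltW//].
    by rewrite uh.
  exists u => [y /tE|y]; first exact: in_cone_pairing_ge0.
  split=> [[c c0 ->]|[/tE/(in_cone_rem ht)[c c0 yt]]].
    rewrite pairingZr uh mulr0; split=> //; apply/tE/in_coneZ => //.
    exact: mem_in_cone.
  move=> uy; exists c => //; apply/eqP; rewrite -subr_eq0; apply/eqP.
  by apply: in_cone_eq0 ut yt _; rewrite pairingDr pairingNr pairingZr uy uh mulr0 subr0.
rewrite tE; split; apply: in_cone_sub => h.
  move=> ht; have [_ _ /(_ _ (ray h ht))[i [[c c0 cE] vi0 _]]] := v_rays.
  have c_neq0 : c != 0.
    by move: vi0; rewrite -toNQ_eq0 cE scaler_eq0 negb_or => /andP[].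
  rewrite -[h]scale1r -(mulVf c_neq0) -scalerA -cE; apply: in_coneZ.
    by rewrite invr_ge0.
  by apply/mem_in_cone/map_f; rewrite mem_enum.
by case/mapP=> i _ ->; apply/tE/sigma_v.
Qed.

Lemma cone_generatedP x : sigma x <->
  exists c : 'I_r -> rat, (forall i, 0 <= c i) /\ x = \sum_i c i *: toNQ (v i).
Proof.
rewrite cone_generated in_cone_sum ?enum_uniq //.
by split=> -[c [c0 ->]]; exists c; rewrite big_enum.
Qed.

Lemma dual_semigroupP (m : 'rV[int]_n) :
  reflect (forall i, 0 <= pairing m (v i)) (m \in dual_semigroup sigma).
Proof.
apply: (iffP (boolp.asboolP _)) => [mP i|mP x /cone_generatedP[c [c0 ->]]].
  by rewrite -(ler0z rat) -pairing_toQ; apply/mP/sigma_v.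
rewrite pairing_sumr sumr_ge0 // => i _.
by rewrite pairingZr mulr_ge0 // pairing_toQ ler0z.
Qed.

Let V_uniq : uniq V.
Proof.
rewrite map_inj_uniq ?enum_uniq // => i j /toNQ_inj.
by case: v_rays => v_inj _ _ /v_inj.
Qed.

(** Let [u] cut out the ray of [v i]. Either [u] is positive on the other vectors, and no nonzero
    combination of them lies where [u] vanishes, or [u] kills another [v j], which then lies on the
    same ray and equals [v i]. *)
Let V_irredundant : irredundant V.
Proof.
move=> h /mapP[i _ ->] rem_i.
have [_ /(_ i)[rho ray_rho rho_v] _] := v_rays; have [rv vi0 _] := rho_v.
have [[u u_dual uE] _] := ray_rho.
have [H|] := boolp.pselect (forall h, h \in rem (toNQ (v i)) V -> 0 < pairing u h).
  have /uE[_ uvi] := rv.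
  have /eqP := in_cone_eq0 H rem_i uvi.
  by rewrite toNQ_eq0 (negPf vi0).
move/boolp.existsNP=> [y] /boolp.not_implyP[].
rewrite mem_rem_uniq // inE => /andP[yi /mapP[j _ yE]].
move/negP; rewrite -leNgt => uy; case/eqP: yi; rewrite yE; congr toNQ.
have uvj : pairing u (toNQ (v j)) = 0.
  by apply/eqP; rewrite eq_le -{1}yE uy u_dual //; apply: sigma_v.
have [_ /(_ j)[rho' ray_rho' rho'_v] _] := v_rays.
apply/esym; apply: (primitive_vector_unique ray_rho' rho_v rho'_v).
by apply/uE; split=> //; apply: sigma_v.
Qed.

(** In the Cox ring this is a monomial of degree 0 containing every variable except the [i]-th.
    Adding a large multiple of [m] repairs negative exponents without touching the [i]-th one. *)
Lemma ex_facet i : exists m : 'rV[int]_n,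
  pairing m (v i) = 0 /\ forall j, j != i -> 0 < pairing m (v j).
Proof.
have V_pointed : pointed V.
  by move=> x /cone_generated sx /cone_generated; apply: sigma_strongly_convex.
have viV : toNQ (v i) \in V by apply: map_f; rewrite mem_enum.
have [u [ui uj]] := facet_functional V_pointed V_irredundant viV.
have [d [m [d0 mE]]] := clear_denominators u.
have mP j : (pairing m (v j))%:~R = d%:R * pairing u (toNQ (v j)).
  by rewrite -pairing_toQ mE pairingZl.
exists m; split.
  by apply/eqP; rewrite -(intr_eq0 rat) mP ui mulr0.
move=> j ji; rewrite -(ltr0z rat) mP mulr_gt0 ?ltr0n //; apply: uj.
rewrite mem_rem_uniq // inE; apply/andP; split; last by apply: map_f; rewrite mem_enum.
rewrite (inj_eq (@toNQ_inj n)).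
by case: v_rays => v_inj _ _; rewrite (inj_eq v_inj).
Qed.

(* The smallest positive value [d] of [pairing ^~ (v i)] divides every
   coordinate of [v i], so that [v i = d *: w] with [w] on the same ray. *)
Lemma ex_pairing_eq1 i : exists m : 'rV[int]_n, pairing m (v i) = 1.
Proof.
have [_ /(_ i)[rho [_ [h h0 hE]] [rv vi0 vP]] _] := v_rays.
pose P d := boolp.asbool ((0 < d)%N /\ exists m, pairing m (v i) = Posz d).
have exP : exists d, P d.
  have [k vk] : exists k, v i k 0 != 0.
    apply/existsP; apply: contraNT vi0; rewrite negb_exists => /forallP x0.
    by apply/eqP/matrixP=> k j; rewrite ord1 mxE; apply/eqP/negbNE/x0.
  set a := v i k 0 in vk *; exists `|a|%N; apply/boolp.asboolP; split; first by rewrite absz_gt0.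
  exists (sgz a *: delta_mx 0 k).
  by rewrite pairingZl pairing_delta abszEsg.
case: (ex_minnP exP) => d /boolp.asboolP[d0 [m mE]] d_min.
have dvd k : (d %| v i k 0%R)%Z.
  have d_neq0 : Posz d != 0 by rewrite eqz_nat -lt0n.
  apply/dvdz_mod0P; have := modz_ge0 (v i k 0) d_neq0.
  case E: (v i k 0%R %% d)%Z => [e|//] _; congr Posz; apply/eqP; rewrite -leqn0 leqNgt.
  apply/negP=> e0; have : P e.
    apply/boolp.asboolP; split=> //; exists (delta_mx 0 k - (v i k 0%R %/ d)%Z *: m).
    by rewrite pairingBl pairingZl pairing_delta mE -E.
  move/d_min; rewrite leqNgt => /negP; apply.
  by rewrite -ltz_nat -E ltz_pmod.
pose w : 'cV[int]_n := \col_k (v i k 0%R %/ d)%Z.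
have vE : v i = Posz d *: w.
  by apply/colP=> k; rewrite !mxE mulrC divzK.
have vEQ : toNQ (v i) = d%:R *: toNQ w by rewrite vE /toNQ map_mxZ.
have dQ0 : d%:R != 0 :> rat by rewrite pnatr_eq0 -lt0n.
have wEQ : toNQ w = d%:R^-1 *: toNQ (v i) by rewrite vEQ scalerA mulVf ?scale1r.
have w0 : w != 0 by apply: contraNneq vi0 => w0; rewrite vE w0 scaler0.
have [|c c1 wE] := vP w _ w0.
  have /hE[a a0 aE] := rv; apply/hE; exists (d%:R^-1 * a).
    by rewrite mulr_ge0 // invr_ge0 ler0n.
  by rewrite wEQ aE scalerA.
exists m; rewrite mE; congr Posz.
have /eqP : (d%:R^-1 - c) *: toNQ (v i) = 0 by rewrite scalerBl -wE -wEQ subrr.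
rewrite scaler_eq0 toNQ_eq0 (negPf vi0) orbF subr_eq0 => /eqP dc.
apply/eqP; rewrite eqn_leq d0 andbT -(ler_nat rat).
by move: c1; rewrite -dc invf_ge1 // ltr0n.
Qed.

End RationalCone.

(** * Divisor classes of monomials *)

Section ClassOfMonomials.
Variables (n r : nat) (v : 'I_r -> 'cV[int]_n).

Lemma divclass_is_zmod_morphism : zmod_morphism (divclass v).
Proof. by move=> D D'; rewrite /divclass raddfB. Qed.

HB.instance Definition _ :=
  GRing.isZmodMorphism.Build 'rV[int]_r (Cl v) (divclass v) divclass_is_zmod_morphism.

Lemma divclass_surj (u : Cl v) : exists D, divclass v D = u.
Proof. by exists (repr u); rewrite /divclass reprK. Qed.

Lemma div_chiE m i : div_chi v m 0 i = pairing m (v i).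
Proof.
rewrite /div_chi summxE (bigD1 i) //= !mxE !eqxx mulr1 big1 ?addr0 // => j ji.
by rewrite !mxE eq_sym (negPf ji) andbF mulr0.
Qed.

Lemma divclass_eq0 D :
  divclass v D = 0 <-> exists m, forall i, D 0 i = pairing m (v i).
Proof.
have -> : divclass v D = 0 <-> D \in principal v.
  rewrite -[D in D \in _]subr0 Quotient.idealrBE -[\pi_(_) 0]/(divclass v 0) raddf0.
  by split=> /eqP.
split=> [/boolp.asboolP[m ->]|[m mE]]; first by exists m => i; rewrite div_chiE.
by apply/boolp.asboolP; exists m; apply/rowP=> i; rewrite div_chiE.
Qed.

Definition mclass (e : 'X_{1..r}) : Cl v :=
  \sum_(i < r) divclass v (prime_div i) *+ e i.

Lemma mclass0 : mclass 0%MM = 0.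
Proof. by rewrite /mclass big1 // => i _; rewrite mnm0E. Qed.

Lemma mclassD e e' : mclass (e + e')%MM = mclass e + mclass e'.
Proof. by rewrite /mclass -big_split; apply: eq_bigr => i _; rewrite mnmDE mulrnDr. Qed.

Lemma mclass1 i : mclass U_(i)%MM = divclass v (prime_div i).
Proof.
rewrite /mclass (bigD1 i) //= mnm1E eqxx big1 ?addr0 // => j ji.
by rewrite mnm1E eq_sym (negPf ji).
Qed.

Lemma divclass_sum D : divclass v D = \sum_(i < r) divclass v (prime_div i) *~ D 0 i.
Proof.
rewrite {1}[D]row_sum_delta raddf_sum; apply: eq_bigr => i _.
by rewrite -[_ *: _]/(D 0 i *: prime_div i) -[D 0 i in LHS]intz scaler_int raddfMz.
Qed.

Lemma mclassE e : mclass e = divclass v (\row_i (e i)%:Z).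
Proof. by rewrite divclass_sum; apply: eq_bigr => i _; rewrite mxE pmulrn. Qed.

Lemma mclass_eq0 e :
  mclass e = 0 <-> exists m, forall i, (e i)%:Z = pairing m (v i).
Proof.
rewrite mclassE divclass_eq0.
by split=> -[m mE]; exists m => i; move: (mE i); rewrite mxE.
Qed.

(** The absolute value only serves to produce natural numbers; the intended arguments are characters
    in the dual cone. *)
Definition mdiv (m : 'rV[int]_n) : 'X_{1..r} := [multinom `|pairing m (v i)|%N | i < r].

Lemma mdivE m i : (forall i, 0 <= pairing m (v i)) -> (mdiv m i)%:Z = pairing m (v i).
Proof. by move=> m0; rewrite mnmE gez0_abs. Qed.

Lemma mdivD m m' : (forall i, 0 <= pairing m (v i)) ->
  (forall i, 0 <= pairing m' (v i)) -> mdiv (m + m') = (mdiv m + mdiv m')%MM.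
Proof.
move=> m0 m'0; apply/mnmP=> i; apply/eqP; rewrite -eqz_nat mnmDE PoszD !mdivE //.
  by rewrite pairingDl.
by move=> j; rewrite pairingDl addr_ge0.
Qed.

Lemma mclass_mdiv m : (forall i, 0 <= pairing m (v i)) -> mclass (mdiv m) = 0.
Proof. by move=> m0; apply/mclass_eq0; exists m => i; apply: mdivE. Qed.

Hypothesis v_facet : forall i, exists m : 'rV[int]_n,
  pairing m (v i) = 0 /\ forall j, j != i -> 0 < pairing m (v j).
Hypothesis v_primitive : forall i, exists m : 'rV[int]_n, pairing m (v i) = 1.

(** From any divisor of class [u], subtract the multiple of [div_chi v p], where
    [pairing p (v i) = 1], that clears the [i]-th coefficient; then add a large multiple of the
    character that vanishes at [v i] and is at least 1 on the other rays. *)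
Lemma ex_mclass_avoiding (u : Cl v) i : exists e, mclass e = u /\ e i = 0%N.
Proof.
have [D <-] := divclass_surj u.
have [f [fi fj]] := v_facet i; have [p pi] := v_primitive i.
pose a j := D 0 j - D 0 i * pairing p (v j).
pose N := \sum_j `|a j|.
have aN j : 0 <= a j + N.
  rewrite -lerBlDl sub0r; apply: le_trans (_ : `|a j| <= N); first by rewrite ler_normr lexx orbT.
  by rewrite /N (bigD1 j) //= lerDl sumr_ge0.
pose m := N *: f - D 0 i *: p.
pose b j := D 0 j + pairing m (v j).
have bE j : b j = a j + N * pairing f (v j).
  by rewrite /b /a pairingBl !pairingZl addrAC addrA.
have b_ge0 j : 0 <= b j.
  rewrite bE; have [->|ji] := eqVneq j i.
    by rewrite fi mulr0 addr0 /a pi mulr1 subrr.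
  apply: le_trans (aN j) _; rewrite lerD2l ler_peMr ?sumr_ge0 //.
  by rewrite -gtz0_ge1 fj.
exists [multinom `|b j|%N | j < r]; split; last first.
  by rewrite mnmE bE fi mulr0 addr0 /a pi mulr1 subrr.
rewrite mclassE; apply/eqP; rewrite -subr_eq0 -raddfB; apply/eqP/divclass_eq0.
by exists m => j; rewrite !mxE mnmE gez0_abs // /b addrC addKr.
Qed.

(** The character [f] is positive off [v i0] and [p] supplies the value 1 there; the factor [N + 1]
    outweighs every negative value of [p]. *)
Lemma ex_interior : exists m : 'rV[int]_n, forall i, 0 < pairing m (v i).
Proof.
have [i0|] := pickP 'I_r; last by move=> no; exists 0 => i; have := no i.
have [f [fi fj]] := v_facet i0; have [p pi] := v_primitive i0.
pose N := \sum_j `|pairing p (v j)|.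
exists (p + (N + 1) *: f) => j; rewrite pairingDl pairingZl.
have [->|ji] := eqVneq j i0; first by rewrite fi pi mulr0 addr0.
have pN : - pairing p (v j) <= N.
  apply: le_trans (_ : `|pairing p (v j)| <= N); first by rewrite ler_normr lexx orbT.
  by rewrite /N (bigD1 j) //= lerDl sumr_ge0.
rewrite -ltrBlDl sub0r; apply: le_lt_trans pN _.
apply: lt_le_trans (_ : N + 1 <= _); first by rewrite ltrDl.
by rewrite ler_peMr ?addr_ge0 ?sumr_ge0 // -gtz0_ge1 fj.
Qed.

End ClassOfMonomials.

(** * The grading of the Cox ring *)

Section InfiniteField.
Variables (K : fieldType) (charK0 : [pchar K] =i pred0).

Lemma natr_inj_pchar0 : injective (fun k : nat => k%:R : K).
Proof.
have nat0 := (pcharf0P K).1 charK0.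
suff H (k l : nat) : (k <= l)%N -> k%:R = l%:R :> K -> k = l.
  by move=> k l E; case/orP: (leq_total k l) => /H; [apply|move=> H'; apply/esym/H'].
move=> kl E; apply/eqP; rewrite eqn_leq kl /= -subn_eq0.
by rewrite -nat0 natrB // E subrr.
Qed.

Lemma poly_vanishing (p : {poly K}) : (forall c, p.[c] = 0) -> p = 0.
Proof.
move=> p0; apply: boolp.contrapT => /eqP p_neq0.
pose s : seq K := [seq k%:R | k <- iota 0 (size p)].
have s_uniq : uniq s by rewrite map_inj_uniq ?iota_uniq //; apply: natr_inj_pchar0.
have s_root : all (root p) s by apply/allP=> c _; rewrite rootE p0.
by have := max_poly_roots p_neq0 s_root s_uniq; rewrite size_map size_iota ltnn.
Qed.

Lemma mpoly_vanishing r (p : {mpoly K[r]}) : (forall y, p.@[y] = 0) -> p = 0.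
Proof.
elim: r p => [|r IHr] p p0.
  have pE : p = (p@_0)%:MP.
    apply: msize1_polyC; rewrite msizeE.
    by apply/bigmax_leqP_seq => m _ _; rewrite mdegE big_ord0.
  by have := p0 (fun=> 0); rewrite pE mevalC => ->.
have evE (y : 'I_r -> K) c : (map_poly (meval y) (muni p)).[c] = 0.
  pose y' (i : 'I_r.+1) := if unlift ord_max i is Some j then y j else c.
  rewrite -(p0 y').
  apply: (@mpoly_rmorph_ext _ _ _
    (horner_eval c \o map_poly (meval y) \o @muni r K) (meval y')) => [a|i] /=.
    by rewrite muniC map_polyC /horner_eval hornerC /= !mevalC.
  have [j ->|->] := unliftP ord_max i; last first.
    by rewrite muniXmax map_polyX /horner_eval hornerX mevalXU /y' unlift_none.
  rewrite mevalXU /y' liftK.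
  have -> : lift ord_max j = widen_ord (leqnSn r) j.
    by apply: val_inj; rewrite /= /bump leqNgt ltn_ord.
  by rewrite muniX map_polyC /horner_eval hornerC /= mevalXU.
suff mp0 : muni p = 0 by rewrite -(muniK p) mp0 raddf0.
apply/polyP=> k; rewrite coef0; apply: IHr => y.
by have /polyP/(_ k) := poly_vanishing (evE y); rewrite coef0 coef_map.
Qed.

End InfiniteField.

Section PrimeVariables.
Variables (K : fieldType) (r : nat).
Implicit Types (p q : {mpoly K[r]}) (i j : 'I_r).

(** The kernel is the ideal generated by ['X_i] and the image lies in a domain, which makes ['X_i]
    prime. *)
Let kill i : {mpoly K[r]} -> {mpoly K[r]} :=
  msubst (fun j => if j == i then 0 else 'X_j : {mpoly K[r]}).

Let killX i (m : 'X_{1..r}) : kill i 'X_[m] = if m i == 0%N then 'X_[m] else 0.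
Proof.
rewrite /kill msubstXm; case: ifP => [/eqP mi|mi].
  rewrite mpolyXE_id; apply: eq_bigr => j _; case: eqP => // ->.
  by rewrite mi !expr0.
by rewrite (bigD1 i) //= eqxx expr0n mi mul0r.
Qed.

Lemma divides_monomial (m m' : 'X_{1..r}) :
  (m <= m')%MM -> divides 'X_[m] ('X_[m'] : {mpoly K[r]}).
Proof. by move=> le_m; exists 'X_[m' - m]; rewrite -mpolyXD addmC submK. Qed.

Let kill_mod i p : divides 'X_i (p - kill i p).
Proof.
elim/mpolyind: p => [|c m p _ _ IHp].
  by rewrite /kill raddf0 subr0; exists 0; rewrite mulr0.
rewrite /kill raddfD /= linearZ /= -/(kill i) opprD addrACA -scalerBr killX.
apply: dividesD => //; rewrite -mul_mpolyC; apply: dividesMr.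
case: ifP => [_|/negbT mi]; first by rewrite subrr; exists 0; rewrite mulr0.
rewrite subr0; apply: divides_monomial; apply/mnm_lepP => j.
by rewrite mnm1E; case: eqP => // <-; rewrite lt0n.
Qed.

Let dividesX_kill i p : divides 'X_i p <-> kill i p = 0.
Proof.
split=> [[q ->]|kp0]; last by have := kill_mod i p; rewrite kp0 subr0.
by rewrite /kill rmorphM /= -/(kill i) killX mnm1E eqxx mul0r.
Qed.

Lemma mpolyX_neq0 (m : 'X_{1..r}) : 'X_[m] != 0 :> {mpoly K[r]}.
Proof. by rewrite -msize_poly_eq0 msizeX. Qed.

Lemma prime_X i : prime_elt ('X_i : {mpoly K[r]}).
Proof.
split; first exact: mpolyX_neq0.
  apply/negP => /mpoly_unitP[c c0] /(congr1 (mcoeff U_(i)%MM))/eqP.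
  by rewrite mcoeffXU mcoeffC eqxx -mdeg_eq0 mdeg1 mulr0 oner_eq0.
move=> p q /dividesX_kill; rewrite /kill rmorphM /= => /eqP.
by rewrite mulf_eq0 => /orP[] /eqP /dividesX_kill; [left|right].
Qed.

Lemma dividesX_mono i (m : 'X_{1..r}) :
  divides ('X_i : {mpoly K[r]}) 'X_[m] <-> (0 < m i)%N.
Proof.
rewrite dividesX_kill killX lt0n; case: eqP => // _.
by split=> // /eqP; rewrite (negPf (mpolyX_neq0 m)).
Qed.

Lemma divides_trans (R : idomainType) (x y z : R) :
  divides x y -> divides y z -> divides x z.
Proof. by move=> dxy [w ->]; apply: dividesMl. Qed.

Lemma prime_divides_mono q (m : 'X_{1..r}) : prime_elt q -> divides q 'X_[m] ->
  exists i, (0 < m i)%N /\ divides q 'X_i.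
Proof.
move=> qP; rewrite mpolyXE_id => /(prime_elt_prod qP)[i _].
case: (posnP (m i)) => [->|mi].
  rewrite expr0 => /divides_unitr/(_ (unitr1 _)).
  by case: qP => _ /negPf->.
by move/(prime_elt_exp qP) => dq; exists i.
Qed.

Lemma prime_divides_one_variable q i j :
  prime_elt q -> divides q 'X_i -> divides q 'X_j -> i = j.
Proof.
move=> qP /(prime_elt_sym qP (prime_X i)) diq dqj.
have /dividesX_mono := divides_trans diq dqj.
by rewrite mnm1E; case: eqP.
Qed.

End PrimeVariables.

Section Grading.
Variables (n r : nat) (v : 'I_r -> 'cV[int]_n) (K : fieldType).
Implicit Types (p q : {mpoly K[r]}) (u w : Cl v).
Local Notation cox := (@cox_component n r v K).

Definition compo u p : {mpoly K[r]} :=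
  \sum_(m <- msupp p | mclass v m == u) p@_m *: 'X_[m].

Lemma mcoeff_compo u p m : (compo u p)@_m = if mclass v m == u then p@_m else 0.
Proof.
rewrite /compo big_mkcond /= raddf_sum /=.
have E m' : (if mclass v m' == u then p@_m' *: 'X_[m'] else 0)@_m =
    if m' == m then (if mclass v m == u then p@_m else 0) else 0.
  case: (m' =P m) => [->|/eqP m'm].
    by case: ifP => _; rewrite ?mcoeff0 // mcoeffZ mcoeffX eqxx mulr1.
  by case: ifP => _; rewrite ?mcoeff0 // mcoeffZ mcoeffX (negPf m'm) mulr0.
rewrite (eq_bigr _ (fun m' _ => E m')).
have [mp|mp] := boolP (m \in msupp p).
  rewrite (bigD1_seq m) ?msupp_uniq //= eqxx big1 ?addr0 // => m' m'm.
  by rewrite (negPf m'm).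
rewrite big_seq big1 => [|m' m'p]; first by rewrite memN_msupp_eq0 // if_same.
by case: eqP m'p mp => // -> ->.
Qed.

Lemma compo_is_linear u : linear (compo u).
Proof.
move=> c p q; apply/mpolyP=> m; rewrite mcoeffD mcoeffZ !mcoeff_compo.
by rewrite mcoeffD mcoeffZ; case: ifP; rewrite // mulr0 addr0.
Qed.

HB.instance Definition _ u :=
  GRing.isLinear.Build K {mpoly K[r]} {mpoly K[r]} _ (compo u) (compo_is_linear u).

Lemma coxP u p : cox u p <-> forall m, p@_m != 0 -> mclass v m = u.
Proof. by split=> H m; [rewrite -mcoeff_msupp|rewrite mcoeff_msupp]; apply: H. Qed.

Lemma cox_compo u p : cox u p <-> compo u p = p.
Proof.
rewrite coxP; split=> [up|<- m].
  apply/mpolyP=> m; rewrite mcoeff_compo; case: eqP => // mu.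
  by apply/esym/eqP/negPn/negP => /up.
by rewrite mcoeff_compo; case: (mclass v m =P u) => // _; rewrite eqxx.
Qed.

Lemma compo_cox u p : cox u (compo u p).
Proof. by apply/coxP=> m; rewrite mcoeff_compo; case: (mclass v m =P u) => // _; rewrite eqxx. Qed.

Lemma compo_other u w p : cox u p -> u != w -> compo w p = 0.
Proof.
move=> /coxP up uw; apply/mpolyP=> m; rewrite mcoeff_compo mcoeff0.
case: eqP => // mw; apply/eqP/negPn/negP => /up mu.
by rewrite -mu mw eqxx in uw.
Qed.

Lemma compo_neq0 p : p != 0 -> exists u, compo u p != 0.
Proof.
move=> p0; have [m mp] : exists m, p@_m != 0.
  have: msupp p != [::] by rewrite msupp_eq0.
  case E: (msupp p) => [//|m s] _; exists m.
  by rewrite -mcoeff_msupp E mem_head.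
exists (mclass v m); apply: contraNneq mp => c0.
by move: (mcoeff_compo (mclass v m) p m); rewrite c0 mcoeff0 eqxx => <-.
Qed.

Lemma compo_sum (d : {mpoly K[r]} -> Prop) p :
  d 0 -> (forall f g, d f -> d g -> d (f + g)) ->
  (forall u, d (compo u p)) -> d p.
Proof.
move=> d0 dD dp; pose s := undup [seq mclass v m | m <- msupp p].
suff -> : p = \sum_(u <- s) compo u p by elim/big_ind: _.
apply/mpolyP=> m; rewrite raddf_sum /=.
under eq_bigr do rewrite mcoeff_compo.
have [mp|mp] := boolP (m \in msupp p); last first.
  by rewrite memN_msupp_eq0 // big1 // => u _; rewrite if_same.
rewrite (bigD1_seq (mclass v m)) ?undup_uniq ?mem_undup ?map_f //= eqxx.
by rewrite big1 ?addr0 // => u; rewrite eq_sym => /negPf->.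
Qed.

Lemma coxX m : cox (mclass v m) 'X_[m].
Proof. by move=> m'; rewrite msuppX inE => /eqP->. Qed.

Lemma coxXU i : cox (divclass v (prime_div i)) 'X_i.
Proof. by rewrite -mclass1; apply: coxX. Qed.

Lemma cox0 u : cox u 0.
Proof. by apply/cox_compo; rewrite raddf0. Qed.

Lemma coxD u p q : cox u p -> cox u q -> cox u (p + q).
Proof. by move=> /cox_compo pu /cox_compo qu; apply/cox_compo; rewrite raddfD /= pu qu. Qed.

Lemma coxZ u c p : cox u p -> cox u (c *: p).
Proof. by move=> /cox_compo pu; apply/cox_compo; rewrite linearZ /= pu. Qed.

Lemma cox_sum u (I : Type) (s : seq I) (P : pred I) F :
  (forall i, P i -> cox u (F i)) -> cox u (\sum_(i <- s | P i) F i).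
Proof. by move=> uF; elim/big_ind: _ => //; [apply: cox0|apply: coxD]. Qed.

Lemma compoX u m : compo u 'X_[m] = if mclass v m == u then 'X_[m] else 0.
Proof.
case: eqP => [<-|/eqP mu]; first exact/cox_compo/coxX.
by rewrite (compo_other _ mu) //; apply: coxX.
Qed.

(** Only one factor has to be homogeneous, so a factorization into inhomogeneous elements can be
    compared degree by degree. *)
Lemma compoM u w p q : cox u p -> compo (u + w) (p * q) = p * compo w q.
Proof.
move=> up; rewrite [in LHS](mpolyE p) [in RHS](mpolyE p) !mulr_suml raddf_sum /=.
rewrite big_seq [RHS]big_seq; apply: eq_bigr => m mp.
rewrite -!scalerAl linearZ /=; congr (_ *: _).
rewrite [in LHS](mpolyE q) [in RHS](mpolyE q) mulr_sumr !raddf_sum /= mulr_sumr.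
apply: eq_bigr => m' _; rewrite -scalerAr !linearZ /= -scalerAr; congr (_ *: _).
rewrite -mpolyXD !compoX mclassD [mclass v m]up // (inj_eq (addrI u)).
by case: ifP => _; rewrite ?mulr0 // mpolyXD.
Qed.

Lemma coxM u w p q : cox u p -> cox w q -> cox (u + w) (p * q).
Proof. by move=> up /cox_compo wq; apply/cox_compo; rewrite compoM // wq. Qed.

Lemma cox1 : cox 0 1.
Proof. by rewrite -(mclass0 v) -mpolyX0; apply: coxX. Qed.

Lemma coxC c : cox 0 c%:MP.
Proof. by rewrite -[c%:MP]mulr1 mul_mpolyC; apply/coxZ/cox1. Qed.

Lemma cox_exp u p k : cox u p -> cox (u *+ k) (p ^+ k).
Proof.
move=> up; elim: k => [|k IHk]; first by rewrite mulr0n expr0; apply: cox1.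
by rewrite mulrS exprS; apply: coxM.
Qed.

Lemma cox_prod (I : Type) (s : seq I) (U : I -> Cl v) F :
  (forall i, cox (U i) (F i)) -> cox (\sum_(i <- s) U i) (\prod_(i <- s) F i).
Proof.
by move=> UF; elim/big_ind2: _ => //; [apply: cox1|move=> *; apply: coxM].
Qed.

Lemma cox_unique u w p : p != 0 -> cox u p -> cox w p -> u = w.
Proof.
move=> p0 up /cox_compo wp; apply/eqP/negPn/negP => uw.
by rewrite -wp (compo_other up uw) eqxx in p0.
Qed.

Lemma cox_msubst (phi : {lrmorphism {mpoly K[r]} -> {mpoly K[r]}})
    (rho : {additive Cl v -> Cl v}) :
  (forall i, cox (rho (divclass v (prime_div i))) (phi 'X_i)) ->
  forall u p, cox u p -> cox (rho u) (phi p).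
Proof.
move=> phiX u p up; rewrite (mpolyE p) raddf_sum big_seq /=.
apply: cox_sum => m mp; rewrite linearZ /=; apply: coxZ.
rewrite mpolyXE_id rmorph_prod /= -(up m mp) raddf_sum /=.
by apply: cox_prod => i; rewrite rmorphXn raddfMn; apply: cox_exp.
Qed.

End Grading.

Section MakeLrmorphism.
Variables (R : nzRingType) (A B : lalgType R) (f : A -> B).

(** The proof arguments are recorded so that the morphism structure can be attached to a bare
    function, typically one obtained by choice. *)
Definition mk_lrmorphism (f_linear : linear f) (f_monoid : monoid_morphism f) :
  A -> B := f.

Variables (f_linear : linear f) (f_monoid : monoid_morphism f).
HB.instance Definition _ := GRing.isLinear.Build R A B *:%R
  (mk_lrmorphism f_linear f_monoid) f_linear.
HB.instance Definition _ := GRing.isMonoidMorphism.Build A B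
  (mk_lrmorphism f_linear f_monoid) f_monoid.

End MakeLrmorphism.

Lemma lrmorphism_eq (R : nzRingType) (A B : lalgType R)
    (f g : {lrmorphism A -> B}) : f =1 g -> f = g.
Proof.
case: f => f [[f1] [f2] [f3]]; case: g => g [[g1] [g2] [g3]] /= fg.
have {fg} E : f = g by apply: boolp.funext.
by subst g; rewrite (boolp.Prop_irrelevance f1 g1) (boolp.Prop_irrelevance f2 g2)
  (boolp.Prop_irrelevance f3 g3).
Qed.

(** * Universal property of the semigroup algebra *)

Section SemigroupAlgebraMorphisms.
Variables (K : comNzRingType) (S : nmodType).
Local Notation A := (semigroup_alg K S).
Implicit Types (f g : A) (a b : S).

Definition sgchi a : A := monalg.mkmalgU a 1.
Definition sgcoef a f : K := monalg.mcoeff a f.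

Lemma sgcoef_is_linear a : linear_for *%R (sgcoef a).
Proof. by move=> c f g; rewrite /sgcoef monalg.mcoeffD monalg.mcoeffZ. Qed.

HB.instance Definition _ a :=
  GRing.isLinear.Build K A K *%R (sgcoef a) (sgcoef_is_linear a).

Lemma sgchi0 : sgchi 0 = 1. Proof. by []. Qed.

Lemma sgchiD a b : sgchi (a + b) = sgchi a * sgchi b.
Proof. by rewrite -[RHS]/(sgmul _ _) sgmulUU mulr1. Qed.

Lemma sgcoef_chi a b : sgcoef a (sgchi b) = (a == b)%:R.
Proof. by rewrite /sgcoef /sgchi monalg.mcoeffU eq_sym; case: eqP. Qed.

Lemma sgcoef_eq f g : (forall a, sgcoef a f = sgcoef a g) -> f = g.
Proof. by move=> fg; apply/monalg.malgP. Qed.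

Lemma sg_expand f : f = \sum_(a <- monalg.msupp f) sgcoef a f *: sgchi a.
Proof.
rewrite [LHS](sgE f); apply: eq_bigr => a _; apply/monalg.malgP => b.
by rewrite monalg.mcoeffZ !monalg.mcoeffU; case: eqP; rewrite ?mulr1 ?mulr0.
Qed.

Lemma sg_lrmorph_ext (B : lalgType K) (phi psi : {linear A -> B}) :
  (forall a, phi (sgchi a) = psi (sgchi a)) -> phi =1 psi.
Proof.
move=> E f; rewrite (sg_expand f) !raddf_sum; apply: eq_bigr => a _.
by rewrite /= !linearZ /= E.
Qed.

Variables (B : comAlgType K) (theta : S -> B).
Hypothesis theta0 : theta 0 = 1.
Hypothesis thetaD : forall a b, theta (a + b) = theta a * theta b.

Let lift f : B := \sum_(a <- monalg.msupp f) sgcoef a f *: theta a.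

Let liftw (d : {fset S}) f : (monalg.msupp f `<=` d)%fset ->
  lift f = \sum_(a <- d) sgcoef a f *: theta a.
Proof.
move=> le_d; rewrite /lift (big_fset_incl _ le_d) //= => a _.
by rewrite /sgcoef => /monalg.mcoeff_outdom ->; rewrite scale0r.
Qed.

Let lift_linear : linear lift.
Proof.
move=> c f g.
pose d := (monalg.msupp f `|` monalg.msupp g)%fset.
have df : (monalg.msupp f `<=` d)%fset by apply: fsubsetUl.
have dg : (monalg.msupp g `<=` d)%fset by apply: fsubsetUr.
rewrite (liftw (d := d)); last first.
  apply: fsubset_trans (monalg.msuppD_le _ _) _; rewrite fsubUset dg andbT.
  exact: fsubset_trans (monalg.msuppZ_le _ _) df.
rewrite (liftw df) (liftw dg) scaler_sumr -big_split; apply: eq_bigr => a _.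
by rewrite linearP /= scalerDl scalerA.
Qed.

HB.instance Definition _ := GRing.isLinear.Build K A B *:%R lift lift_linear.

Let liftX a : lift (sgchi a) = theta a.
Proof.
rewrite (liftw (d := [fset a]%fset)) ?big_seq_fset1 ?sgcoef_chi ?eqxx ?scale1r //.
exact: monalg.msuppU_le.
Qed.

Let lift_monoid : monoid_morphism lift.
Proof.
split=> [|f g]; first by rewrite -sgchi0 liftX.
rewrite [in LHS](sg_expand f) [in LHS](sg_expand g) mulr_suml linear_sum [RHS]mulr_suml.
apply: eq_bigr => a _; rewrite mulr_sumr linear_sum [RHS]mulr_sumr.
apply: eq_bigr => b _.
by rewrite /= -scalerAl -scalerAr -sgchiD !linearZ /= liftX thetaD -scalerAl -scalerAr.
Qed.

Lemma ex_sglift : exists phi : {lrmorphism A -> B}, forall a, phi (sgchi a) = theta a.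
Proof. by exists (mk_lrmorphism lift_linear lift_monoid) => a; apply: liftX. Qed.

End SemigroupAlgebraMorphisms.

Opaque sgmul sgchi sgcoef.

(** * The toric algebra as the degree zero part of the Cox ring *)

Section ToricAlgebra.
Variables (K : closedFieldType) (n r : nat).
Variables (sigma : 'cV[rat]_n -> Prop) (v : 'I_r -> 'cV[int]_n).
Hypothesis dualP : forall m : 'rV[int]_n,
  reflect (forall i, 0 <= pairing m (v i)) (m \in dual_semigroup sigma).
Hypothesis v_full : forall m : 'rV[int]_n,
  (forall i, pairing m (v i) = 0) -> m = 0.

Local Notation S := (dual_monoid sigma).
Local Notation A := (semigroup_alg K S).
Local Notation R := {mpoly K[r]}.
Local Notation X := (toric_variety K sigma).
Local Notation cox := (@cox_component n r v K).
Implicit Types (f g : A) (a b : S) (p q : R).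

Lemma dual_pairing_ge0 a i : 0 <= pairing (val a) (v i).
Proof. by apply/dualP: i; apply: valP. Qed.

Definition mono a : 'X_{1..r} := mdiv v (val a).

Lemma monoE a i : (mono a i)%:Z = pairing (val a) (v i).
Proof. by rewrite mdivE //; apply: dual_pairing_ge0. Qed.

Lemma monoD a b : mono (a + b) = (mono a + mono b)%MM.
Proof. by rewrite /mono -mdivD //; apply: dual_pairing_ge0. Qed.

Lemma mono0 : mono 0 = 0%MM.
Proof. by apply/mnmP=> i; apply/eqP; rewrite -eqz_nat monoE pairing0l mnm0E. Qed.

Lemma mono_inj : injective mono.
Proof.
move=> a b ab; apply/val_inj/eqP; rewrite -subr_eq0; apply/eqP/v_full => i.
by rewrite pairingBl -!monoE ab subrr.
Qed.

Lemma mclass_mono a : mclass v (mono a) = 0.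
Proof. by apply: mclass_mdiv; apply: dual_pairing_ge0. Qed.

Lemma mclass0_mono e : mclass v e = 0 -> exists a, mono a = e.
Proof.
move/mclass_eq0=> [m mE].
have mS : m \in dual_semigroup sigma by apply/dualP=> i; rewrite -mE.
by exists (Sub m mS); apply/mnmP=> i; apply/eqP; rewrite -eqz_nat monoE SubK mE.
Qed.

Lemma ex_cox_embedding :
  exists phi : {lrmorphism A -> R}, forall a, phi (sgchi K a) = 'X_[mono a].
Proof.
apply: ex_sglift; first by rewrite mono0 mpolyX0.
by move=> a b; rewrite monoD mpolyXD.
Qed.

Definition iota : {lrmorphism A -> R} := sval (boolp.cid ex_cox_embedding).

Lemma iota_chi a : iota (sgchi K a) = 'X_[mono a].
Proof. by rewrite /iota; case: boolp.cid. Qed.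

Lemma iota_chiM a f : iota (sgchi K a * f) = 'X_[mono a] * iota f.
Proof. by rewrite (rmorphM iota) -iota_chi. Qed.

Lemma mcoeff_iota f a : (iota f)@_(mono a) = sgcoef a f.
Proof.
rewrite [in RHS](sg_expand f) [in LHS](sg_expand f) !raddf_sum /=.
apply: eq_bigr => b _; rewrite !linearZ /= iota_chi sgcoef_chi mcoeffX.
by rewrite (inj_eq mono_inj) eq_sym.
Qed.

Lemma iota_inj : injective iota.
Proof. by move=> f g fg; apply: sgcoef_eq => a; rewrite -!mcoeff_iota fg. Qed.

Lemma iota_cox f : cox 0 (iota f).
Proof.
rewrite (sg_expand f) raddf_sum; apply: cox_sum => a _.
by rewrite /= linearZ /= iota_chi; apply: coxZ; rewrite -(mclass_mono a); apply: coxX.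
Qed.

Lemma cox_iota p : cox 0 p -> exists f, iota f = p.
Proof.
move=> p0; pose d q := exists f, iota f = q.
have dD q q' : d q -> d q' -> d (q + q').
  by case=> [f <-] [g <-]; exists (f + g); rewrite rmorphD.
rewrite -/(d p) (mpolyE p) big_seq; elim/big_ind: _ => // [|m mp].
  by exists 0; rewrite rmorph0.
have [a <-] := mclass0_mono (p0 m mp).
by exists (p@_(mono a) *: sgchi K a); rewrite linearZ /= iota_chi.
Qed.

Lemma ex_retract p : exists f, iota f = compo (0 : Cl v) p.
Proof. exact/cox_iota/compo_cox. Qed.

(** Inverse of [iota] on degree 0, made total by projecting to that degree first; it turns graded
    endomorphisms of the Cox ring and coefficients of families into data on [A]. *)
Definition retract p : A := sval (boolp.cid (ex_retract p)).

Lemma retractK p : iota (retract p) = compo (0 : Cl v) p.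
Proof. by rewrite /retract; case: boolp.cid. Qed.

Lemma ex_descent (phi : {lrmorphism R -> R}) :
  (forall p, cox 0 p -> cox 0 (phi p)) ->
  exists a : {lrmorphism A -> A}, forall f, iota (a f) = phi (iota f).
Proof.
move=> phi0; have aE f : iota (retract (phi (iota f))) = phi (iota f).
  by rewrite retractK; apply/cox_compo/phi0/iota_cox.
have a_lin : linear (fun f => retract (phi (iota f))).
  move=> c f g; apply: iota_inj.
  rewrite -[LHS]/(iota (retract (phi (iota (c *: f + g))))) aE.
  by rewrite (linearP iota) (linearP phi) [RHS](linearP iota) /= !aE.
have a_mon : monoid_morphism (fun f => retract (phi (iota f))).
  split=> [|f g]; apply: iota_inj.
    by rewrite -[LHS]/(iota (retract (phi (iota 1)))) aE (rmorph1 iota) (rmorph1 phi).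
  rewrite -[LHS]/(iota (retract (phi (iota (f * g))))) aE.
  by rewrite [RHS](rmorphM iota) /= !aE -(rmorphM phi) -(rmorphM iota).
by exists (mk_lrmorphism a_lin a_mon) => f; apply: aE.
Qed.

(** On points this is the quotient map from affine [r]-space to [X]. *)
Lemma ex_point (y : 'I_r -> K) : exists x : X, forall f, x f = (iota f).@[y].
Proof.
have x_lin : linear (fun f => (iota f).@[y] : K^o).
  by move=> c f g; rewrite linearP mevalD mevalZ.
have x_mon : monoid_morphism (fun f => (iota f).@[y] : K^o).
  by split=> [|f g]; rewrite ?(rmorph1 iota) ?meval1 // (rmorphM iota) mevalM.
by exists (mk_lrmorphism x_lin x_mon : {lrmorphism A -> K^o}).
Qed.

Hypothesis charK0 : [pchar K] =i pred0.

(** The points coming from affine [r]-space already suffice: [iota] is injective, and a polynomial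
    vanishing at all arguments is 0 over an infinite field. *)
Lemma points_separate f g : (forall x : X, x f = x g) -> f = g.
Proof.
move=> fg; apply/iota_inj/eqP; rewrite -subr_eq0; apply/eqP.
apply: (mpoly_vanishing charK0) => y; have [x xE] := ex_point y.
by rewrite mevalB -!xE fg subrr.
Qed.

(** The images are chosen one function at a time; as points separate elements of [A], the choices
    are forced and hence respect the operations. *)
Lemma morphism_comorphism (phi : X -> X) : is_morphism phi ->
  exists a : {lrmorphism A -> A}, forall x f, phi x f = x (a f).
Proof.
move=> phiM; have ex_a f : exists g, forall x, phi x f = x g.
  by have [|g gE] := phiM (fun x : X => x f); [exists f|exists g].
have [a aE] := boolp.choice ex_a.
have a_lin : linear a.
  move=> c f g; apply: points_separate => x; rewrite -aE.
  by rewrite (linearP (phi x)) (linearP x) /= !aE.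
have a_mon : monoid_morphism a.
  split=> [|f g]; apply: points_separate => x; first by rewrite -aE (rmorph1 x) (rmorph1 (phi x)).
  by rewrite -aE (rmorphM (phi x)) (rmorphM x) /= !aE.
by exists (mk_lrmorphism a_lin a_mon) => x f; apply: aE.
Qed.

Lemma automorphism_comorphism (phi : X -> X) : is_automorphism phi ->
  exists a b : {lrmorphism A -> A},
    [/\ forall x f, phi x f = x (a f), cancel a b & cancel b a].
Proof.
move=> [phiM [psi [psiM phiK psiK]]].
have [a aE] := morphism_comorphism phiM; have [b bE] := morphism_comorphism psiM.
exists a, b; split=> // f; apply: points_separate => x.
  by rewrite -bE -aE psiK.
by rewrite -aE -bE phiK.
Qed.

Definition pullback (a : {lrmorphism A -> A}) (x : X) : X :=
  (x \o a : {lrmorphism A -> K^o}).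

Lemma pullback_automorphism (a b : {lrmorphism A -> A}) :
  cancel a b -> cancel b a -> is_automorphism (pullback a).
Proof.
move=> ab ba; split=> [f [g gE]|]; first by exists (a g) => x; rewrite /= gE.
exists (pullback b); split=> [f [g gE]|x|x]; first by exists (b g) => x; rewrite /= gE.
  by apply: lrmorphism_eq => f; rewrite /= ba.
by apply: lrmorphism_eq => f; rewrite /= ab.
Qed.

End ToricAlgebra.

Opaque mono iota retract.

(** * Lifting automorphisms to the Cox ring *)

Section Valuations.
Variables (K : fieldType) (r : nat).
Implicit Types (p q g h : {mpoly K[r]}).

Lemma valuation_unique q k l g h : prime_elt q -> ~ divides q g -> ~ divides q h ->
  q ^+ k * g = q ^+ l * h -> k = l.
Proof.
move=> [q0 _ _] ndg ndh.
elim: k l => [|k IHk] [|l] //; rewrite ?expr0 ?exprS ?mul1r -?mulrA => E.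
- by case: ndg; exists (q ^+ l * h).
- by case: ndh; exists (q ^+ k * g).
- by congr _.+1; apply: IHk; apply: (mulfI q0).
Qed.

Lemma not_dividesM q g h : prime_elt q -> ~ divides q g -> ~ divides q h ->
  ~ divides q (g * h).
Proof. by move=> qP ndg ndh /(prime_eltM qP)[]. Qed.

Lemma not_divides_exp q g k : prime_elt q -> ~ divides q g -> ~ divides q (g ^+ k).
Proof. by move=> qP ndg /(prime_elt_exp qP). Qed.

End Valuations.

Section Lifting.
Variables (K : closedFieldType) (n r : nat).
Variables (sigma : 'cV[rat]_n -> Prop) (v : 'I_r -> 'cV[int]_n).
Hypothesis dualP : forall m : 'rV[int]_n,
  reflect (forall i, 0 <= pairing m (v i)) (m \in dual_semigroup sigma).
Hypothesis v_full : forall m : 'rV[int]_n,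
  (forall i, pairing m (v i) = 0) -> m = 0.
Hypothesis v_facet : forall i, exists m : 'rV[int]_n,
  pairing m (v i) = 0 /\ forall j, j != i -> 0 < pairing m (v j).
Hypothesis v_primitive : forall i, exists m : 'rV[int]_n, pairing m (v i) = 1.

Local Notation S := (dual_monoid sigma).
Local Notation A := (semigroup_alg K S).
Local Notation R := {mpoly K[r]}.
Local Notation cox := (@cox_component n r v K).
Local Notation iota := (iota K dualP).
Local Notation mono := (mono v).
Implicit Types (a b s : S) (p q g : R).

Lemma val_dualD a b : val (a + b) = val a + val b.
Proof. by []. Qed.

Lemma val_dualMn a k : val (a *+ k) = val a *+ k.
Proof. by elim: k => [|k IHk]; rewrite ?mulr0n // !mulrS val_dualD IHk. Qed.

Lemma ex_dual (m : 'rV[int]_n) : (forall i, 0 <= pairing m (v i)) ->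
  exists a : S, val a = m.
Proof. by move=> m0; have mS := introT (dualP m) m0; exists (Sub m mS); rewrite SubK. Qed.

Lemma ex_dual_interior : exists a : S, forall i, (0 < mono a i)%N.
Proof.
have [m mP] := ex_interior v_facet v_primitive.
have [a aE] := ex_dual (fun i => ltW (mP i)).
by exists a => i; rewrite -ltz_nat (monoE dualP) aE.
Qed.

(** An interior [s] has all exponents at least 1, so its multiple by the sum of the exponents of [a]
    dominates [a] on every ray. *)
Lemma dual_absorb a s : (forall i, (0 < mono s i)%N) ->
  exists k b, s *+ k = a + b.
Proof.
move=> s_int; pose k := (\sum_i mono a i)%N; exists k.
have [|b bE] := @ex_dual (val s *+ k - val a).
  move=> i; rewrite pairingBl pairingMnl -!(monoE dualP) subr_ge0.
  rewrite -mulr_natr natz -PoszM lez_nat /k (bigD1 i) //= mulnDr.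
  by rewrite (leq_trans _ (leq_addr _ _)) // leq_pmull.
by exists b; apply: val_inj; rewrite val_dualMn val_dualD bE addrC subrK.
Qed.

Lemma ex_dual_sub (m : 'rV[int]_n) : exists a b : S, m = val a - val b.
Proof.
have [s s_int] := ex_dual_interior.
pose k := (\sum_i `|pairing m (v i)|)%N.
have [|a aE] := @ex_dual (m + val s *+ k).
  move=> i; rewrite pairingDl pairingMnl -(monoE dualP) -lerBlDl sub0r.
  apply: le_trans (_ : `|pairing m (v i)| <= _); first by rewrite ler_normr lexx orbT.
  rewrite -abszE -mulr_natr natz -PoszM lez_nat /k (bigD1 i) //= mulnDr.
  by rewrite (leq_trans _ (leq_addr _ _)) // leq_pmull.
by exists a, (s *+ k); rewrite aE val_dualMn addrK.
Qed.

Section Automorphism.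
Variables (phi psi : {lrmorphism A -> A}).
Hypotheses (phiK : cancel phi psi) (psiK : cancel psi phi).

Variable alpha : S -> R.
Hypothesis alphaE : forall a, alpha a = iota (phi (sgchi K a)).

Lemma alphaD a b : alpha (a + b) = alpha a * alpha b.
Proof. by rewrite !alphaE sgchiD (rmorphM phi) (rmorphM iota). Qed.

Lemma alpha_neq0 a : alpha a != 0.
Proof.
rewrite alphaE -(rmorph0 iota) (inj_eq (iota_inj v_full)).
rewrite -(rmorph0 phi) (inj_eq (can_inj phiK)).
apply: contra_neq (mpolyX_neq0 K (mono a)) => E.
by rewrite -(iota_chi K dualP) E rmorph0.
Qed.

Lemma ex_mclass (u : Cl v) : exists e, mclass v e = u.
Proof.
have [i _|no_i] := pickP 'I_r.
  by have [e [eu _]] := ex_mclass_avoiding v_facet v_primitive u i; exists e.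
exists 0%MM; rewrite mclass0; have [D <-] := divclass_surj u.
by apply/esym/divclass_eq0; exists 0 => i; have := no_i i.
Qed.

(** Distinct variables are not associated, so [q] divides at most one of them, and that one can be
    avoided within the class [u]. *)
Lemma ex_mclass_not_divides (u : Cl v) q : prime_elt q ->
  exists e, mclass v e = u /\ ~ divides q ('X_[e] : R).
Proof.
move=> qP; have [[i dqi]|nd] := boolp.pselect (exists i, divides q ('X_i : R)).
  have [e [eu ei]] := ex_mclass_avoiding v_facet v_primitive u i.
  exists e; split=> // /(prime_divides_mono qP)[j [ej dqj]].
  by move: ej; rewrite -(prime_divides_one_variable qP dqi dqj) ei.
have [e eu] := ex_mclass u; exists e; split=> // /(prime_divides_mono qP)[i [_ dqi]].
by apply: nd; exists i.
Qed.

(* The localization of the algebra at [q] is a valuation ring, which forces the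
   valuation of [q] on characters to be a multiple of a coordinate of [mono]. *)
Lemma valuation_essential q k (g1 g2 : R) a1 a2 : prime_elt q ->
  alpha a1 = q ^+ k * g1 -> alpha a2 = q ^+ k * g2 -> ~ divides q g2 ->
  exists s b, ~ divides q (alpha s) /\ (mono s + mono a1 = mono b + mono a2)%MM.
Proof.
move=> qP a1E a2E ndg2.
(* [g1] and [g2] need not be homogeneous. A component of [g2] prime to [q], times a monomial of
   opposite class prime to [q], has degree 0 and so comes from [A]. *)
have [u ndu] : exists u, ~ divides q (compo (u : Cl v) g2).
  apply: boolp.contrapT => H; apply: ndg2.
  apply: (@compo_sum n r v K (divides q)) => [|x y|u]; first by exists 0; rewrite mulr0.
    exact: dividesD.
  by apply: boolp.contrapT => nd; apply: H; exists u.
have [e [eu nde]] := ex_mclass_not_divides (- u) qP.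
have cox_alpha a : cox 0 (alpha a) by rewrite alphaE; apply: iota_cox.
have prodE : alpha a1 * compo u g2 = alpha a2 * compo u g1.
  have E a g' : compo u (alpha a * g') = alpha a * compo u g'.
    by rewrite -(compoM _ _ (cox_alpha a)) add0r.
  rewrite -(E a1) -(E a2) a1E a2E; congr compo.
  by rewrite mulrAC.
have mk_h g' : exists h, iota (phi h) = compo u g' * 'X_[e].
  have [|h hE] := @cox_iota _ _ _ _ _ dualP (compo u g' * 'X_[e]).
    by rewrite -(subrr u) -eu; apply: coxM; [apply: compo_cox|apply: coxX].
  by exists (psi h); rewrite psiK.
have [h hE] := mk_h g2; have [h1 gE] := mk_h g1.
have hg : sgchi K a1 * h = sgchi K a2 * h1.
  apply/(can_inj phiK)/(iota_inj v_full).
  have E a x : iota (phi (sgchi K a * x)) = alpha a * iota (phi x).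
    by rewrite (rmorphM phi) (rmorphM iota) alphaE.
  apply: (etrans (E a1 h)); apply: (etrans _ (esym (E a2 h1))).
  by rewrite hE gE !mulrA prodE.
(* Otherwise [q] would divide the image of [h]. The monomial of [s + a1] occurs in the left side of
   [hg], hence in the right side, which yields [b]. *)
have [s [sh nds]] : exists s, sgcoef s h != 0 /\ ~ divides q (alpha s).
  apply: boolp.contrapT => H.
  have : divides q (iota (phi h)).
    rewrite (sg_expand h) !raddf_sum /=; apply: divides_sum => s _.
    rewrite !linearZ /= -alphaE -mul_mpolyC; have [->|sh] := eqVneq (sgcoef s h) 0.
      by exists 0; rewrite mul0r mulr0.
    apply: dividesMr; apply: boolp.contrapT => nd; apply: H.
    by exists s; split.
  by rewrite hE; apply: not_dividesM.
have : (iota (sgchi K a2 * h1))@_(mono a1 + mono s)%MM != 0.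
  by rewrite -hg iota_chiM mulrC mcoeffMX mcoeff_iota.
rewrite iota_chiM mulrC -mcoeff_msupp.
rewrite (perm_mem (msuppMX _ _)) => /mapP[e' e'g eE].
have [b bE] := mclass0_mono dualP (iota_cox e'g).
exists s, b; split; first by [].
rewrite -bE in eE; exact: etrans (addmC _ _) (etrans eE (addmC _ _)).
Qed.

End Automorphism.
End Lifting.

(** * Valuations of characters and factorization of their images *)

Section DivisorTheory.
Variables (K : closedFieldType) (n r : nat).
Variables (sigma : 'cV[rat]_n -> Prop) (v : 'I_r -> 'cV[int]_n).
Hypothesis dualP : forall m : 'rV[int]_n,
  reflect (forall i, 0 <= pairing m (v i)) (m \in dual_semigroup sigma).
Hypothesis v_facet : forall i, exists m : 'rV[int]_n,
  pairing m (v i) = 0 /\ forall j, j != i -> 0 < pairing m (v j).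
Hypothesis v_primitive : forall i, exists m : 'rV[int]_n, pairing m (v i) = 1.

Local Notation S := (dual_monoid sigma).
Local Notation R := {mpoly K[r]}.
Local Notation mono := (mono v).
Implicit Types (a b s : S) (p q g : R) (alpha : S -> R).

Definition multiplicative_family alpha :=
  (forall a b, alpha (a + b) = alpha a * alpha b) /\ (forall a, alpha a != 0).

Definition proportional_valuations alpha := forall q, prime_elt q ->
  (forall a, ~ divides q (alpha a)) \/
  exists k j, forall a, exists2 g, alpha a = q ^+ (k * mono a j) * g & ~ divides q g.

Lemma monoDE a b i : mono (a + b) i = (mono a i + mono b i)%N.
Proof. by rewrite (monoD dualP) mnmDE. Qed.

Lemma monoMnE a k i : mono (a *+ k) i = (k * mono a i)%N.
Proof.
elim: k => [|k IHk]; first by rewrite mulr0n (mono0 dualP) mnm0E.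
by rewrite mulrS monoDE IHk mulSn.
Qed.

Lemma mono_sum_gt0 (c : 'I_r -> S) j : (0 < mono (c j) j)%N ->
  (0 < mono (\sum_i c i)%R j)%N.
Proof. by move=> cj; rewrite (bigD1 j) //= monoDE addn_gt0 cj. Qed.

Lemma ex_mono_consecutive j : exists a b, mono a j = (mono b j).+1.
Proof.
have [m mj] := v_primitive j.
have [a [b mE]] := ex_dual_sub dualP v_facet v_primitive m.
exists a, b; apply/eqP; rewrite -eqz_nat -addn1 PoszD !(monoE dualP).
by rewrite -[X in _ + X]mj mE pairingBl addrC subrK.
Qed.

(** If the valuation is nontrivial, the characters of valuation 0 lie on one facet of the dual cone,
    where the [j]-th exponent is 0. Then equal valuations force equal [j]-th exponents, and
    comparing multiples of characters gives proportionality. *)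
Lemma valuation_proportional alpha : multiplicative_family alpha ->
  (forall q k (g1 g2 : R) a1 a2, prime_elt q ->
    alpha a1 = q ^+ k * g1 -> alpha a2 = q ^+ k * g2 -> ~ divides q g2 ->
    exists s b, ~ divides q (alpha s) /\ (mono s + mono a1 = mono b + mono a2)%MM) ->
  proportional_valuations alpha.
Proof.
move=> [alphaD alpha0] essential q qP.
have ex_nu a : exists k, exists2 g, alpha a = q ^+ k * g & ~ divides q g.
  exact: prime_elt_valuation.
have [nu nuP] := boolp.choice ex_nu.
have nu_unique a k g : alpha a = q ^+ k * g -> ~ divides q g -> nu a = k.
  move=> aE ndg; have [h hE ndh] := nuP a.
  by apply: (valuation_unique qP ndh ndg); rewrite -hE.
have nuD a b : nu (a + b) = (nu a + nu b)%N.
  have [g gE ndg] := nuP a; have [h hE ndh] := nuP b.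
  apply: (nu_unique _ _ (g * h)); last exact: not_dividesM.
  by rewrite alphaD gE hE exprD mulrACA.
have nu0 : nu 0 = 0%N by apply/eqP; rewrite -(eqn_add2l (nu 0)) -nuD addr0 addn0.
have nuMn a k : nu (a *+ k) = (k * nu a)%N.
  by elim: k => [|k IHk]; rewrite ?mulr0n // mulrS nuD IHk mulSn.
have nu_eq0 a : ~ divides q (alpha a) <-> nu a = 0%N.
  split=> [nda|nua]; first by apply: (nu_unique _ _ (alpha a)); rewrite // mul1r.
  by have [g -> ndg] := nuP a; rewrite nua mul1r.
have [nu_triv|nu_nontriv] := boolp.pselect (forall a, nu a = 0%N).
  by left=> a; apply/nu_eq0.
(* Otherwise a sum of characters of valuation 0 would be interior; every character divides a
   multiple of it, so all valuations would be 0. *)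
right; have [j jP] : exists j, forall s, nu s = 0%N -> mono s j = 0%N.
  apply: boolp.contrapT => no_j; apply: nu_nontriv => a.
  have ex_c j : exists s, nu s = 0%N /\ (0 < mono s j)%N.
    apply: boolp.contrapT => no_s; apply: no_j; exists j => s nus.
    by apply/eqP; rewrite -leqn0 leqNgt; apply/negP => sj; apply: no_s; exists s.
  have [c cP] := boolp.choice ex_c.
  have nu_c : nu (\sum_j c j)%R = 0%N.
    elim/big_ind: _ => // [x y nux nuy|i _]; first by rewrite nuD nux nuy.
    by have [] := cP i.
  have c_int j : (0 < mono (\sum_j c j)%R j)%N.
    by apply: mono_sum_gt0; have [] := cP j.
  have [k [b bE]] := dual_absorb dualP a c_int.
  have : nu (a + b) = 0%N by rewrite -bE nuMn nu_c muln0.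
  by rewrite nuD => /eqP; rewrite addn_eq0 => /andP[/eqP].
have nu_mono_le a1 a2 : nu a1 = nu a2 -> (mono a2 j <= mono a1 j)%N.
  move=> nu12; have [g1 g1E _] := nuP a1; have [g2 g2E ndg2] := nuP a2.
  rewrite -nu12 in g2E.
  have [s [b [nds /mnmP/(_ j)]]] := essential _ _ _ _ _ _ qP g1E g2E ndg2.
  rewrite !mnmDE (jP s) ?add0n => [->|]; first exact: leq_addl.
  exact/nu_eq0.
have cross a1 a2 : (nu a1 * mono a2 j = nu a2 * mono a1 j)%N.
  rewrite -!monoMnE; apply/eqP; rewrite eqn_leq.
  by rewrite !nu_mono_le // !nuMn mulnC.
(* Two characters whose [j]-th exponents differ by one make the proportionality factor integral: it
   is the difference of their valuations. *)
have [a1 [a2 a12]] := ex_mono_consecutive j.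
exists (nu a1 - nu a2)%N, j => a; have [g gE ndg] := nuP a; exists g => //.
rewrite gE; congr (_ ^+ _ * _).
by rewrite mulnBl (cross a1) (cross a2) a12 mulnS addnK.
Qed.

(** Prime divisors [q] of the image of an interior [a0] are split off one at a time: the valuation
    of [q] is [k * mono a j], so [q ^+ k] goes into [F j], and the image of [a0] loses degree. Once
    that image is a unit all images are, since every character divides a multiple of [a0]. *)
Lemma divisor_factorization alpha :
  multiplicative_family alpha -> proportional_valuations alpha ->
  exists (F : 'I_r -> R) (c : S -> K),
    forall a, c a != 0 /\ alpha a = c a *: \prod_i F i ^+ mono a i.
Proof.
have [a0 a0_int] := ex_dual_interior dualP v_facet v_primitive.
have [d] := ubnP (msize (alpha a0)).
elim: d alpha => // d IHd alpha le_d alpha_mult alpha_prop.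
have [alphaD alpha0] := alpha_mult.
have [a0U|a0U] := boolP (alpha a0 \is a GRing.unit).
  have alphaU a : exists c, c != 0 /\ alpha a = c%:MP.
    have [k [b bE]] := dual_absorb dualP a a0_int.
    suff /mpoly_unitP[c c0 ->] : alpha a \is a GRing.unit by exists c.
    suff : alpha (a + b) \is a GRing.unit by rewrite alphaD unitrM => /andP[].
    rewrite -bE; elim: k {b bE} => [|k IHk]; last by rewrite mulrS alphaD unitrM a0U.
    rewrite mulr0n; suff -> : alpha 0 = 1 by apply: unitr1.
    by apply: (mulfI (alpha0 0)); rewrite -alphaD addr0 mulr1.
  have [c cP] := boolp.choice alphaU; exists (fun=> 1), c => a.
  have [c0 ->] := cP a; split=> //.
  by rewrite big1 ?alg_mpolyC // => i _; rewrite expr1n.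
have [q qP dq] := ex_prime_divisor (alpha0 a0) a0U.
have [|[k [j kjP]]] := alpha_prop q qP; first by move/(_ a0).
have [beta betaP] : exists beta, forall a,
    alpha a = q ^+ (k * mono a j) * beta a /\ ~ divides q (beta a).
  have [|beta betaP] := @boolp.choice S R (fun a g =>
    alpha a = q ^+ (k * mono a j) * g /\ ~ divides q g).
    by move=> a; have [g gE ndg] := kjP a; exists g.
  by exists beta.
have [q0 qU _] := qP.
have beta0 a : beta a != 0.
  by have [aE _] := betaP a; move: (alpha0 a); rewrite aE mulf_eq0 negb_or => /andP[].
have qk_neq0 e : q ^+ e != 0 by rewrite expf_neq0.
have betaD a b : beta (a + b) = beta a * beta b.
  apply: (mulfI (qk_neq0 (k * mono (a + b)%R j)%N)).
  have [<- _] := betaP (a + b); have [aE _] := betaP a; have [bE _] := betaP b.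
  by rewrite alphaD aE bE monoDE mulnDr exprD mulrACA.
have k_gt0 : (0 < k)%N.
  rewrite lt0n; apply/eqP => k0; have [aE ndb] := betaP a0.
  by apply: ndb; move: dq; rewrite aE k0 mul0n mul1r.
have beta_prop : proportional_valuations beta.
  move=> p pP; have [nd|[k' [j' kj'P]]] := alpha_prop p pP.
    left=> a; have [aE _] := betaP a => dp; apply: (nd a).
    by rewrite aE; apply: dividesMr.
  (* A prime associated to [q] divides no [beta a]; any other prime has the same valuation on [beta]
     as on [alpha]. *)
  have [dpq|ndpq] := boolp.pselect (divides p q).
    left=> a; have [_ ndb] := betaP a => dpb; apply: ndb.
    exact: divides_trans (prime_elt_sym pP qP dpq) dpb.
  right; exists k', j' => a; have [l [h hE ndh]] := prime_elt_valuation pP (beta0 a).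
  exists h => //; rewrite hE; congr (_ ^+ _ * _).
  have [g gE ndg] := kj'P a; have [aE _] := betaP a.
  apply: (valuation_unique pP (g := q ^+ (k * mono a j) * h) _ ndg).
    by apply: not_dividesM => //; apply: not_divides_exp.
  by rewrite mulrCA -hE -aE.
have [|F [c FP]] := IHd beta _ (conj betaD beta0) beta_prop.
  rewrite -ltnS (leq_trans _ le_d) // ltnS; have [-> _] := betaP a0.
  rewrite msizeM //.
  have : (1 < msize (q ^+ (k * mono a0 j)))%N.
    rewrite ltnNge; apply/negP => sz1; case/negP: qU.
    have [c c0 qE] : exists2 c, c != 0 & q ^+ (k * mono a0 j) = c%:MP.
      by apply/msize_poly1P; rewrite eqn_leq sz1 lt0n msize_poly_eq0 qk_neq0.
    have : q ^+ (k * mono a0 j) \is a GRing.unit by apply/mpoly_unitP; exists c.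
    by rewrite unitrX_pos // muln_gt0 k_gt0 a0_int.
  by case: (msize _) => [|[|x]] //= _; rewrite addSn ltnS leq_addl.
exists (fun i => if i == j then q ^+ k * F i else F i), c => a.
have [c0 bE] := FP a; split=> //; have [-> _] := betaP a.
rewrite bE -scalerAr; congr (_ *: _).
rewrite (bigD1 j) // [in RHS](bigD1 j) //= eqxx exprMn -exprM -mulrA.
congr (_ * (_ * _)); apply: eq_bigr => i /negPf-> //.
Qed.

End DivisorTheory.

(** * Extension of characters of the dual monoid *)

Section CharacterExtension.
Variables (K : closedFieldType) (n r : nat).
Variables (sigma : 'cV[rat]_n -> Prop) (v : 'I_r -> 'cV[int]_n).
Hypothesis dualP : forall m : 'rV[int]_n,
  reflect (forall i, 0 <= pairing m (v i)) (m \in dual_semigroup sigma).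
Hypothesis v_full : forall m : 'rV[int]_n,
  (forall i, pairing m (v i) = 0) -> m = 0.
Hypothesis v_facet : forall i, exists m : 'rV[int]_n,
  pairing m (v i) = 0 /\ forall j, j != i -> 0 < pairing m (v j).
Hypothesis v_primitive : forall i, exists m : 'rV[int]_n, pairing m (v i) = 1.

Local Notation S := (dual_monoid sigma).
Local Notation mono := (mono v).

Lemma ex_root (d : nat) (x : K) : (0 < d)%N -> exists y, y ^+ d = x.
Proof.
move=> d0; have [y yE] := solve_monicpoly (fun i => if i == 0%N then x else 0) d0.
exists y; rewrite yE; case: d d0 {yE} => // d _.
by rewrite big_ord_recl /= expr0 mulr1 big1 ?addr0 // => i _; rewrite mul0r.
Qed.

(** The rays span, so the matrix of the [v i] has a rational right inverse; [d] clears its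
    denominators. *)
Lemma rays_right_inverse : exists (d : nat) (U : 'M[int]_(r, n)),
  (0 < d)%N /\ forall m k, \sum_i pairing m (v i) * U i k = d%:Z * m 0 k.
Proof.
pose V : 'M[int]_(n, r) := \matrix_(k, i) v i k 0.
have VE m i : (m *m V) 0 i = pairing m (v i).
  by rewrite /pairing !mxE; apply: eq_bigr => k _; rewrite mxE.
have V_free : row_free (map_mx intr V : 'M[rat]_(n, r)).
  apply: inj_row_free => w wV.
  have [d [m [d0 mE]]] := clear_denominators w.
  have m0 : m = 0.
    apply: v_full => i; rewrite -VE; apply/eqP; rewrite -(intr_eq0 rat).
    have /rowP/(_ i) : toMQ m *m map_mx intr V = 0.
      by rewrite mE -scalemxAl wV scaler0.
    by rewrite /toMQ -map_mxM !mxE => ->.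
  move: mE; rewrite m0 /toMQ map_mx0 => /esym/eqP.
  by rewrite scaler_eq0 pnatr_eq0 -leqn0 leqNgt d0 => /eqP.
have [B VB] := row_freeP V_free.
have [d [m [d0 mE]]] := clear_denominators (mxvec B).
pose U := vec_mx m : 'M[int]_(r, n).
have UE : map_mx intr U = d%:R *: B :> 'M[rat]_(r, n).
  by rewrite /U map_vec_mx -[map_mx _ _]/(toMQ m) mE linearZ /= mxvecK.
have VU : V *m U = (d%:Z)%:M.
  have VUQ : map_mx intr (V *m U) = map_mx intr ((d%:Z)%:M) :> 'M[rat]_n.
    by rewrite map_mxM UE -scalemxAr VB map_scalar_mx scalemx1.
  apply/matrixP=> i j; have /matrixP/(_ i j) := VUQ.
  by rewrite [LHS]mxE [RHS]mxE => /intr_inj.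
exists d, U; split=> // w k.
have /rowP/(_ k) : w *m V *m U = d%:Z *: w.
  by rewrite -mulmxA VU mul_mx_scalar.
by rewrite !mxE => <-; apply: eq_bigr => i _; rewrite VE.
Qed.

(* [mono] identifies the monoid with its image in [nat^r]; a character extends
   from the corresponding sublattice of [int^r] because [K^*] is divisible. *)
Lemma monoid_character_extends (c : S -> K) :
  (forall a b, c (a + b) = c a * c b) -> (forall a, c a != 0) ->
  exists t : 'I_r -> K, (forall i, t i != 0) /\
    forall a, c a = \prod_i t i ^+ mono a i.
Proof.
move=> cD c0; have [d [U [d0 UE]]] := rays_right_inverse.
have c_0 : c 0 = 1 by apply: (mulfI (c0 0)); rewrite -cD addr0 mulr1.
have cMn a k : c (a *+ k) = c a ^+ k.
  by elim: k => [|k IHk]; rewrite ?mulr0n // mulrS cD IHk exprS.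
have c_sum (F : 'I_n -> S) : c (\sum_k F k) = \prod_k c (F k).
  by apply: big_morph.
have ex_xy (k : 'I_n) : exists xy : S * S, delta_mx 0 k = val xy.1 - val xy.2 :> 'rV[int]_n.
  by have [x [y E]] := ex_dual_sub dualP v_facet v_primitive (delta_mx 0 k); exists (x, y).
have [xy xyE] := boolp.choice ex_xy.
pose gam k := c (xy k).1 / c (xy k).2.
have gam0 k : gam k != 0 by rewrite mulf_neq0 ?invr_neq0.
have cE a : c a = \prod_k gam k ^ (val a 0 k).
  pose p k := if 0 <= val a 0 k then `|val a 0%R k|%N else 0%N.
  pose q k := if 0 <= val a 0 k then 0%N else `|val a 0%R k|%N.
  have pqE k : val a 0 k = (p k)%:Z - (q k)%:Z.
    rewrite /p /q; case: (lerP 0 (val a 0 k)) => ak; first by rewrite subr0 gez0_abs.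
    by rewrite sub0r ltz0_abs // opprK.
  (* [c] is only defined on the monoid, so the subtracted terms are moved to the left before [c] is
     applied. *)
  have aE : a + \sum_k ((xy k).2 *+ p k + (xy k).1 *+ q k) =
      \sum_k ((xy k).1 *+ p k + (xy k).2 *+ q k).
    have val_sum (F : 'I_n -> S) : val (\sum_k F k) = \sum_k val (F k).
      by apply: (big_morph val (@val_dualD _ sigma)).
    apply: val_inj; rewrite val_dualD !val_sum [val a in LHS]row_sum_delta -big_split.
    apply: eq_bigr => k _; rewrite !val_dualD !val_dualMn /= pqE xyE.
    by rewrite -!scaler_nat; apply/rowP=> l; rewrite !mxE !natz; ring.
  move/(congr1 c): aE; rewrite cD !c_sum.
  set P := \prod_k c _; have P0 : P != 0 by apply/prodf_neq0 => k _.
  move=> aE; apply: (mulIf P0); rewrite aE /P -big_split; apply: eq_bigr => k _.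
  rewrite !cD !cMn /= pqE expfzDr ?gam0 // -exprnN -exprnP /gam !exprMn !exprVn.
  have fracE (x y z t : K) : y != 0 -> z != 0 -> t != 0 ->
      x * t = x * y^-1 * (z * t^-1)^-1 * (y * z).
    by move=> y0 z0 t0; field; rewrite y0 z0 t0.
  by apply: fracE; rewrite expf_neq0.
have [eta etaE] := boolp.choice (fun k => ex_root (gam k) d0).
have eta0 k : eta k != 0.
  by move: (gam0 k); rewrite -etaE; apply: contra_neq => ->; rewrite expr0n -leqn0 leqNgt d0.
(* By [UE] the exponents of [eta k] add up to [d] times the [k]-th coordinate of [val a], and
   [eta k ^+ d = gam k]. *)
exists (fun i => \prod_k eta k ^ (U i k)); split=> [i|a].
  by apply/prodf_neq0 => k _; rewrite expfz_neq0.
rewrite cE; under [RHS]eq_bigr do rewrite -prodrXl.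
rewrite exchange_big /=; apply: eq_bigr => k _.
rewrite -etaE exprnP exprz_exp -UE.
rewrite (big_morph (fun z : int => eta k ^ z) (id1 := 1) (op1 := *%R)) //; last first.
  by move=> x y; rewrite expfzDr.
apply: eq_bigr => i _.
by rewrite exprnP exprz_exp mulrC -(monoE dualP).
Qed.

End CharacterExtension.

(** * Construction of the lift and homogeneity of its values *)

Section CoxLift.
Variables (K : closedFieldType) (n r : nat).
Variables (sigma : 'cV[rat]_n -> Prop) (v : 'I_r -> 'cV[int]_n).
Hypothesis dualP : forall m : 'rV[int]_n,
  reflect (forall i, 0 <= pairing m (v i)) (m \in dual_semigroup sigma).
Hypothesis v_full : forall m : 'rV[int]_n,
  (forall i, pairing m (v i) = 0) -> m = 0.
Hypothesis v_facet : forall i, exists m : 'rV[int]_n,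
  pairing m (v i) = 0 /\ forall j, j != i -> 0 < pairing m (v j).
Hypothesis v_primitive : forall i, exists m : 'rV[int]_n, pairing m (v i) = 1.

Local Notation S := (dual_monoid sigma).
Local Notation A := (semigroup_alg K S).
Local Notation R := {mpoly K[r]}.
Local Notation cox := (@cox_component n r v K).
Local Notation iota := (iota K dualP).
Local Notation mono := (mono v).
Implicit Types (a b s : S) (p q : R).

Lemma iota_monoE (phi : {lrmorphism R -> R}) a :
  phi (iota (sgchi K a)) = \prod_i phi 'X_i ^+ mono a i.
Proof.
rewrite iota_chi mpolyXE_id rmorph_prod; apply: eq_bigr => i _.
by rewrite rmorphXn.
Qed.

(** The factors [F i] are images for the variables up to a character [c] of the monoid, which is
    absorbed by the rescalings [t i]. *)
Lemma ex_cox_endomorphism (phi psi : {lrmorphism A -> A}) :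
  cancel phi psi -> cancel psi phi ->
  exists Phi : {lrmorphism R -> R}, forall f, Phi (iota f) = iota (phi f).
Proof.
move=> phiK psiK; pose alpha a := iota (phi (sgchi K a)).
have alphaE a : alpha a = iota (phi (sgchi K a)) by [].
move: alpha alphaE => alpha alphaE.
have alpha_mult : multiplicative_family alpha.
  by split; [apply: (alphaD alphaE)|apply: (alpha_neq0 v_full phiK alphaE)].
have alpha_prop : proportional_valuations v alpha.
  apply: (valuation_proportional dualP v_facet v_primitive alpha_mult).
  move=> q k g1 g2 a1 a2.
  exact: (valuation_essential v_full v_facet v_primitive phiK psiK alphaE).
have [F [c FP]] := divisor_factorization dualP v_facet v_primitive alpha_mult alpha_prop.
have [alphaD alpha0] := alpha_mult.
have c0 a : c a != 0 by have [] := FP a.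
have P0 a : \prod_i F i ^+ mono a i != 0.
  by apply: contra_neq (alpha0 a) => P0; have [_ ->] := FP a; rewrite P0 scaler0.
have cD a b : c (a + b) = c a * c b.
  have PD : \prod_i F i ^+ mono (a + b) i =
      (\prod_i F i ^+ mono a i) * (\prod_i F i ^+ mono b i).
    by rewrite -big_split; apply: eq_bigr => i _; rewrite (monoDE dualP) exprD.
  have := alphaD a b; have [_ ->] := FP (a + b); have [_ ->] := FP a; have [_ ->] := FP b.
  rewrite -scalerAl -scalerAr scalerA -PD -!mul_mpolyC => E.
  by have := mulIf (P0 _) E => /(congr1 (mcoeff 0%MM)); rewrite !mpolyCK.
have [t [t0 tP]] := monoid_character_extends dualP v_full v_facet v_primitive cD c0.
exists (msubst (fun i => t i *: F i)).
apply: (@sg_lrmorph_ext K S R (msubst (fun i => t i *: F i) \o iota) (iota \o phi)) => a /=.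
rewrite iota_monoE -alphaE; have [_ ->] := FP a; rewrite tP -mul_mpolyC rmorph_prod -big_split.
by apply: eq_bigr => i _; rewrite /= msubstX exprZn -mul_mpolyC rmorphXn.
Qed.

(** For [i != j], a character omitting only the [j]-th variable shows that ['X_j] does not divide
    [G i]; an interior one then forces ['X_i] to divide [G i]. A product of positive powers of the
    cofactors is 1, so they are constants. *)
Lemma scaling_of_invariant (Theta : {lrmorphism R -> R}) :
  (forall f, Theta (iota f) = iota f) ->
  exists t : 'I_r -> K, forall i, t i != 0 /\ Theta 'X_i = t i *: 'X_i.
Proof.
move=> ThetaE; pose G i : R := Theta 'X_i.
have GE a : \prod_i G i ^+ mono a i = 'X_[mono a] by rewrite -iota_monoE ThetaE iota_chi.
have [a0 a0_int] := ex_dual_interior dualP v_facet v_primitive.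
have Gij i j : i != j -> ~ divides 'X_j (G i).
  move=> ij; have [m [mj mi]] := v_facet j.
  have [|a aE] := ex_dual dualP (m := m).
    by move=> k; have [->|/mi/ltW//] := eqVneq k j; rewrite mj.
  have aj : mono a j = 0%N by apply/eqP; rewrite -eqz_nat (monoE dualP) aE mj.
  have ai : (0 < mono a i)%N by rewrite -ltz_nat (monoE dualP) aE mi.
  move=> dj; have : divides 'X_j ('X_[mono a] : R).
    rewrite -GE (bigD1 i) //=; apply: dividesMl.
    by rewrite -(prednK ai) exprS; apply: dividesMl.
  by move/dividesX_mono; rewrite aj.
have Gi i : divides 'X_i (G i).
  have : divides 'X_i ('X_[mono a0] : R) by apply/dividesX_mono/a0_int.
  rewrite -GE => /(prime_elt_prod (prime_X K i))[j _ /(prime_elt_exp (prime_X K i))].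
  by have [->|ji /(Gij _ _ ji)] := eqVneq j i.
have [H HE] := boolp.choice Gi.
have : \prod_i H i ^+ mono a0 i = 1.
  apply: (mulfI (mpolyX_neq0 K (mono a0))); rewrite mulr1 -[in RHS]GE.
  rewrite mpolyXE_id -big_split; apply: eq_bigr => i _.
  by rewrite HE exprMn.
move=> Hprod.
have HU i : exists t, t != 0 /\ H i = t%:MP.
  suff /mpoly_unitP[t t0 ->] : H i \is a GRing.unit by exists t.
  have := unitr1 R; rewrite -Hprod (bigD1 i) //= unitrM => /andP[].
  by rewrite unitrX_pos.
have [t tP] := boolp.choice HU; exists t => i; have [t0 HiE] := tP i.
by split=> //; rewrite -/(G i) HE HiE mulrC mul_mpolyC.
Qed.

Lemma scaling_inverse (Theta : {lrmorphism R -> R}) :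
  (forall f, Theta (iota f) = iota f) ->
  exists D : {lrmorphism R -> R}, cancel Theta D /\ cancel D Theta.
Proof.
move=> /scaling_of_invariant[t tP].
exists (msubst (fun i => (t i)^-1 *: 'X_i : R)); split.
  apply: (@mpoly_lrmorph_ext r K R (msubst _ \o Theta) idfun) => i /=.
  by have [t0 ->] := tP i; rewrite linearZ /= msubstX scalerA mulfV ?scale1r.
apply: (@mpoly_lrmorph_ext r K R (Theta \o msubst _) idfun) => i /=.
by have [t0 tE] := tP i; rewrite msubstX linearZ /= tE scalerA mulVf ?scale1r.
Qed.

(** Lifts of [phi] and [psi] need not be mutually inverse, but their composites fix [A] and are thus
    invertible scalings; correcting [Psi] by one of these gives the inverse. *)
Lemma ex_cox_automorphism (phi psi : {lrmorphism A -> A}) :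
  cancel phi psi -> cancel psi phi ->
  exists Phi Psi : {lrmorphism R -> R},
    [/\ cancel Phi Psi, cancel Psi Phi,
        forall f, Phi (iota f) = iota (phi f)
      & forall f, Psi (iota f) = iota (psi f)].
Proof.
move=> phiK psiK.
have [Phi PhiE] := ex_cox_endomorphism phiK psiK.
have [Psi PsiE] := ex_cox_endomorphism psiK phiK.
have [|D [DK _]] := @scaling_inverse (Psi \o Phi).
  by move=> f /=; rewrite PhiE PsiE phiK.
have [|D' [_ D'K]] := @scaling_inverse (Phi \o Psi).
  by move=> f /=; rewrite PsiE PhiE psiK.
have Phi_inj : injective Phi by move=> p q E; rewrite -(DK p) -(DK q) /= E.
have Psi'K : cancel (Psi \o D' : {lrmorphism R -> R}) Phi by exact: D'K.
have PhiK : cancel Phi (Psi \o D' : {lrmorphism R -> R}).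
  by move=> p; apply: Phi_inj; rewrite Psi'K.
exists Phi, (Psi \o D' : {lrmorphism R -> R}); split=> // f.
by apply: Phi_inj; rewrite Psi'K PhiE psiK.
Qed.

Section Homogeneous.
Variables Phi Psi : {lrmorphism R -> R}.
Hypotheses (PhiK : cancel Phi Psi) (PsiK : cancel Psi Phi).
Hypothesis Phi0 : forall p, cox 0 p -> cox 0 (Phi p).

Let Phi_neq0 p : p != 0 -> Phi p != 0.
Proof. by move=> p0; rewrite -(rmorph0 Phi) (inj_eq (can_inj PhiK)). Qed.

(* Elements of one degree have images with proportional components, so that
   the component [g w] of [g = Phi 'X_i] is a multiple of [g], hence a scalar
   multiple for degree reasons. *)
Lemma automorphism_homogeneous i : exists w, cox w (Phi 'X_i).
Proof.
set g := Phi 'X_i; have g0 : g != 0 by apply/Phi_neq0/mpolyX_neq0.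
have [w gw0] := compo_neq0 v g0; exists w.
have [e [eu ei]] := ex_mclass_avoiding v_facet v_primitive (divclass v (prime_div i)) i.
have [e' e'u] := ex_mclass v_facet v_primitive (- divclass v (prime_div i)).
pose g' := Phi 'X_[e]; pose b := Phi 'X_[e'].
have bg : cox 0 (b * g).
  rewrite /b /g -rmorphM; apply: Phi0.
  rewrite -(addNr (divclass v (prime_div i))) -e'u; apply: coxM; first exact: coxX.
  exact: coxXU.
have bg' : cox 0 (b * g').
  rewrite /b /g' -rmorphM; apply: Phi0.
  by rewrite -(addNr (divclass v (prime_div i))) -e'u -eu; apply: coxM; apply: coxX.
have b0 : b != 0 by apply/Phi_neq0/mpolyX_neq0.
(* [b * g] and [b * g'] have degree 0, so multiplying by them commutes with taking the component of
   degree [w]; then [b] cancels. *)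
have E : compo w g * g' = compo w g' * g.
  have compoMr p q : cox 0 p -> compo w (p * q) = p * compo w q.
    by move=> p0; rewrite -(compoM _ _ p0) add0r.
  have : compo w (b * g' * g) = compo w (b * g * g') by rewrite mulrAC.
  rewrite !compoMr // -!mulrA => /(mulfI b0).
  by rewrite [LHS]mulrC [RHS]mulrC.
(* Applying [Psi] to [E] shows that ['X_i] divides this element times a monomial that avoids
   ['X_i]. *)
have [mu muE] : divides 'X_i (Psi (compo w g)).
  have : divides 'X_i (Psi (compo w g) * 'X_[e]).
    have PsiM x y : Psi (x * y) = Psi x * Psi y by apply: rmorphM.
    exists (Psi (compo w g')); move/(congr1 Psi): E; rewrite !PsiM /g' /g !PhiK => ->.
    by rewrite mulrC.
  by case/(prime_eltM (prime_X K i)) => // /dividesX_mono; rewrite ei.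
have gwE : compo w g = g * Phi mu by rewrite -(PsiK (compo w g)) muE rmorphM.
have mu0 : Phi mu != 0 by apply: contra_neq gw0 => mu0; rewrite gwE mu0 mulr0.
have sz_gw : (msize (compo w g) <= msize g)%N.
  rewrite [leqLHS]msizeE; apply/bigmax_leqP_seq => m; rewrite mcoeff_msupp mcoeff_compo => mg _.
  by apply: msize_mdeg_lt; rewrite mcoeff_msupp; move: mg; case: ifP; rewrite ?eqxx.
have /msize_poly1P[c c0 cE] : msize (Phi mu) == 1%N.
  move: sz_gw; rewrite gwE msizeM //; move: g0 mu0; rewrite -!msize_poly_eq0.
  case: (msize g) => // x; case: (msize (Phi mu)) => // y _ _.
  by rewrite addSn addnS /= -[leqRHS]addn1 -addn1 -addnA leq_add2l addn1 ltnS leqn0 => /eqP->.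
have gE : g = c^-1 *: compo w g.
  by rewrite gwE cE mulrC mul_mpolyC scalerA mulVf ?scale1r.
by rewrite gE; apply/coxZ/compo_cox.
Qed.

End Homogeneous.

End CoxLift.

Section MakeAdditive.
Variables (U V : zmodType) (f : U -> V).

Definition mk_additive (f_additive : zmod_morphism f) : U -> V := f.

Variable f_additive : zmod_morphism f.
HB.instance Definition _ :=
  GRing.isZmodMorphism.Build U V (mk_additive f_additive) f_additive.

End MakeAdditive.

Lemma Cl_additive_ext (n r : nat) (v : 'I_r -> 'cV[int]_n) (W : zmodType)
    (f g : {additive Cl v -> W}) :
  (forall i, f (divclass v (prime_div i)) = g (divclass v (prime_div i))) -> f =1 g.
Proof.
move=> fg u; have [D <-] := divclass_surj u; rewrite divclass_sum !raddf_sum.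
by apply: eq_bigr => i _; rewrite /= !raddfMz fg.
Qed.

Lemma ex_Cl_additive (n r : nat) (v : 'I_r -> 'cV[int]_n) (W : zmodType)
    (d : 'I_r -> W) :
  (forall m, \sum_i d i *~ pairing m (v i) = 0) ->
  exists f : {additive Cl v -> W}, forall i, f (divclass v (prime_div i)) = d i.
Proof.
move=> d0; pose F (D : 'rV[int]_r) := \sum_i d i *~ D 0 i.
have FB D D' : F (D - D') = F D - F D'.
  by rewrite /F -sumrB; apply: eq_bigr => i _; rewrite !mxE mulrzBr.
pose f (u : Cl v) := F (repr u).
have fE D : f (divclass v D) = F D.
  apply/eqP; rewrite -subr_eq0 /f -FB; apply/eqP.
  have /divclass_eq0[m mE] : divclass v (repr (divclass v D) - D) = 0.
    by rewrite raddfB /= [X in X - _]reprK subrr.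
  by apply: etrans (d0 m); apply: eq_bigr => i _; rewrite -mE.
have f_additive : zmod_morphism f.
  move=> u w; have [D <-] := divclass_surj u; have [D' <-] := divclass_surj w.
  by rewrite -raddfB !fE FB.
exists (mk_additive f_additive) => i; rewrite -[LHS]/(f _) fE /F (bigD1 i) //=.
rewrite !mxE !eqxx big1 ?addr0 // => j ji.
by rewrite !mxE (negPf ji) andbF mulr0z.
Qed.

(** * Action of a lift on the class group *)

Section Gamma.
Variables (K : closedFieldType) (n r : nat).
Variables (sigma : 'cV[rat]_n -> Prop) (v : 'I_r -> 'cV[int]_n).
Hypothesis dualP : forall m : 'rV[int]_n,
  reflect (forall i, 0 <= pairing m (v i)) (m \in dual_semigroup sigma).
Hypothesis v_full : forall m : 'rV[int]_n,
  (forall i, pairing m (v i) = 0) -> m = 0.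
Hypothesis v_facet : forall i, exists m : 'rV[int]_n,
  pairing m (v i) = 0 /\ forall j, j != i -> 0 < pairing m (v j).
Hypothesis v_primitive : forall i, exists m : 'rV[int]_n, pairing m (v i) = 1.

Local Notation A := (semigroup_alg K (dual_monoid sigma)).
Local Notation R := {mpoly K[r]}.
Local Notation cox := (@cox_component n r v K).
Local Notation iota := (iota K dualP).

Lemma is_gammaE (Phi : {lrmorphism R -> R}) (rho : {additive Cl v -> Cl v}) u p :
  is_gamma Phi rho -> cox u p -> cox (rho u) (Phi p).
Proof. by move=> [_ rhoE] up; apply/rhoE; exists p. Qed.

(** The degrees of the images of the variables give a map on divisors; it kills principal ones
    because images of characters have degree 0 and the dual monoid generates [M]. *)
Lemma ex_degree_map (Phi Psi : {lrmorphism R -> R}) :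
  cancel Phi Psi -> cancel Psi Phi -> (forall p, cox 0 p -> cox 0 (Phi p)) ->
  exists rho : {additive Cl v -> Cl v},
    forall i, cox (rho (divclass v (prime_div i))) (Phi 'X_i).
Proof.
move=> PhiK PsiK Phi0.
have [d dP] := boolp.choice (automorphism_homogeneous v_facet v_primitive PhiK PsiK Phi0).
have d_dual (a : dual_monoid sigma) : \sum_i d i *~ pairing (val a) (v i) = 0.
  have a0 : Phi (iota (sgchi K a)) != 0.
    by rewrite -(rmorph0 Phi) (inj_eq (can_inj PhiK)) iota_chi mpolyX_neq0.
  apply: (cox_unique a0); last exact/Phi0/iota_cox.
  rewrite iota_monoE; apply: cox_prod => i.
  by rewrite -(monoE dualP) -pmulrn; apply: cox_exp.
have [m|rho rhoE] := @ex_Cl_additive _ _ v _ d; last by exists rho => i; rewrite rhoE.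
have [a [b ->]] := ex_dual_sub dualP v_facet v_primitive m.
transitivity (\sum_i d i *~ pairing (val a) (v i) - \sum_i d i *~ pairing (val b) (v i)).
  rewrite -sumrB.
  by apply: eq_bigr => i _; rewrite pairingBl mulrzBr.
by rewrite !d_dual subrr.
Qed.

Lemma ex_gamma (Phi Psi : {lrmorphism R -> R}) :
  cancel Phi Psi -> cancel Psi Phi ->
  (forall p, cox 0 p -> cox 0 (Phi p)) -> (forall p, cox 0 p -> cox 0 (Psi p)) ->
  exists rho : {additive Cl v -> Cl v}, is_gamma Phi rho.
Proof.
move=> PhiK PsiK Phi0 Psi0.
have [rho rhoP] := ex_degree_map PhiK PsiK Phi0.
have [rho' rho'P] := ex_degree_map PsiK PhiK Psi0.
have inv (f g : {lrmorphism R -> R}) (s t : {additive Cl v -> Cl v}) : cancel f g ->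
    (forall i, cox (s (divclass v (prime_div i))) (f 'X_i)) ->
    (forall i, cox (t (divclass v (prime_div i))) (g 'X_i)) -> cancel s t.
  move=> fK sP tP; apply: (@Cl_additive_ext _ _ v _ (t \o s) idfun) => i /=.
  apply: (cox_unique (mpolyX_neq0 K U_(i)%MM)); last exact: coxXU.
  by rewrite -(fK 'X_i); apply: cox_msubst tP _ _ _.
exists rho; split.
  by exists rho'; [apply: inv rhoP rho'P|apply: inv rho'P rhoP].
move=> u q; split=> [uq|[p up ->]]; last exact: cox_msubst rhoP _ _ up.
exists (Psi q); last by rewrite PsiK.
rewrite -(inv _ _ _ _ PhiK rhoP rho'P u); exact: cox_msubst rho'P _ _ uq.
Qed.

Theorem cox_lift (phi psi : {lrmorphism A -> A}) :
  cancel phi psi -> cancel psi phi ->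
  exists (Phi : {lrmorphism R -> R}) (rho : {additive Cl v -> Cl v}),
    [/\ bijective Phi, is_gamma Phi rho & forall f, Phi (iota f) = iota (phi f)].
Proof.
move=> phiK psiK.
have [Phi [Psi [PhiK PsiK PhiE PsiE]]] :=
  ex_cox_automorphism dualP v_full v_facet v_primitive phiK psiK.
have Phi0 p : cox 0 p -> cox 0 (Phi p).
  by move=> /(cox_iota dualP)[f <-]; rewrite PhiE; apply: iota_cox.
have Psi0 p : cox 0 p -> cox 0 (Psi p).
  by move=> /(cox_iota dualP)[f <-]; rewrite PsiE; apply: iota_cox.
have [rho rhoP] := ex_gamma PhiK PsiK Phi0 Psi0.
by exists Phi, rho; split=> //; exists Psi.
Qed.

End Gamma.

(** * Linear parts and symmetries of the cone *)

Section LinearPart.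
Variables (K : fieldType) (r : nat).
Local Notation R := {mpoly K[r]}.
Implicit Types (p q : R).

Lemma mpoly_closed_ind (P : R -> Prop) : (forall c, P c%:MP) -> (forall i, P 'X_i) ->
  (forall p q, P p -> P q -> P (p + q)) -> (forall p q, P p -> P q -> P (p * q)) ->
  forall p, P p.
Proof.
move=> PC PX PD PM; elim/mpolyind=> [|c m p _ _ Pp]; first by rewrite -mpolyC0.
apply: (PD) => //; rewrite -mul_mpolyC; apply: (PM) => //.
have P1 : P 1 by exact: (PC 1).
rewrite mpolyXE_id; apply: (big_ind P) => [|p' q'|i _]; [exact: P1|exact: PM|].
by elim: (m i) => [|k IHk]; rewrite ?expr0 // exprS; apply: (PM).
Qed.

Lemma mcoeffU_mderiv i p : p@_U_(i) = (p^`M(i))@_0.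
Proof. by rewrite mcoeff_deriv add0m mnm0E mulr1n. Qed.

Lemma mcoeff0M p q : (p * q)@_0 = p@_0 * q@_0.
Proof. exact: (rmorphM (@mcoeff r K 0%MM)). Qed.

Lemma mcoeffUM i p q : (p * q)@_U_(i) = p@_U_(i) * q@_0 + p@_0 * q@_U_(i).
Proof. by rewrite !mcoeffU_mderiv mderivM mcoeffD !mcoeff0M. Qed.

Lemma mcoeffUC i c : (c%:MP : R)@_U_(i) = 0.
Proof. by rewrite mcoeffC -mdeg_eq0 mdeg1 mulr0. Qed.

Variable Phi : {lrmorphism R -> R}.
Let base i := (Phi 'X_i)@_0.

Lemma lrmorphC c : Phi c%:MP = c%:MP.
Proof. by rewrite -[c%:MP]mulr1 mul_mpolyC linearZ rmorph1. Qed.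

Let mcoeff0_image p : (Phi p)@_0 = p.@[base].
Proof.
elim/mpoly_closed_ind: p => [c|i|p q IHp IHq|p q IHp IHq].
- by rewrite lrmorphC mevalC mpolyCK.
- by rewrite mevalXU.
- by rewrite rmorphD mcoeffD IHp IHq mevalD.
- by rewrite rmorphM mcoeff0M IHp IHq mevalM.
Qed.

(** [Phi] need not fix the origin, so the derivatives of [p] are taken at [base], the image of the
    origin. *)
Lemma chain_rule j p :
  (Phi p)@_U_(j) = \sum_k (p^`M(k)).@[base] * (Phi 'X_k)@_U_(j).
Proof.
elim/mpoly_closed_ind: p => [c|i|p q IHp IHq|p q IHp IHq].
- rewrite lrmorphC mcoeffUC big1 // => k _.
  by rewrite mderivC meval0 mul0r.
- have UU : (U_(i) - U_(i))%MM = 0%MM :> 'X_{1..r} by apply/mnmP=> l; rewrite mnmBE subnn mnm0E.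
  rewrite (bigD1 i) //= mderivX mnm1E eqxx scale1r UU mpolyX0 meval1 mul1r.
  rewrite big1 ?addr0 // => k ki.
  by rewrite mderivX mnm1E eq_sym (negPf ki) scale0r meval0 mul0r.
- rewrite rmorphD mcoeffD IHp IHq -big_split; apply: eq_bigr => k _.
  by rewrite mderivD mevalD mulrDl.
- rewrite rmorphM mcoeffUM IHp IHq !mcoeff0_image mulr_suml mulr_sumr -big_split.
  apply: eq_bigr => k _.
  rewrite mderivM mevalD !mevalM mulrDl; congr (_ + _); last by rewrite mulrA.
  by rewrite mulrAC.
Qed.

Definition linear_part : 'M[K]_r := \matrix_(i, j) (Phi 'X_i)@_U_(j).

(** By the chain rule, the Jacobian matrix of the inverse at [base] is a left inverse. *)
Lemma linear_part_unit : bijective Phi -> linear_part \in unitmx.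
Proof.
case=> Psi _ PsiK; pose B := \matrix_(i, k) ((Psi 'X_i)^`M(k)).@[base].
suff : B *m linear_part = 1%:M by case/mulmx1_unit.
apply/matrixP=> i j; have := chain_rule j (Psi 'X_i).
rewrite PsiK mcoeffXU !mxE => ->.
by apply: eq_bigr => k _; rewrite !mxE.
Qed.

(** Some term of the Leibniz expansion of the determinant is nonzero. *)
Lemma linear_part_perm : bijective Phi ->
  exists s : 'S_r, forall i, (Phi 'X_i)@_U_(s i) != 0.
Proof.
move=> /linear_part_unit; rewrite unitmxE unitfE => det0.
apply: boolp.contrapT => no_s; case/eqP: det0; rewrite /determinant big1 // => s _.
suff [i si] : exists i, (Phi 'X_i)@_U_(s i) = 0.
  by rewrite (bigD1 i) //= mxE si mul0r mulr0.
apply: boolp.contrapT => no_i; apply: no_s; exists s => i.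
by apply/eqP => si; apply: no_i; exists i.
Qed.

End LinearPart.

Section Symmetries.
Variables (n r : nat) (v : 'I_r -> 'cV[int]_n).
Hypothesis v_full : forall m : 'rV[int]_n,
  (forall i, pairing m (v i) = 0) -> m = 0.
Local Notation D i := (divclass v (prime_div i)).

Lemma gamma_perm (K : fieldType) (Phi : {lrmorphism {mpoly K[r]} -> {mpoly K[r]}})
    (rho : {additive Cl v -> Cl v}) : bijective Phi -> is_gamma Phi rho ->
  exists s : 'S_r, forall i, D (s i) = rho (D i).
Proof.
move=> Phi_bij rhoP; have [s sP] := linear_part_perm Phi_bij; exists s => i.
have [_ rhoE] := rhoP.
have : cox_component (rho (D i)) (Phi 'X_i) by apply/rhoE; exists 'X_i => //; apply: coxXU.
by move/coxP/(_ _ (sP i)); rewrite mclass1.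
Qed.

Lemma divclass_pairing_sum (x : 'I_r -> int) :
  \sum_i D i *~ x i = 0 <-> exists m, forall i, x i = pairing m (v i).
Proof.
have -> : \sum_i D i *~ x i = divclass v (\row_i x i).
  by rewrite divclass_sum; apply: eq_bigr => i _; rewrite mxE.
by rewrite divclass_eq0; split=> -[m mE]; exists m => i; have := mE i; rewrite mxE.
Qed.

Lemma matrix_of_rows (x : 'I_r -> 'cV[int]_n) :
  (forall m, exists m', forall i, pairing m' (v i) = pairing m (x i)) ->
  exists L : 'M[int]_n, forall i, L *m v i = x i.
Proof.
move=> ex_m'; have [m' m'E] := boolp.choice (fun k : 'I_n => ex_m' (delta_mx 0 k)).
exists (\matrix_k m' k) => i; apply/colP=> k.
have := m'E k i; rewrite pairing_delta => <-; rewrite /pairing.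
by rewrite [LHS]mxE [RHS]mxE; apply: eq_bigr => l _; rewrite !mxE.
Qed.

(** The vectors [pairing m (v i)] form the lattice of relations between the classes [D i]. Since
    [rho] permutes these classes through [s], so does [s] preserve this copy of [M] in [Z^r];
    dualizing gives [L]. *)
Lemma gamma_symmetry (s : 'S_r) (rho : {additive Cl v -> Cl v}) :
  bijective rho -> (forall i, D (s i) = rho (D i)) ->
  exists2 L : 'M[int]_n, L \in unitmx & forall i, L *m v i = v (s i).
Proof.
move=> rho_bij sE.
have [|L LE] := @matrix_of_rows (fun i => v (s i)).
  move=> m; have [|m' m'E] := (divclass_pairing_sum (fun i => pairing m (v (s i)))).1.
    apply: (bij_inj rho_bij); rewrite raddf0 raddf_sum /=.
    have : \sum_i D (s i) *~ pairing m (v (s i)) = 0.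
      transitivity (\sum_i D i *~ pairing m (v i)); last first.
        by apply/divclass_pairing_sum; exists m.
      by rewrite [RHS](reindex_inj (@perm_inj _ s)).
    by apply: etrans; apply: eq_bigr => i _; rewrite raddfMz sE.
  by exists m' => i; rewrite m'E.
have [|L' L'E] := @matrix_of_rows (fun i => v ((s^-1)%g i)).
  move=> m; have [|m' m'E] := (divclass_pairing_sum (fun i => pairing m (v ((s^-1)%g i)))).1.
    rewrite (reindex_inj (@perm_inj _ s)) /=.
    have : rho (\sum_i D i *~ pairing m (v i)) = 0.
      by rewrite (divclass_pairing_sum _).2 ?raddf0 //; exists m.
    rewrite raddf_sum /=; apply: etrans; apply: eq_bigr => i _.
    by rewrite raddfMz permK sE.
  by exists m' => i; rewrite m'E.
exists L => //; suff : L' *m L = 1%:M by case/mulmx1_unit.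
apply/eqP; rewrite -subr_eq0; apply/eqP/row_matrixP => k; rewrite row0.
apply: v_full => i; rewrite /pairing -row_mul mulmxBl mul1mx -mulmxA LE L'E permK subrr.
by rewrite row0 mxE.
Qed.

Variable sigma : 'cV[rat]_n -> Prop.
Hypothesis sigmaP : forall x, sigma x <->
  exists c : 'I_r -> rat, (forall i, 0 <= c i) /\ x = \sum_i c i *: toNQ (v i).

Lemma permuting_stabilizes (L : 'M[int]_n) (s : 'S_r) :
  (forall i, L *m v i = v (s i)) -> stabilizes_cone sigma L.
Proof.
move=> LE x; have LEQ i : map_mx intr L *m toNQ (v i) = toNQ (v (s i)).
  by rewrite /toNQ -map_mxM LE.
have imE c : map_mx intr L *m (\sum_i c i *: toNQ (v i)) = \sum_i c i *: toNQ (v (s i)).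
  by rewrite mulmx_sumr; apply: eq_bigr => i _; rewrite -scalemxAr LEQ.
split=> [/sigmaP[c [c0 ->]]|[y /sigmaP[c [c0 ->]] ->]].
  exists (\sum_i c (s i) *: toNQ (v i)); first by apply/sigmaP; exists (fun i => c (s i)); split.
  by rewrite imE (reindex_inj (@perm_inj _ s)).
apply/sigmaP; exists (fun i => c ((s^-1)%g i)); split=> //.
by rewrite imE [RHS](reindex_inj (@perm_inj _ s)); apply: eq_bigr => i _; rewrite /= permK.
Qed.

Definition class_mixing_symmetry := exists L : 'M[int]_n,
  [/\ L \in unitmx, stabilizes_cone sigma L
    & exists i j : 'I_r, L *m v i = v j /\ D i <> D j].

Definition normalizing_preserves (K : fieldType) :=
  forall phi : {lrmorphism {mpoly K[r]} -> {mpoly K[r]}},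
    in_Aut_tilde v phi <-> in_Ker_gamma v phi.

Lemma no_symmetry_preserves (K : fieldType) :
  ~ class_mixing_symmetry -> normalizing_preserves K.
Proof.
move=> no_L phi; split=> [[phi_bij [rho rhoP]]|[phi_bij idP]]; last first.
  by split=> //; exists idfun.
split=> //; have [s sE] := gamma_perm phi_bij rhoP; have [rho_bij _] := rhoP.
have [L LU LE] := gamma_symmetry rho_bij sE.
have rho_id : rho =1 idfun.
  apply: Cl_additive_ext => i /=; rewrite -sE; apply: boolp.contrapT => Di.
  apply: no_L; exists L; split=> //; first exact: permuting_stabilizes LE.
  by exists i, (s i); split=> // E; apply: Di.
split; first by exists id.
by move=> u q; have [_ /(_ u q)] := rhoP; rewrite rho_id.
Qed.

End Symmetries.

(** * Deformation to the identity *)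

Section AffineSubstitutions.
Variables (K : fieldType) (r : nat).
Local Notation R := {mpoly K[r]}.
Implicit Types (M : 'M[K]_r) (a b : 'I_r -> K).

(** Translations on both sides of the linear map give the inverse the same shape, with [a] and [b]
    exchanged up to sign. *)
Definition affine_subst M a b : R -> R :=
  msubst (fun i => \sum_k M i k *: ('X_k + (a k)%:MP) + (b i)%:MP : R).

HB.instance Definition _ M a b := GRing.LRMorphism.copy (affine_subst M a b)
  (msubst (fun i => \sum_k M i k *: ('X_k + (a k)%:MP) + (b i)%:MP : R)).

Lemma affine_substX M a b i :
  affine_subst M a b 'X_i = \sum_k M i k *: ('X_k + (a k)%:MP) + (b i)%:MP.
Proof. exact: msubstX. Qed.

Lemma affine_substK M M' a b : M *m M' = 1%:M ->
  cancel (affine_subst M a b) (affine_subst M' (fun i => - b i) (fun i => - a i)).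
Proof.
move=> MM'; pose f : {lrmorphism R -> R} := affine_subst M' (fun i => - b i) (fun i => - a i).
rewrite -/f.
apply: (@mpoly_lrmorph_ext r K R (f \o affine_subst M a b) idfun) => i /=.
rewrite affine_substX rmorphD raddf_sum /= (lrmorphC f).
have E k : f (M i k *: ('X_k + (a k)%:MP)) =
    \sum_l (M i k * M' k l) *: ('X_l - (b l)%:MP).
  rewrite linearZ /= rmorphD /= (lrmorphC f) affine_substX -addrA -mpolyCD addNr addr0.
  rewrite scaler_sumr; apply: eq_bigr => l _.
  by rewrite scalerA mpolyCN.
rewrite (eq_bigr _ (fun k _ => E k)) exchange_big /=.
have F l : \sum_k (M i k * M' k l) *: ('X_l - (b l)%:MP) =
    (i == l)%:R *: ('X_l - (b l)%:MP) :> R.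
  by rewrite -scaler_suml; have /matrixP/(_ i l) := MM'; rewrite !mxE => ->.
rewrite (eq_bigr _ (fun l _ => F l)) (bigD1 i) //= eqxx scale1r big1 ?addr0 ?subrK //.
by move=> l li; rewrite eq_sym (negPf li) scale0r.
Qed.

Lemma affine_subst_bij M a b : M \in unitmx -> bijective (affine_subst M a b).
Proof.
move=> MU; exists (affine_subst (invmx M) (fun i => - b i) (fun i => - a i)).
  by apply: affine_substK; rewrite mulmxV.
have := @affine_substK (invmx M) M (fun i => - b i) (fun i => - a i) (mulVmx MU).
congr (cancel _ _); apply: boolp.funext => p; rewrite /affine_subst.
by congr msubst; apply: boolp.funext => i; rewrite opprK; congr (_ + _);
  apply: eq_bigr => k _; rewrite opprK.
Qed.

End AffineSubstitutions.

Section PolynomialFamilies.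
Variables (K : fieldType) (r : nat).
Local Notation R := {mpoly K[r]}.
Implicit Types (P : K -> R).

Definition polynomial_family P := exists Q : {poly R}, forall s, P s = Q.[s%:MP].

Lemma polynomial_familyC p : polynomial_family (fun=> p).
Proof. by exists p%:P => s; rewrite hornerC. Qed.

Lemma polynomial_family_id : polynomial_family (fun s => s%:MP).
Proof. by exists 'X => s; rewrite hornerX. Qed.

Lemma polynomial_familyD P P' : polynomial_family P -> polynomial_family P' ->
  polynomial_family (fun s => P s + P' s).
Proof. by move=> [Q QE] [Q' Q'E]; exists (Q + Q') => s; rewrite QE Q'E hornerD. Qed.

Lemma polynomial_familyM P P' : polynomial_family P -> polynomial_family P' ->
  polynomial_family (fun s => P s * P' s).
Proof. by move=> [Q QE] [Q' Q'E]; exists (Q * Q') => s; rewrite QE Q'E hornerM. Qed.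

Lemma polynomial_family_sum (I : Type) (t : seq I) (B : pred I) (P : I -> K -> R) :
  (forall i, polynomial_family (P i)) ->
  polynomial_family (fun s => \sum_(i <- t | B i) P i s).
Proof.
move=> PP; elim: t => [|i t IHt].
  by exists 0 => s; rewrite big_nil horner0.
case Bi : (B i).
  have [Q QE] := polynomial_familyD (PP i) IHt.
  by exists Q => s; rewrite big_cons Bi QE.
by have [Q QE] := IHt; exists Q => s; rewrite big_cons Bi.
Qed.

Lemma polynomial_family_horner (p : {poly K}) : polynomial_family (fun s => (p.[s])%:MP).
Proof.
exists (map_poly (@mpolyC r K) p) => s.
by rewrite horner_map.
Qed.

Lemma polynomial_family_msubst (G : K -> 'I_r -> R) p :
  (forall i, polynomial_family (fun s => G s i)) ->
  polynomial_family (fun s => msubst (G s) p).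
Proof.
move=> GP; elim/mpoly_closed_ind: p => [c|i|p q [P PE] [Q QE]|p q [P PE] [Q QE]].
- by exists c%:MP%:P => s; rewrite hornerC (lrmorphC (msubst (G s))).
- by have [Q QE] := GP i; exists Q => s; rewrite msubstX.
- by exists (P + Q) => s; rewrite rmorphD /= PE QE hornerD.
- by exists (P * Q) => s; rewrite rmorphM /= PE QE hornerM.
Qed.

End PolynomialFamilies.

Section Dilation.
Variables (K : fieldType) (r : nat).
Local Notation R := {mpoly K[r]}.
Implicit Types (p : R) (s : K).

(* [(p(s T) - p(0)) / s], also for [s = 0]. *)
Definition dilation p s : R :=
  \sum_(m <- msupp p | m != 0%MM) (s ^+ (mdeg m).-1)%:MP * (p@_m *: 'X_[m]).

Lemma dilationE p s :
  s%:MP * dilation p s = msubst (fun i => s *: 'X_i : R) p - (p@_0)%:MP.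
Proof.
apply/eqP; rewrite eq_sym subr_eq; apply/eqP.
have -> : (p@_0)%:MP = \sum_(m <- msupp p | m == 0%MM) p@_m *: 'X_[m].
  have [p0|p0] := boolP (0%MM \in msupp p); last first.
    rewrite memN_msupp_eq0 // mpolyC0 big_seq_cond big1 // => m /andP[mp /eqP m0].
    by rewrite -m0 mp in p0.
  rewrite big_mkcond (bigD1_seq 0%MM) ?msupp_uniq //= eqxx mpolyX0 alg_mpolyC.
  by rewrite big1 ?addr0 // => m /negPf->.
rewrite {1}(mpolyE p) raddf_sum (bigID (fun m => m == 0%MM)) /= addrC.
congr (_ + _); last first.
  apply: eq_bigr => m /eqP ->.
  by rewrite linearZ /= mpolyX0 rmorph1.
rewrite /dilation mulr_sumr; apply: eq_bigr => m m0.
rewrite linearZ /= msubstXm mulrA -mpolyCM -exprS prednK ?lt0n ?mdeg_eq0 //.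
rewrite mul_mpolyC scalerA [in RHS]mulrC -scalerA; congr (_ *: _).
rewrite mdegE mpolyXE_id.
rewrite (eq_bigr _ (fun i _ => exprZn s 'X_i (m i))) scaler_prod.
by rewrite (big_morph (fun k => s ^+ k) (exprD s) (expr0 s)).
Qed.

Lemma dilation0 p : dilation p 0 = \sum_j p@_U_(j) *: 'X_j.
Proof.
apply/mpolyP=> m; rewrite /dilation !raddf_sum /=.
under eq_bigr do rewrite mcoeffCM mcoeffZ mcoeffX.
under [RHS]eq_bigr do rewrite mcoeffZ mcoeffX.
have [/mdeg1P[j /eqP mj]|m1] := boolP (mdeg m == 1%N).
  rewrite [RHS](bigD1 j) //= mj eqxx mulr1 [in RHS]big1 ?addr0; last first.
    move=> k kj; case: eqP => [/(congr1 (fun m : 'X_{1..r} => m k))|_]; last by rewrite mulr0.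
    by rewrite !mnm1E eqxx eq_sym (negPf kj).
  have [jp|jp] := boolP (U_(j)%MM \in msupp p).
    rewrite big_mkcond (bigD1_seq U_(j)%MM) ?msupp_uniq //= -mdeg_eq0 mdeg1 /= eqxx expr0 mul1r mulr1.
    by rewrite big1 ?addr0 // => m' /negPf m'j; rewrite m'j !mulr0 if_same.
  rewrite (memN_msupp_eq0 jp) big_seq_cond big1 // => m' /andP[m'p _].
  by case: eqP m'p jp => [-> -> //|]; rewrite !mulr0.
rewrite [RHS]big1 => [|j _]; last first.
  by case: (U_(j)%MM =P m) m1 => [<-|_ _]; rewrite ?mdeg1 // mulr0.
apply: big1 => m' m'0; case: eqP => [m'm|_]; last by rewrite !mulr0.
rewrite m'm in m'0 *; rewrite expr0n.
case: eqP => [E|_]; last by rewrite mul0r.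
by move: m'0 m1; rewrite -mdeg_eq0; case: (mdeg m) E => // -[].
Qed.

Lemma dilation_polynomial p : polynomial_family (dilation p).
Proof.
apply: polynomial_family_sum => m; apply: polynomial_familyM.
  have [Q QE] := @polynomial_family_horner K r 'X^((mdeg m).-1).
  by exists Q => s; rewrite -QE hornerXn.
exact: polynomial_familyC.
Qed.

Lemma cox_dilation n (v : 'I_r -> 'cV[int]_n) (u : Cl v) p s :
  cox_component u p -> cox_component u (dilation p s).
Proof.
move=> up; rewrite /dilation big_seq_cond; apply: cox_sum => m /andP[mp _].
by rewrite mul_mpolyC; do 2!apply: coxZ; rewrite -(up m mp); apply: coxX.
Qed.

End Dilation.

Section GradedInverse.
Variables (K : fieldType) (n r : nat) (v : 'I_r -> 'cV[int]_n).
Local Notation R := {mpoly K[r]}.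
Local Notation cox := (@cox_component n r v K).

Lemma graded_compo (Phi : {lrmorphism R -> R}) (u : Cl v) p :
  (forall w q, cox w q -> cox w (Phi q)) -> compo u (Phi p) = Phi (compo u p).
Proof.
move=> PhiP; pose d q := compo u (Phi q) = Phi (compo u q).
apply: (@compo_sum n r v K d) => [|f g|w]; rewrite /d ?raddf0 ?rmorphD ?raddfD //=.
  by move=> -> ->.
have [->|wu] := eqVneq w u.
  rewrite (cox_compo u (compo u p)).1; last exact: compo_cox.
  by apply/cox_compo/PhiP/compo_cox.
have -> : compo u (compo w p) = 0 by apply: compo_other wu; apply: compo_cox.
rewrite rmorph0.
by apply: compo_other wu; apply/PhiP/compo_cox.
Qed.

Lemma graded_inverse (Phi Psi : {lrmorphism R -> R}) :
  cancel Phi Psi -> cancel Psi Phi ->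
  (forall w q, cox w q -> cox w (Phi q)) -> forall w q, cox w q -> cox w (Psi q).
Proof.
move=> PhiK PsiK PhiP w q /cox_compo wq; apply/cox_compo.
by apply: (can_inj PhiK); rewrite -graded_compo // PsiK.
Qed.

Lemma lrmorphism_inverse (Phi : {lrmorphism R -> R}) : bijective Phi ->
  exists Psi : {lrmorphism R -> R}, cancel Phi Psi /\ cancel Psi Phi.
Proof.
case=> g PhiK gK; have g_lin : linear g.
  by move=> c p q; apply: (can_inj PhiK); rewrite gK (linearP Phi) /= !gK.
have g_mon : monoid_morphism g.
  split=> [|p q]; apply: (can_inj PhiK); first by rewrite gK (rmorph1 Phi).
  by rewrite gK (rmorphM Phi) /= !gK.
by exists (mk_lrmorphism g_lin g_mon).
Qed.

End GradedInverse.

(** * Matrices that mix only variables of the same class *)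

Section BlockMatrices.
Variables (K : fieldType) (r : nat) (C : eqType) (cl : 'I_r -> C).
Implicit Types M : 'M[K]_r.

Definition block_matrix M := forall i j, M i j != 0 -> cl i = cl j.

Let proj u : 'rV[K]_r := \row_i (cl i == u)%:R.

(** Commuting with the projections is visibly stable under products and inverses, unlike the
    condition on entries. *)
Lemma block_matrixP M :
  block_matrix M <-> forall u, diag_mx (proj u) *m M = M *m diag_mx (proj u).
Proof.
split=> [MP u|MP i j Mij]; last first.
  have /matrixP/(_ i j) := MP (cl i); rewrite mul_diag_mx mul_mx_diag !mxE eqxx mul1r.
  by case: eqP => // _ E; rewrite E mulr0 eqxx in Mij.
apply/matrixP=> i j; rewrite mul_diag_mx mul_mx_diag !mxE.
have [->|/MP ->] := eqVneq (M i j) 0; first by rewrite mulr0 mul0r.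
by rewrite mulrC.
Qed.

Lemma block_matrixD M N : block_matrix M -> block_matrix N -> block_matrix (M + N).
Proof.
move=> MP NP i j; rewrite mxE; apply: contraNeq => /eqP ij; apply/eqP.
have [->|/MP//] := eqVneq (M i j) 0; have [->|/NP//] := eqVneq (N i j) 0.
exact: addr0.
Qed.

Lemma block_matrixZ c M : block_matrix M -> block_matrix (c *: M).
Proof.
by move=> MP i j; rewrite mxE mulf_eq0 negb_or => /andP[_ /MP].
Qed.

Lemma block_matrix1 : block_matrix 1%:M.
Proof. by move=> i j; rewrite mxE; have [->|] := eqVneq i j; rewrite ?eqxx. Qed.

Lemma block_matrixM M N : block_matrix M -> block_matrix N -> block_matrix (M *m N).
Proof.
move=> /block_matrixP MP /block_matrixP NP; apply/block_matrixP=> u.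
by rewrite mulmxA MP -mulmxA NP mulmxA.
Qed.

Lemma block_matrixV M : M \in unitmx -> block_matrix M -> block_matrix (invmx M).
Proof.
move=> MU /block_matrixP MP; apply/block_matrixP=> u.
by rewrite -[LHS](mulKmx MU) [M *m (_ *m _)]mulmxA -MP -mulmxA mulmxV // mulmx1.
Qed.

End BlockMatrices.

Section Deformation.
Variables (K : fieldType) (n r : nat) (v : 'I_r -> 'cV[int]_n).
Local Notation R := {mpoly K[r]}.
Local Notation cox := (@cox_component n r v K).
Local Notation D i := (divclass v (prime_div i)).

Variable Phi : {lrmorphism R -> R}.
Hypothesis Phi_bij : bijective Phi.
Hypothesis Phi_graded : forall i, cox (D i) (Phi 'X_i).

Local Notation A := (linear_part Phi).
Let c i := (Phi 'X_i)@_0.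

Let A_unit : A \in unitmx. Proof. exact: linear_part_unit. Qed.

Definition linear_path s : 'M[K]_r := (1 - s) *: 1%:M + s *: A.

(** At [s = 0] the dilations reduce to the linear part [A], which [invmx A] cancels; at [s = 1] the
    matrix is the identity and [Phi 'X_i] is recovered, its constant term being scaled by [s] in
    between. *)
Definition deformation_var s i : R := (s * c i)%:MP +
  \sum_k (linear_path s *m invmx A) i k *: dilation (Phi 'X_k) s.

Definition deformation s : R -> R := msubst (deformation_var s).

HB.instance Definition _ s :=
  GRing.LRMorphism.copy (deformation s) (msubst (deformation_var s)).

Lemma deformationX s i : deformation s 'X_i = deformation_var s i.
Proof. exact: msubstX. Qed.

(** Its nonvanishing locus is the parameter space, as the segment from the identity to [A] may meet
    singular matrices. *)
Definition deformation_det : {poly K} :=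
  \det ((1 - 'X) *: 1%:M + 'X *: map_mx polyC A).

Lemma deformation_detE s : deformation_det.[s] = \det (linear_path s).
Proof.
rewrite -horner_evalE -det_map_mx; congr (\det _); apply/matrixP=> i j.
rewrite !mxE -[LHS]/(_.[s]).
by rewrite !(hornerD, hornerM, hornerN, hornerX, hornerC, hornerMn).
Qed.

Lemma deformation_det0 : deformation_det.[0] != 0.
Proof. by rewrite deformation_detE /linear_path subr0 scale1r scale0r addr0 det1 oner_neq0. Qed.

Lemma deformation_det1 : deformation_det.[1] != 0.
Proof.
rewrite deformation_detE /linear_path subrr scale0r scale1r add0r.
by rewrite -unitfE -unitmxE.
Qed.

Lemma deformation_at0 : deformation 0 =1 id.
Proof.
apply: (@mpoly_lrmorph_ext r K R (deformation 0) idfun) => i /=.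
rewrite deformationX /deformation_var mul0r mpolyC0 add0r.
rewrite /linear_path subr0 scale1r scale0r addr0 mul1mx.
under eq_bigr do rewrite dilation0 scaler_sumr.
rewrite exchange_big /=.
have E j : \sum_k invmx A i k *: ((Phi 'X_k)@_U_(j) *: 'X_j) = (i == j)%:R *: 'X_j :> R.
  have /matrixP/(_ i j) := mulVmx A_unit; rewrite !mxE => <-.
  by rewrite scaler_suml; apply: eq_bigr => k _; rewrite scalerA mxE.
rewrite (eq_bigr _ (fun j _ => E j)) (bigD1 i) //= eqxx scale1r big1 ?addr0 // => j ji.
by rewrite eq_sym (negPf ji) scale0r.
Qed.

Lemma deformation_at1 : deformation 1 =1 Phi.
Proof.
apply: (@mpoly_lrmorph_ext r K R (deformation 1) Phi) => i /=.
rewrite deformationX /deformation_var mul1r /linear_path subrr scale0r scale1r add0r.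
rewrite mulmxV // (bigD1 i) //= mxE eqxx scale1r big1; last first.
  by move=> k ki; rewrite mxE eq_sym (negPf ki) scale0r.
rewrite addr0 -[dilation _ _]mul1r -mpolyC1 dilationE addrC subrK.
apply: (@mpoly_lrmorph_ext r K R (msubst (fun i => 1 *: 'X_i : R)) idfun) => j /=.
by rewrite msubstX scale1r.
Qed.

(** For [s != 0] the map is the composite of an affine substitution, [Phi] and the dilation by [s];
    at [s = 0], where this breaks down, it is the identity. *)
Lemma deformation_bij s : deformation_det.[s] != 0 -> bijective (deformation s).
Proof.
rewrite deformation_detE -unitfE -unitmxE => path_unit.
have [->|s0] := eqVneq s 0.
  by exists id => p; rewrite deformation_at0.
pose C := linear_path s *m invmx A.
pose dil : {lrmorphism R -> R} := affine_subst (s%:M) (fun=> 0) (fun=> 0).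
pose aff : {lrmorphism R -> R} :=
  affine_subst (s^-1 *: C) (fun k => - c k) (fun i => s * c i).
have dilE : dil =1 msubst (fun i => s *: 'X_i : R).
  apply: (@mpoly_lrmorph_ext r K R dil (msubst _)) => i /=.
  rewrite msubstX /dil affine_substX mpolyC0 addr0 (bigD1 i) //= mxE eqxx mulr1n addr0.
  by rewrite big1 ?addr0 // => k ki; rewrite mxE eq_sym (negPf ki) mulr0n scale0r.
have E : deformation s =1 dil \o Phi \o aff.
  apply: (@mpoly_lrmorph_ext r K R (deformation s) (dil \o Phi \o aff)) => i /=.
  rewrite deformationX /aff affine_substX !rmorphD /= !(lrmorphC Phi) !(lrmorphC dil).
  rewrite addrC; congr (_ + _); rewrite !raddf_sum /=; apply: eq_bigr => k _.
  rewrite !linearZ /= !rmorphD /= (lrmorphC Phi) (lrmorphC dil) mpolyCN.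
  by rewrite dilE -dilationE mul_mpolyC scalerA [(_ *: C) i k]mxE -/C mulrAC mulVf ?mul1r.
have sU : s%:M \in @unitmx K r by rewrite unitmxE det_scalar unitfE expf_neq0.
have CU : s^-1 *: C \in unitmx.
  rewrite -mul_scalar_mx unitmx_mul /C unitmx_mul path_unit unitmx_inv A_unit !andbT.
  by rewrite unitmxE det_scalar unitfE expf_neq0 ?invr_neq0.
suff : bijective (dil \o Phi \o aff) by move/eq_bij; apply=> p; rewrite E.
apply: bij_comp; last exact: affine_subst_bij.
by apply: bij_comp => //; apply: affine_subst_bij.
Qed.

(** Nonzero constants [c i] occur only for variables of class 0, and the matrix is block diagonal
    for the classes. *)
Lemma deformation_graded s w p : cox w p -> cox w (deformation s p).
Proof.
move=> wp; apply: (@cox_msubst n r v K (deformation s) idfun) wp => i /=.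
rewrite deformationX; apply: coxD.
  have [->|ci] := eqVneq (c i) 0; first by rewrite mulr0 mpolyC0; apply: cox0.
  by have := (coxP _ _).1 (@Phi_graded i) _ ci; rewrite mclass0 => <-; apply: coxC.
have A_block : block_matrix (fun i => D i) A.
  move=> k l; rewrite mxE => /((coxP _ _).1 (@Phi_graded k)).
  by rewrite mclass1.
have C_block : block_matrix (fun i => D i) (linear_path s *m invmx A).
  apply: block_matrixM; last exact: block_matrixV.
  by apply: block_matrixD; apply: block_matrixZ => //; apply: block_matrix1.
apply: cox_sum => k _; have [->|/C_block ->] := eqVneq ((linear_path s *m invmx A) i k) 0.
  by rewrite scale0r; apply: cox0.
exact/coxZ/cox_dilation.
Qed.

Lemma deformation_polynomial p : polynomial_family (fun s => deformation s p).
Proof.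
apply: polynomial_family_msubst => i; rewrite /deformation_var.
apply: polynomial_familyD.
  have [Q QE] := polynomial_familyM (polynomial_family_id K r) (polynomial_familyC (c i)%:MP).
  by exists Q => s; rewrite -QE mpolyCM.
apply: polynomial_family_sum => k.
pose q : {poly K} := (((1 - 'X) *: 1%:M + 'X *: map_mx polyC A) *m map_mx polyC (invmx A)) i k.
have qE s : (linear_path s *m invmx A) i k = q.[s].
  rewrite /q !mxE horner_sum; apply: eq_bigr => l _.
  by rewrite !mxE !(hornerD, hornerM, hornerN, hornerX, hornerC, hornerMn).
have [Q QE] := polynomial_familyM (polynomial_family_horner r q)
  (dilation_polynomial (Phi 'X_k)).
by exists Q => s; rewrite -QE qE mul_mpolyC.
Qed.

End Deformation.

(** * Open subsets of the affine line as parameter spaces *)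

Section OpenLine.
Variables (K : closedFieldType) (d : {poly K}).

Definition open_line : variety K :=
  @Variety K {s : K | d.[s] != 0} (fun f =>
    exists (P : {poly K}) (N : nat), forall x, f x = P.[val x] / d.[val x] ^+ N).

Implicit Types x : open_line.

Let e x (i : 'I_2) : K := if i == 0 then val x else (d.[val x])^-1.
Let horner_mpoly (P : {poly K}) : {mpoly K[2]} := (map_poly (@mpolyC 2 K) P).['X_0].

Let meval_horner P y : (horner_mpoly P).@[y] = P.[y 0].
Proof.
rewrite /horner_mpoly -horner_map /= mevalXU -map_poly_comp.
by rewrite map_poly_id // => c _ /=; rewrite mevalC.
Qed.

(** The embedding is onto the plane curve [d(x) * y = 1], whose second coordinate supplies the
    denominators. *)
Lemma open_line_affine : affine_variety open_line.
Proof.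
exists 2, e, (fun p => p = horner_mpoly d * 'X_1 - 1); split.
- by move=> x y /(congr1 (fun f : 'I_2 -> K => f 0)) E; apply: val_inj.
- move=> y; split=> [[x <-] p ->|/(_ _ erefl)].
    rewrite mevalB mevalM meval1 mevalXU meval_horner /e /=.
    by rewrite mulfV ?subrr //; apply: (valP x).
  rewrite mevalB mevalM meval1 mevalXU meval_horner => /eqP.
  rewrite subr_eq0 => /eqP dy; have dy0 : d.[y 0] != 0.
    by apply: contra_eq_neq dy => ->; rewrite mul0r eq_sym oner_eq0.
  exists (Sub (y 0) dy0 : {s : K | d.[s] != 0}); apply: boolp.funext => i.
  rewrite /e SubK; case: eqP => [->//|/eqP i0].
  have -> : i = 1 by apply/val_inj; case: i i0 => -[|[|//]].
  by apply: (mulfI dy0); rewrite mulfV.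
move=> f; split=> [[P [N fE]]|[p fE]].
  exists (horner_mpoly P * 'X_1 ^+ N) => x.
  by rewrite fE mevalM meval_horner rmorphXn /= mevalXU /e /= exprVn.
suff [P [N PE]] : exists P N, forall x, p.@[e x] = P.[val x] / d.[val x] ^+ N.
  by exists P, N => x; rewrite fE PE.
have d0 x : d.[val x] != 0 by apply: (valP x).
elim/mpoly_closed_ind: p {f fE} => [c|i|p q [P [N PE]] [Q [M QE]]|p q [P [N PE]] [Q [M QE]]].
- by exists c%:P, 0%N => x; rewrite mevalC hornerC expr0 divr1.
- have [->|i0] := eqVneq i 0.
    by exists 'X, 0%N => x; rewrite mevalXU hornerX expr0 divr1.
  by exists 1, 1%N => x; rewrite mevalXU hornerC expr1 /e (negPf i0) div1r.
- exists (P * d ^+ M + Q * d ^+ N), (N + M)%N => x.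
  rewrite mevalD PE QE hornerD !hornerM !horner_exp exprD.
  by field; rewrite !expf_neq0.
- exists (P * Q), (N + M)%N => x.
  by rewrite mevalM PE QE hornerM exprD invfM mulrACA.
Qed.

Hypothesis charK0 : [pchar K] =i pred0.

(** Each proper closed subset is killed by a nonzero polynomial; if two of them covered the line,
    the product of these polynomials with [d] would vanish on the infinite field [K]. *)
Lemma open_line_irreducible : (exists s, d.[s] != 0) -> irreducible_variety open_line.
Proof.
move=> [s ds]; split; first by constructor; exact: (Sub s ds).
move=> Z1 Z2 [F1 [F1r Z1E]] [F2 [F2r Z2E]] cover.
have nonzero (Z : open_line -> Prop) (F : (open_line -> K) -> Prop) :
    (forall f, F f -> regular f) -> (forall x, Z x <-> forall f, F f -> f x = 0) ->
    ~ (forall x, Z x) -> exists2 P : {poly K}, P != 0 & forall x, Z x -> P.[val x] = 0.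
  move=> Fr ZE /boolp.existsNP[x] /ZE/boolp.existsNP[f] /boolp.not_implyP[Ff /eqP fx].
  have [P [N fE]] := Fr f Ff; exists P.
    by apply: contra_neq fx => P0; rewrite fE P0 horner0 mul0r.
  move=> y /ZE/(_ f Ff); rewrite fE => /eqP; rewrite mulf_eq0 invr_eq0 => /orP[/eqP//|].
  by rewrite expf_eq0 (negPf (valP y)) andbF.
apply: boolp.contrapT => /boolp.not_orP[/(nonzero _ _ F1r Z1E)[P P0 PZ] /(nonzero _ _ F2r Z2E)[Q Q0 QZ]].
have d0 : d != 0 by apply: contraNneq ds => ->; rewrite horner0.
suff /eqP : P * Q * d = 0 by rewrite !mulf_eq0 (negPf P0) (negPf Q0) (negPf d0).
apply: (poly_vanishing charK0) => c; rewrite !hornerM.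
have [->|dc] := eqVneq d.[c] 0; first by rewrite mulr0.
pose x : open_line := Sub c dc.
have [/PZ|/QZ] := cover x; rewrite SubK => ->; by rewrite ?mul0r // mulr0 mul0r.
Qed.

End OpenLine.

Section PreservesConnected.
Variables (K : closedFieldType) (charK0 : [pchar K] =i pred0) (n r : nat).
Variables (sigma : 'cV[rat]_n -> Prop) (v : 'I_r -> 'cV[int]_n).
Hypothesis dualP : forall m : 'rV[int]_n,
  reflect (forall i, 0 <= pairing m (v i)) (m \in dual_semigroup sigma).
Hypothesis v_full : forall m : 'rV[int]_n,
  (forall i, pairing m (v i) = 0) -> m = 0.
Hypothesis v_facet : forall i, exists m : 'rV[int]_n,
  pairing m (v i) = 0 /\ forall j, j != i -> 0 < pairing m (v j).
Hypothesis v_primitive : forall i, exists m : 'rV[int]_n, pairing m (v i) = 1.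

Local Notation A := (semigroup_alg K (dual_monoid sigma)).
Local Notation R := {mpoly K[r]}.
Local Notation X := (toric_variety K sigma).
Local Notation cox := (@cox_component n r v K).
Local Notation iota := (iota K dualP).
Local Notation retract := (retract dualP).

Lemma ex_graded_descent (Phi : {lrmorphism R -> R}) :
  bijective Phi -> (forall w p, cox w p -> cox w (Phi p)) ->
  exists a : {lrmorphism A -> A},
    (forall f, iota (a f) = Phi (iota f)) /\ is_automorphism (pullback a : X -> X).
Proof.
move=> Phi_bij Phi_graded; have [Psi [PhiK PsiK]] := lrmorphism_inverse Phi_bij.
have Psi_graded := graded_inverse PhiK PsiK Phi_graded.
have [a aE] := ex_descent dualP v_full (@Phi_graded 0).
have [b bE] := ex_descent dualP v_full (@Psi_graded 0).
exists a; split=> //; apply: (pullback_automorphism (b := b)) => f.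
  by apply: (iota_inj (dualP := dualP) v_full); rewrite bE aE PhiK.
by apply: (iota_inj (dualP := dualP) v_full); rewrite aE bE PsiK.
Qed.

Lemma preserves_connected : normalizing_preserves v K -> Aut_connected X.
Proof.
move=> preserves g g_aut.
have [phi [psi [phiE phiK psiK]]] := automorphism_comorphism dualP v_full charK0 g_aut.
have [Phi [rho [Phi_bij rhoP PhiE]]] := cox_lift dualP v_full v_facet v_primitive phiK psiK.
have /preserves[_ [_ gammaE]] : in_Aut_tilde v Phi by split=> //; exists rho.
have Phi_graded i : cox (divclass v (prime_div i)) (Phi 'X_i).
  by apply/(gammaE (divclass v (prime_div i))); exists 'X_i => //; apply: coxXU.
pose d := deformation_det Phi; pose S := open_line d.
have ex_a (s : S) : exists a : {lrmorphism A -> A},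
    (forall f, iota (a f) = deformation Phi (val s) (iota f)) /\
    is_automorphism (pullback a : X -> X).
  apply: ex_graded_descent; first exact/deformation_bij/(valP s).
  exact: deformation_graded.
have [a aP] := boolp.choice ex_a.
exists S; split; first exact: open_line_affine.
  by apply: (open_line_irreducible charK0); exists 0; apply: deformation_det0.
exists (fun s => pullback (a s) : X -> X); split.
  split=> [s|f [h hE]]; first by have [] := aP s.
  (* Expanding in powers of the parameter and projecting each coefficient to degree 0 writes the
     pulled back function as an element of the tensor product of the coordinate rings. *)
  have [Q QE] := deformation_polynomial Phi (iota h).
  exists (size Q), (fun j (s : S) => val s ^+ j), (fun j (x : X) => x (retract Q`_j)).
  split=> [j|j|[s x] /=].
  - by exists 'X^j, 0%N => s; rewrite hornerXn expr0 divr1.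
  - by exists (retract Q`_j).
  rewrite hE /pullback /=; have [asE _] := aP s.
  have -> : a s h = \sum_(j < size Q) val s ^+ j *: retract Q`_j.
    apply: (iota_inj (dualP := dualP) v_full).
    have <- : compo (0 : Cl v) (iota (a s h)) = iota (a s h) by apply/cox_compo/iota_cox.
    rewrite asE QE horner_coef !raddf_sum; apply: eq_bigr => j _ /=.
    by rewrite -rmorphXn mulrC mul_mpolyC !linearZ /= retractK.
  pose y : {lrmorphism A -> K^o} := x.
  rewrite -[LHS]/(y _) raddf_sum; apply: eq_bigr => j _.
  by rewrite /= linearZ.
exists (Sub 0 (deformation_det0 Phi)), (Sub 1 (deformation_det1 Phi_bij)).
split=> x; apply: lrmorphism_eq => f; rewrite /pullback /=.
  have [E _] := aP (Sub 0 (deformation_det0 Phi)); congr (x _).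
  by apply: (iota_inj (dualP := dualP) v_full); rewrite E SubK deformation_at0.
have [E _] := aP (Sub 1 (deformation_det1 Phi_bij)); rewrite phiE; congr (x _).
by apply: (iota_inj (dualP := dualP) v_full); rewrite E SubK deformation_at1 // PhiE.
Qed.

End PreservesConnected.

(** * Families and permutations of the divisor classes *)

Section SymmetryPermutation.
Variables (n : nat) (sigma : 'cV[rat]_n -> Prop) (r : nat) (v : 'I_r -> 'cV[int]_n).
Hypothesis v_rays : lists_primitive_vectors sigma v.

Lemma symmetry_permutes_rays (L : 'M[int]_n) : L \in unitmx -> stabilizes_cone sigma L ->
  exists s : 'S_r, forall i, L *m v i = v (s i).
Proof.
move=> LU Lsigma; pose L' := invmx L.
have LL' : L *m L' = 1%:M by apply: mulmxV.
have L'L : L' *m L = 1%:M by apply: mulVmx.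
pose Q : 'M[rat]_n := map_mx intr L; pose Q' : 'M[rat]_n := map_mx intr L'.
have QQ' x : Q *m (Q' *m x) = x :> 'cV_n by rewrite mulmxA -map_mxM LL' map_mx1 mul1mx.
have Q'Q x : Q' *m (Q *m x) = x :> 'cV_n by rewrite mulmxA -map_mxM L'L map_mx1 mul1mx.
have toQ x : Q *m toNQ x = toNQ (L *m x) by rewrite /toNQ map_mxM.
have toQ' x : Q' *m toNQ x = toNQ (L' *m x) by rewrite /toNQ map_mxM.
have sigmaQ' x : sigma (Q' *m x) <-> sigma x.
  split=> [sx|/Lsigma[y sy ->]]; last by rewrite Q'Q.
  by apply/Lsigma; exists (Q' *m x); rewrite ?QQ'.
have [v_inj v_ray v_all] := v_rays.
have ex_j i : exists j, L *m v i = v j.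
  have [rho [[u u_dual uE] [w w0 wE]] [rho_v vi0 v_min]] := v_ray i.
  pose rho' x := rho (Q' *m x).
  have ray' : is_ray sigma rho'.
    split.
      have uQ' x : pairing (u *m Q') x = pairing u (Q' *m x) by rewrite /pairing mulmxA.
      exists (u *m Q') => [x sx|x]; rewrite uQ'; first by apply/u_dual/sigmaQ'.
      by rewrite -sigmaQ'; apply: uE.
    exists (Q *m w); first by apply: contra_neq w0 => w0; rewrite -(Q'Q w) w0 mulmx0.
    move=> x; rewrite /rho' wE; split=> -[c c0 cE]; exists c => //.
      by rewrite scalemxAr -cE QQ'.
    by rewrite cE -scalemxAr Q'Q.
  have prim' : is_primitive_vector rho' (L *m v i).
    split.
    - by rewrite /rho' -toQ Q'Q.
    - by apply: contra_neq vi0 => Lv0; rewrite -(mul1mx (v i)) -L'L -mulmxA Lv0 mulmx0.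
    - move=> w'; rewrite /rho' toQ' => /v_min H w'0; have [|c c1 cE] := H.
        by apply: contra_neq w'0 => Lw0; rewrite -(mul1mx w') -LL' -mulmxA Lw0 mulmx0.
      by exists c => //; rewrite -(QQ' (toNQ w')) toQ' cE -scalemxAr toQ.
  have [j vj] := v_all _ ray'; exists j.
  apply: (primitive_vector_unique ray' prim' vj).
  by case: vj.
have [s sE] := boolp.choice ex_j.
have s_inj : injective s.
  move=> i j sij; apply: v_inj; rewrite -(mul1mx (v i)) -(mul1mx (v j)) -L'L -!mulmxA.
  by rewrite !sE sij.
by exists (perm s_inj) => i; rewrite permE.
Qed.

End SymmetryPermutation.

Section ClassSeparation.
Variables (n r : nat) (v : 'I_r -> 'cV[int]_n).
Hypothesis v_facet : forall i, exists m : 'rV[int]_n,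
  pairing m (v i) = 0 /\ forall j, j != i -> 0 < pairing m (v j).
Hypothesis v_primitive : forall i, exists m : 'rV[int]_n, pairing m (v i) = 1.
Local Notation D i := (divclass v (prime_div i)).

Lemma symmetry_class_map (L : 'M[int]_n) (s : 'S_r) : L \in unitmx ->
  (forall i, L *m v i = v (s i)) -> forall x : 'I_r -> int,
  \sum_i D i *~ x i = 0 -> \sum_i D (s i) *~ x i = 0.
Proof.
move=> LU sE x /divclass_pairing_sum[m mE].
have x'E i : x i = pairing (m *m invmx L) (v (s i)).
  by rewrite mE -sE /pairing -!mulmxA mulKmx.
transitivity (\sum_i D i *~ pairing (m *m invmx L) (v i)); last first.
  by apply/divclass_pairing_sum; exists (m *m invmx L).
by rewrite [RHS](reindex_inj (@perm_inj _ s)); apply: eq_bigr => i _; rewrite x'E.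
Qed.

(** By the double annihilator argument over the rationals, [v k] lies in the span of the [v l] with
    [l] in [B]; [d] clears the denominators. *)
Lemma rational_relation (B : {pred 'I_r}) k :
  (forall m : 'rV[int]_n, (forall l, l \in B -> pairing m (v l) = 0) -> pairing m (v k) = 0) ->
  exists (d : nat) (z : 'I_r -> int), (0 < d)%N /\
    forall m : 'rV[int]_n, d%:Z * pairing m (v k) = \sum_(l in B) z l * pairing m (v l).
Proof.
move=> vkB; pose W : 'M[rat]_(r, n) := \matrix_(l, j) (if l \in B then (v l j 0)%:~R else 0).
pose w : 'rV[rat]_n := (toNQ (v k))^T.
have wW : (w <= W)%MS.
  rewrite submxE; apply/eqP/rowP=> j; rewrite [RHS]mxE.
  have [d [m [d0 mE]]] := clear_denominators (col j (cokermx W))^T.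
  have dE u : d%:R * (u *m cokermx W) 0 j = (u *m (toMQ m)^T) 0 0.
    rewrite mE [RHS]mxE [in LHS]mxE mulr_sumr.
    by apply: eq_bigr => l _; rewrite !mxE mulrCA.
  have dQ0 : d%:R != 0 :> rat by rewrite pnatr_eq0 -lt0n.
  apply: (mulfI dQ0); apply/eqP; rewrite mulr0.
  rewrite dE /w -trmx_mul [(_ ^T) 0 0]mxE -[(_ *m _) 0 0]/(pairing _ _) pairing_toQ intr_eq0.
  apply/eqP/vkB => l lB; apply/eqP; rewrite -(intr_eq0 rat) -pairing_toQ.
  have -> : pairing (toMQ m) (toNQ (v l)) = d%:R * (row l W *m cokermx W) 0 j.
    rewrite dE /pairing; have -> : row l W = (toNQ (v l))^T.
      by apply/rowP=> i; rewrite !mxE lB.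
    by rewrite -trmx_mul [RHS]mxE.
  by rewrite -row_mul mulmx_coker row0 mxE mulr0.
have [c cE] := submxP wW; have [d [z [d0 zE]]] := clear_denominators c.
exists d, (fun l => z 0 l); split=> // m; apply/eqP; rewrite -(eqr_int rat) rmorphM /=.
have -> : (pairing m (v k))%:~R = (w *m (toMQ m)^T) 0 0 :> rat.
  by rewrite /w -trmx_mul [RHS]mxE -pairing_toQ.
have -> : d%:~R * (w *m (toMQ m)^T) 0 0 = (toMQ z *m (W *m (toMQ m)^T)) 0 0.
  by rewrite zE cE -mulmxA -scalemxAl [RHS]mxE.
rewrite [X in X == _]mxE rmorph_sum /= [X in _ == X]big_mkcond /=.
apply/eqP/eq_bigr => l _; rewrite rmorphM /= [toMQ z 0 l]mxE.
have -> : (W *m (toMQ m)^T) l 0 = if l \in B then (pairing m (v l))%:~R else 0.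
  rewrite -pairing_toQ /pairing [LHS]mxE; case: ifP => lB.
    by rewrite mxE; apply: eq_bigr => j _; rewrite !mxE lB mulrC.
  by apply: big1 => j _; rewrite !mxE lB mul0r.
by case: ifP; rewrite // mulr0.
Qed.

(* The coefficients of a linear relation between the [v l] define an additive
   map on the class group, hence are constant on each class of divisors. *)
Lemma class_separation i k : D k <> D i -> D k <> 0 ->
  exists m : 'rV[int]_n,
    (forall l, D l = 0 \/ D l = D i -> pairing m (v l) = 0) /\ pairing m (v k) != 0.
Proof.
move=> Dki Dk0; apply: boolp.contrapT => no_m.
pose B : {pred 'I_r} := [pred l | (D l == 0) || (D l == D i)].
have BP l : reflect (D l = 0 \/ D l = D i) (l \in B).
  by rewrite inE; apply: (iffP orP) => -[/eqP|/eqP]; auto.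
have [|d [z [d0 zE]]] := @rational_relation B k.
  move=> m mB; apply/eqP/negPn/negP => mk; apply: no_m; exists m; split=> // l /BP.
  exact: mB.
have kB : k \notin B by apply/BP => -[].
pose x l := if l == k then d%:Z else if l \in B then - z l else 0.
have [m|f fE] := @ex_Cl_additive _ _ v int x.
  rewrite (bigD1 k) //= {1}/x eqxx -mulrzr intz zE [X in X + _]big_mkcond /=.
  rewrite (bigD1 k) //= (negPf kB) add0r -big_split big1 //= => l lk.
  rewrite -mulrzr intz /x (negPf lk); case: ifP => _; last by rewrite mul0r addr0.
  by rewrite mulNr subrr.
have x0 l : D l = 0 -> x l = 0 by move=> Dl; rewrite -fE Dl raddf0.
have xi l : D l = D i -> x l = x i by move=> Dl; rewrite -!fE Dl.
have ik : i != k by apply: contra_not_neq Dki => ->.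
have [mk [mk0 mkP]] := v_facet k.
have zB l : l \in B -> z l = if D l == D i then - x i else 0.
  move=> lB; have lk : l != k by apply: contraNneq kB => <-.
  have zl : z l = - x l by rewrite /x (negPf lk) lB opprK.
  by rewrite zl; case: eqP => [/xi ->//|Dl]; case/BP: lB => // /x0 ->; rewrite oppr0.
(* The coefficients vanish on class 0 and are constant on the class of [i], so only one of them
   survives. *)
have relE m : d%:Z * pairing m (v k) = - x i * \sum_(l | D l == D i) pairing m (v l).
  rewrite zE mulr_sumr big_mkcond [RHS]big_mkcond; apply: eq_bigr => l _.
  case: ifP => [/zB ->|lB]; first by case: eqP => // _; rewrite mul0r.
  by case: eqP => // Dl; case/BP: lB; right.
(* At the character vanishing on [v k] and positive on the other rays, the left side of [relE] is 0
   and the sum is positive. *)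
have xi0 : x i = 0.
  have /esym/eqP := relE mk; rewrite mk0 mulr0 mulf_eq0 oppr_eq0 => /orP[/eqP//|].
  rewrite gt_eqF // (bigD1 i) //=; apply: ltr_wpDr; last exact: mkP.
  apply: sumr_ge0 => l /andP[/eqP Dl _]; apply/ltW/mkP.
  by apply: contra_not_neq Dki => <-.
have [m mE] := v_primitive k.
have := relE m; rewrite mE xi0 oppr0 mul0r mulr1 => /eqP.
by rewrite eqz_nat eqn0Ngt d0.
Qed.

Lemma ex_class0_dual l : D l = 0 -> exists m : 'rV[int]_n,
  forall j, pairing m (v j) = (j == l)%:Z.
Proof.
move=> /divclass_eq0[m mE]; exists m => j; rewrite -mE /prime_div mxE eqxx eq_sym.
by case: eqP.
Qed.

(** A ray of class 0 has a character that is 1 on it and 0 on all other rays; subtracting multiples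
    of these from an interior character clears exactly the coordinates of class 0. *)
Lemma ex_interior_off_class0 : exists m : 'rV[int]_n,
  forall i, if D i == 0 then pairing m (v i) = 0 else 0 < pairing m (v i).
Proof.
have [m0 m0P] := ex_interior v_facet v_primitive.
have ex_p l : exists p : 'rV[int]_n, forall j,
    pairing p (v j) = if D l == 0 then (j == l)%:Z else 0.
  case: eqP => [/ex_class0_dual//|_]; exists 0 => j; exact: pairing0l.
have [p pE] := boolp.choice ex_p.
exists (m0 - \sum_l pairing m0 (v l) *: p l) => i.
have -> : pairing (m0 - \sum_l pairing m0 (v l) *: p l) (v i) =
    pairing m0 (v i) - (if D i == 0 then pairing m0 (v i) else 0).
  rewrite pairingBl pairing_suml; congr (_ - _).
  rewrite (bigD1 i) //= pairingZl pE eqxx big1 ?addr0.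
    by case: ifP => _; rewrite ?mulr1 ?mulr0.
  by move=> l li; rewrite pairingZl pE (eq_sym i) (negPf li) if_same mulr0.
by case: ifP => E; rewrite E ?subrr ?subr0 ?m0P.
Qed.

End ClassSeparation.

(** * Leading forms along lines through the origin *)

Section LeadingForms.
Variables (K : fieldType) (r : nat).
Local Notation R := {mpoly K[r]}.
Implicit Types (p q : R) (y : 'I_r -> K).

Definition line_eval y : R -> {poly K} := msubst (fun i => y i *: 'X : {poly K}).

HB.instance Definition _ y := GRing.LRMorphism.copy (line_eval y)
  (msubst (fun i => y i *: 'X : {poly K})).

Lemma line_evalC y c : line_eval y c%:MP = c%:P.
Proof. by rewrite -[c%:MP]mulr1 mul_mpolyC linearZ rmorph1 /= alg_polyC. Qed.

Lemma line_evalX y i : line_eval y 'X_i = y i *: 'X.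
Proof. exact: msubstX. Qed.

Lemma coef0_line_eval y p : (line_eval y p)`_0 = p@_0.
Proof.
elim/mpoly_closed_ind: p => [c|i|p q IHp IHq|p q IHp IHq].
- by rewrite line_evalC coefC mpolyCK.
- by rewrite line_evalX coefZ coefX mulr0 mcoeffX -mdeg_eq0 mdeg1.
- by rewrite rmorphD /= coefD mcoeffD IHp IHq.
- by rewrite rmorphM /= coef0M mcoeff0M IHp IHq.
Qed.

Lemma coef1_line_eval y p : (line_eval y p)`_1 = \sum_j p@_U_(j) * y j.
Proof.
elim/mpoly_closed_ind: p => [c|i|p q IHp IHq|p q IHp IHq].
- rewrite line_evalC coefC big1 // => j _.
  by rewrite mcoeffUC mul0r.
- rewrite line_evalX coefZ coefX mulr1 (bigD1 i) //= mcoeffXU eqxx mul1r.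
  by rewrite big1 ?addr0 // => j ji; rewrite mcoeffXU eq_sym (negPf ji) mul0r.
- rewrite rmorphD /= coefD IHp IHq -big_split; apply: eq_bigr => j _ /=.
  by rewrite mcoeffD mulrDl.
- rewrite rmorphM /= coefM !big_ord_recl big_ord0 addr0 /= !coef0_line_eval IHp IHq.
  rewrite mulr_sumr mulr_suml -big_split; apply: eq_bigr => j _ /=.
  by rewrite mcoeffUM; ring.
Qed.

Lemma poly_coef0_split (p : {poly K}) : p`_0 = 0 -> exists q : {poly K}, p = 'X * q /\ q`_0 = p`_1.
Proof.
move=> p0; exists (\poly_(j < size p) p`_j.+1); split.
  apply/polyP=> -[|k]; rewrite coefXM //= coef_poly; case: ltnP => // le_k.
  by rewrite nth_default // ltnW.
by rewrite coef_poly; case: ltnP => // le_p; rewrite nth_default // ltnW.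
Qed.

(** Every factor that really occurs is divisible by ['X] on the line, so [\sum_i e i] is the lowest
    possible order and its coefficient is multiplicative. *)
Lemma line_eval_prod y (F : 'I_r -> R) (e : 'I_r -> nat) :
  (forall i, (0 < e i)%N -> (F i)@_0 = 0) ->
  (line_eval y (\prod_i F i ^+ e i))`_(\sum_i e i) =
  \prod_i ((line_eval y (F i))`_1) ^+ e i.
Proof.
move=> F0; have ex_q i : exists q : {poly K}, line_eval y (F i) ^+ e i = 'X^(e i) * q ^+ e i /\
    ((0 < e i)%N -> q`_0 = (line_eval y (F i))`_1).
  have [ei|ei] := posnP (e i); first by exists 1; rewrite ei !expr0 mulr1.
  have [|q [qE q0]] := @poly_coef0_split (line_eval y (F i)).
    by rewrite coef0_line_eval F0.
  by exists q; rewrite {1}qE exprMn.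
have [q qP] := boolp.choice ex_q.
have -> : line_eval y (\prod_i F i ^+ e i) = 'X^(\sum_i e i) * \prod_i q i ^+ e i.
  rewrite rmorph_prod /= (big_morph (fun k => 'X ^+ k : {poly K}) (exprD 'X) (expr0 'X)).
  rewrite -big_split; apply: eq_bigr => i _ /=.
  by rewrite rmorphXn /=; have [-> _] := qP i.
rewrite coefXnM ltnn subnn -horner_coef0 horner_prod; apply: eq_bigr => i _.
rewrite horner_exp horner_coef0; have [ei|ei] := posnP (e i); first by rewrite ei !expr0.
by have [_ ->] := qP i.
Qed.

End LeadingForms.

(** * Regular functions on an irreducible affine parameter space *)

Section AffineRegular.
Variables (K : closedFieldType) (S : variety K).
Hypothesis S_affine : affine_variety S.
Implicit Types (f g : S -> K).

Lemma regularC c : regular (fun _ : S => c).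
Proof.
have [k [e [I [_ _ regE]]]] := S_affine; apply/regE.
by exists c%:MP => x; rewrite mevalC.
Qed.

Lemma regularD f g : regular f -> regular g -> regular (fun x => f x + g x).
Proof.
have [k [e [I [_ _ regE]]]] := S_affine => /regE[p fE] /regE[q gE]; apply/regE.
by exists (p + q) => x; rewrite mevalD fE gE.
Qed.

Lemma regularM f g : regular f -> regular g -> regular (fun x => f x * g x).
Proof.
have [k [e [I [_ _ regE]]]] := S_affine => /regE[p fE] /regE[q gE]; apply/regE.
by exists (p * q) => x; rewrite mevalM fE gE.
Qed.

Lemma regular_sum (J : Type) (t : seq J) (F : J -> S -> K) :
  (forall j, regular (F j)) -> regular (fun x => \sum_(j <- t) F j x).
Proof.
have [k [e [I [_ _ regE]]]] := S_affine => FP.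
have [p pE] := boolp.choice (fun j => (regE (F j)).1 (FP j)).
apply/regE; exists (\sum_(j <- t) p j) => x.
by rewrite raddf_sum; apply: eq_bigr => j _; rewrite pE.
Qed.

Hypothesis S_irreducible : irreducible_variety S.

Lemma irreducible_mul f g : regular f -> regular g ->
  (exists x, f x != 0) -> (exists x, g x != 0) -> exists x, f x * g x != 0.
Proof.
move=> freg greg [x fx] [y gy]; apply: boolp.contrapT => no_z.
have closed (h : S -> K) : regular h -> zariski_closed (fun z => h z = 0).
  move=> hreg; exists (fun h' => h' = h); split=> [_ ->//|z].
  by split=> [hz _ ->//|/(_ h erefl)].
have [_ irr] := S_irreducible.
have [z|fz|gz] := irr _ _ (closed f freg) (closed g greg); last 2 first.
- by rewrite fz eqxx in fx.
- by rewrite gz eqxx in gy.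
have [fz|fz] := eqVneq (f z) 0; first by left.
right; apply/eqP/negPn/negP => gz; apply: no_z; exists z.
by rewrite mulf_neq0.
Qed.

Lemma irreducible_prod (J : Type) (t : seq J) (F : J -> S -> K) :
  (forall j, regular (F j)) -> (forall j, exists x, F j x != 0) ->
  exists x, \prod_(j <- t) F j x != 0.
Proof.
move=> Freg Fnz; suff [_ H] : regular (fun x => \prod_(j <- t) F j x) /\
  exists x, \prod_(j <- t) F j x != 0 by [].
elim: t => [|j t [IHreg IHnz]].
  have [[x] _] := S_irreducible; split; last by exists x; rewrite big_nil oner_neq0.
  by under boolp.eq_fun do rewrite big_nil; apply: regularC.
split; first by under boolp.eq_fun do rewrite big_cons; apply: regularM.
have [x xP] := irreducible_mul (Freg j) IHreg (Fnz j) IHnz.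
by exists x; rewrite big_cons.
Qed.

End AffineRegular.

Section ConnectedNoSymmetry.
Variables (K : closedFieldType) (charK0 : [pchar K] =i pred0) (n r : nat).
Variables (sigma : 'cV[rat]_n -> Prop) (v : 'I_r -> 'cV[int]_n).
Hypothesis dualP : forall m : 'rV[int]_n,
  reflect (forall i, 0 <= pairing m (v i)) (m \in dual_semigroup sigma).
Hypothesis v_full : forall m : 'rV[int]_n,
  (forall i, pairing m (v i) = 0) -> m = 0.
Hypothesis v_facet : forall i, exists m : 'rV[int]_n,
  pairing m (v i) = 0 /\ forall j, j != i -> 0 < pairing m (v j).
Hypothesis v_primitive : forall i, exists m : 'rV[int]_n, pairing m (v i) = 1.

Local Notation A := (semigroup_alg K (dual_monoid sigma)).
Local Notation R := {mpoly K[r]}.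
Local Notation X := (toric_variety K sigma).
Local Notation cox := (@cox_component n r v K).
Local Notation iota := (iota K dualP).
Local Notation mono := (mono v).
Local Notation D i := (divclass v (prime_div i)).
Implicit Types (a b : dual_monoid sigma) (y : 'I_r -> K) (s : 'S_r).

(** Variables of class 0 are excluded because a constant term in their images would spoil the
    leading coefficient. *)
Definition admissible s i a1 a2 y1 y2 :=
  [/\ D i <> 0, forall k, D k = 0 -> mono a1 k = 0%N /\ mono a2 k = 0%N,
      forall k, D k = D i -> mono a1 k = mono a2 k
    & forall j, D j <> D (s i) -> y1 j = y2 j].

Definition leading_value (Phi : A -> R) a y : K :=
  (line_eval y (Phi (sgchi K a)))`_(\sum_i mono a i).

(* Expresses that the leading form of [Phi chi^a1 / Phi chi^a2] does not involve
   the variables of class [D (s i)] when the exponents of [a1] and [a2] agree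
   on the variables of class [D i]. *)
Definition cross_relation (Phi : A -> R) a1 a2 y1 y2 :=
  leading_value Phi a1 y1 * leading_value Phi a2 y2 -
  leading_value Phi a1 y2 * leading_value Phi a2 y1.

Lemma leading_valueE (Phi : {lrmorphism R -> R}) a y :
  (forall k, (0 < mono a k)%N -> (Phi 'X_k)@_0 = 0) ->
  leading_value (Phi \o iota) a y = \prod_k (line_eval y (Phi 'X_k))`_1 ^+ mono a k.
Proof.
by move=> Phi0; rewrite /leading_value /= iota_monoE line_eval_prod.
Qed.

(** The two products agree factor by factor: for [k] in the class of [i] the exponents coincide, and
    for any other [k] the linear part of [Phi 'X_k] avoids the class [D (s i)], so its values at
    [y1] and [y2] are equal. *)
Lemma gamma_cross_relation (Phi : {lrmorphism R -> R}) (rho : {additive Cl v -> Cl v}) s :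
  bijective Phi -> is_gamma Phi rho -> (forall i, D (s i) = rho (D i)) ->
  forall i a1 a2 y1 y2, admissible s i a1 a2 y1 y2 ->
  cross_relation (Phi \o iota) a1 a2 y1 y2 = 0.
Proof.
move=> Phi_bij rhoP sE i a1 a2 y1 y2 [Di a0 aDi yE].
have [rho_bij _] := rhoP.
have Phi_graded k : cox (rho (D k)) (Phi 'X_k) by apply: (is_gammaE rhoP); apply: coxXU.
have Phi0 a k : (forall k, D k = 0 -> mono a k = 0%N) ->
    (0 < mono a k)%N -> (Phi 'X_k)@_0 = 0.
  move=> aD0 ak; apply/eqP/negPn/negP => /((coxP _ _).1 (@Phi_graded k)).
  rewrite mclass0 -(raddf0 rho) => /esym/(bij_inj rho_bij) Dk.
  by rewrite aD0 in ak.
have a10 k : D k = 0 -> mono a1 k = 0%N by move=> /a0[].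
have a20 k : D k = 0 -> mono a2 k = 0%N by move=> /a0[].
rewrite /cross_relation !leading_valueE; try by move=> k; apply: Phi0.
apply/eqP; rewrite subr_eq0 -!big_split; apply/eqP/eq_bigr => k _ /=.
have [Dk|Dk] := eqVneq (D k) (D i); first by rewrite aDi // mulrC.
have -> : (line_eval y1 (Phi 'X_k))`_1 = (line_eval y2 (Phi 'X_k))`_1 by
  rewrite !coef1_line_eval; apply: eq_bigr => j _;
  have [->|/((coxP _ _).1 (@Phi_graded k))] := eqVneq ((Phi 'X_k)@_U_(j)) 0;
  rewrite ?mul0r // mclass1 => Dj;
  rewrite yE // Dj sE => /(bij_inj rho_bij)/eqP; rewrite (negPf Dk).
by [].
Qed.

Variable l : 'S_r.
Hypothesis l_class : forall x : 'I_r -> int,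
  \sum_i D i *~ x i = 0 -> \sum_i D (l i) *~ x i = 0.

Let sum_delta (F : 'I_r -> Cl v) k : \sum_i F i *~ (i == k)%:Z = F k.
Proof.
rewrite (bigD1 k) //= eqxx big1 ?addr0 // => i ik.
by rewrite (negPf ik) mulr0z.
Qed.

Lemma class_map_eq0 k : D k = 0 -> D (l k) = 0.
Proof.
move=> Dk; rewrite -(sum_delta (fun i => D (l i))); apply: l_class.
by rewrite (sum_delta (fun i => D i)).
Qed.

Lemma class_map_eq i k : D i = D k -> D (l i) = D (l k).
Proof.
move=> Dik; apply/eqP; rewrite -subr_eq0; apply/eqP.
rewrite -(sum_delta (fun i => D (l i)) i) -(sum_delta (fun i => D (l i)) k) -sumrB.
under eq_bigr do rewrite -mulrzBr.
apply: l_class; under eq_bigr do rewrite mulrzBr.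
by rewrite sumrB !(sum_delta (fun i => D i)) Dik subrr.
Qed.

Definition perm_subst : R -> R := msubst (fun i => 'X_(l i) : R).

HB.instance Definition _ :=
  GRing.LRMorphism.copy perm_subst (msubst (fun i => 'X_(l i) : R)).

Lemma perm_substX i : perm_subst 'X_i = 'X_(l i).
Proof. exact: msubstX. Qed.

Lemma cox_perm_subst p : cox 0 p -> cox 0 (perm_subst p).
Proof.
move=> p0; rewrite (mpolyE p) raddf_sum big_seq; apply: cox_sum => m mp.
rewrite /= linearZ /=; apply: coxZ.
have -> : perm_subst 'X_[m] = \prod_i 'X_(l i) ^+ m i by exact: msubstXm.
have <- : \sum_i D (l i) *+ m i = 0.
  apply: etrans (@l_class (fun i => (m i)%:Z) _); first exact: eq_bigr.
  exact: etrans (eq_bigr _ _) (p0 m mp).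
by apply: cox_prod => i; apply/cox_exp/coxXU.
Qed.

Lemma leading_value_perm a y :
  leading_value (perm_subst \o iota) a y = \prod_k y (l k) ^+ mono a k.
Proof.
have X0 i : ('X_i : R)@_0 = 0 by rewrite mcoeffX -mdeg_eq0 mdeg1.
rewrite (leading_valueE (Phi := perm_subst)) => [|k _]; last by rewrite /= perm_substX X0.
apply: eq_bigr => k _; rewrite /= perm_substX line_evalX coefZ coefX.
by rewrite mulr1.
Qed.

(** If [D (s i)] and [D (l i)] differ, the variable sent to the one of index [s i] has neither class
    0 nor the class of [i]. Two test characters can then differ in its exponent while agreeing on
    those two classes, which breaks the relation. *)
Lemma cross_relation_detects s : (forall i, D (s i) = 0 -> D i = 0) ->
  (forall i, D i = 0 -> D (s i) = 0) ->
  (forall i a1 a2 y1 y2, admissible s i a1 a2 y1 y2 ->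
    cross_relation (perm_subst \o iota) a1 a2 y1 y2 = 0) ->
  forall i, D (s i) = D (l i).
Proof.
move=> s0 s0' cross i.
have [Di|/eqP Di] := eqVneq (D i) 0; first by rewrite s0' // class_map_eq0.
apply: boolp.contrapT => Dsl; pose k := (l^-1)%g (s i).
have lk : l k = s i by rewrite /k permKV.
have Dk0 : D k <> 0 by move=> /class_map_eq0; rewrite lk => /s0.
have Dki : D k <> D i by move=> /class_map_eq; rewrite lk.
have [m [mP mk]] := class_separation v_facet v_primitive Dki Dk0.
have [m0 m0P] := ex_interior_off_class0 v_facet v_primitive.
pose N := \sum_j `|pairing m (v j)|.
have N_ge0 : 0 <= N by apply: sumr_ge0.
have mN j : - pairing m (v j) <= N.
  apply: le_trans (_ : `|pairing m (v j)| <= N); first by rewrite ler_normr lexx orbT.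
  by rewrite /N (bigD1 j) //= lerDl sumr_ge0.
have m0_ge0 j : 0 <= pairing m0 (v j) by have := m0P j; case: ifP => _ => [->|/ltW].
have [|a2 a2E] := ex_dual dualP (m := N *: m0).
  by move=> j; rewrite pairingZl mulr_ge0.
have [|a1 a1E] := ex_dual dualP (m := m + N *: m0).
  move=> j; rewrite pairingDl pairingZl; have := m0P j.
  case: eqP => [Dj ->|_ m0j]; first by rewrite mP ?mulr0 //; left.
  rewrite -lerBlDl sub0r; apply: le_trans (mN j) _.
  by rewrite ler_peMr // -gtz0_ge1.
have a12 j : (mono a1 j)%:Z = pairing m (v j) + (mono a2 j)%:Z.
  by rewrite !(monoE dualP) a1E a2E pairingDl.
(* With the value 2 the relation compares powers of 2, which are distinct in characteristic 0. *)
pose y2 (j : 'I_r) : K := if j == s i then 2%:R else 1.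
have adm : admissible s i a1 a2 (fun=> 1) y2.
  split=> // [j Dj|j Dj|j Dj]; last by rewrite /y2; case: eqP => // ji; rewrite ji in Dj.
    have a2j : mono a2 j = 0%N.
      apply/eqP; rewrite -eqz_nat (monoE dualP) a2E pairingZl.
      by have := m0P j; rewrite Dj eqxx => ->; rewrite mulr0.
    split=> //; apply/eqP; rewrite -eqz_nat a12 a2j mP ?addr0 //; by left.
  by apply/eqP; rewrite -eqz_nat a12 mP ?add0r //; right.
have ldy2 a : leading_value (perm_subst \o iota) a y2 = 2%:R ^+ mono a k.
  rewrite leading_value_perm (bigD1 k) //= /y2 lk eqxx big1 ?mulr1 // => j jk.
  by rewrite -lk (inj_eq (@perm_inj _ l)) (negPf jk) expr1n.
have ld1 a : leading_value (perm_subst \o iota) a (fun=> 1) = 1.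
  by rewrite leading_value_perm big1 // => j _; rewrite expr1n.
have /eqP := cross _ _ _ _ _ adm; rewrite /cross_relation !ldy2 !ld1 mul1r mulr1.
rewrite subr_eq0 -!natrX => /eqP/(natr_inj_pchar0 charK0)/eqP.
rewrite eqn_exp2l // => /eqP a21; move: mk; have := a12 k; rewrite a21.
by move/eqP; rewrite -subr_eq subrr eq_sym => ->.
Qed.

End ConnectedNoSymmetry.

(** * From a connecting family to the absence of symmetries mixing classes *)

Section ConnectedSymmetry.
Variables (K : closedFieldType) (charK0 : [pchar K] =i pred0) (n r : nat).
Variables (sigma : 'cV[rat]_n -> Prop) (v : 'I_r -> 'cV[int]_n).
Hypothesis v_rays : lists_primitive_vectors sigma v.
Hypothesis dualP : forall m : 'rV[int]_n,
  reflect (forall i, 0 <= pairing m (v i)) (m \in dual_semigroup sigma).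
Hypothesis v_full : forall m : 'rV[int]_n,
  (forall i, pairing m (v i) = 0) -> m = 0.
Hypothesis v_facet : forall i, exists m : 'rV[int]_n,
  pairing m (v i) = 0 /\ forall j, j != i -> 0 < pairing m (v j).
Hypothesis v_primitive : forall i, exists m : 'rV[int]_n, pairing m (v i) = 1.

Local Notation A := (semigroup_alg K (dual_monoid sigma)).
Local Notation R := {mpoly K[r]}.
Local Notation X := (toric_variety K sigma).
Local Notation cox := (@cox_component n r v K).
Local Notation iota := (iota K dualP).
Local Notation D i := (divclass v (prime_div i)).

(** Complements the cross relations, which are empty for [i] of class 0. *)
Definition class_preserving_at_0 (s : 'S_r) := forall i, D (s i) = 0 <-> D i = 0.

Definition cross_relations (s : 'S_r) (F : A -> R) := forall i a1 a2 y1 y2,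
  admissible v s i a1 a2 y1 y2 -> cross_relation v F a1 a2 y1 y2 = 0.

Lemma perm_substK (l : 'S_r) : cancel (@perm_subst K r l) (@perm_subst K r l^-1%g).
Proof.
apply: (@mpoly_lrmorph_ext r K R (@perm_subst K r l^-1%g \o @perm_subst K r l) idfun) => i /=.
by rewrite !perm_substX permK.
Qed.

Lemma perm_subst1 : @perm_subst K r 1%g =1 id.
Proof.
apply: (@mpoly_lrmorph_ext r K R (@perm_subst K r 1%g) idfun) => i /=.
by rewrite perm_substX perm1.
Qed.

Lemma symmetry_automorphism (L : 'M[int]_n) (l : 'S_r) : L \in unitmx ->
  (forall i, L *m v i = v (l i)) ->
  exists a : {lrmorphism A -> A},
    (forall f, iota (a f) = perm_subst l (iota f)) /\ is_automorphism (pullback a : X -> X).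
Proof.
move=> LU lE.
have L'U : invmx L \in unitmx by rewrite unitmx_inv.
have l'E i : invmx L *m v i = v (l^-1%g i).
  by rewrite -{1}(permKV l i) -lE mulKmx.
have [a aE] := ex_descent dualP v_full (phi := @perm_subst K r l)
  (@cox_perm_subst K n r v l (symmetry_class_map LU lE)).
have [b bE] := ex_descent dualP v_full (phi := @perm_subst K r l^-1%g)
  (@cox_perm_subst K n r v l^-1%g (symmetry_class_map L'U l'E)).
exists a; split=> //; apply: (pullback_automorphism (b := b)) => f.
  by apply: (iota_inj (dualP := dualP) v_full); rewrite bE aE; apply: perm_substK.
apply: (iota_inj (dualP := dualP) v_full); rewrite aE bE -{1}[l]invgK; exact: perm_substK.
Qed.

Lemma automorphism_cross_relations (phi psi : {lrmorphism A -> A}) :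
  cancel phi psi -> cancel psi phi ->
  exists s : 'S_r, class_preserving_at_0 s /\ cross_relations s (iota \o phi).
Proof.
move=> phiK psiK.
have [Phi [rho [Phi_bij rhoP PhiE]]] := cox_lift dualP v_full v_facet v_primitive phiK psiK.
have [s sE] := gamma_perm Phi_bij rhoP; have [rho_bij _] := rhoP.
exists s; split=> [i|].
  rewrite sE; split=> [Di|->]; last by rewrite raddf0.
  by apply: (bij_inj rho_bij); rewrite Di raddf0.
rewrite (_ : iota \o phi = Phi \o iota); last by apply: boolp.funext => f /=; rewrite PhiE.
exact: gamma_cross_relation Phi_bij rhoP sE.
Qed.

Section Family.
Variable S : variety K.
Hypothesis S_affine : affine_variety S.
Hypothesis S_irreducible : irreducible_variety S.
Variables (phi : S -> X -> X) (a : S -> {lrmorphism A -> A}).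
Hypothesis phi_family : algebraic_family phi.
Hypothesis aE : forall s x f, phi s x f = x (a s f).

(** In a family, the pulled back character is a finite combination of fixed elements of [A] with
    regular coefficients, and the leading value is linear in it. *)
Lemma regular_leading_value b y :
  regular (fun s : S => leading_value v (iota \o a s) b y).
Proof.
have [_ /(_ (fun x : X => x (sgchi K b)))] := phi_family.
case=> [|k [g [h [g_reg h_reg E]]]]; first by exists (sgchi K b).
have [eta etaE] := boolp.choice h_reg.
have abE s : a s (sgchi K b) = \sum_i g i s *: eta i.
  apply: (points_separate dualP v_full charK0) => x.
  rewrite -aE; apply: etrans (E (s, x)) _ => /=.
  pose x' : {lrmorphism A -> K^o} := x.
  rewrite -[RHS]/(x' _) raddf_sum; apply: eq_bigr => i _.
  by rewrite /= linearZ etaE.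
have -> : (fun s : S => leading_value v (iota \o a s) b y) =
    fun s => \sum_i g i s * (line_eval y (iota (eta i)))`_(\sum_j mono v b j).
  apply: boolp.funext => s; rewrite /leading_value /= abE !raddf_sum /= coef_sum.
  by apply: eq_bigr => i _; rewrite !linearZ /= coefZ.
by apply: regular_sum => // i; apply: regularM => //; apply: regularC.
Qed.

Lemma regular_cross_relation a1 a2 y1 y2 :
  regular (fun s : S => cross_relation v (iota \o a s) a1 a2 y1 y2).
Proof.
rewrite /cross_relation.
under boolp.eq_fun do rewrite -mulN1r.
apply: regularD => //; first by apply: regularM => //; apply: regular_leading_value.
apply: regularM => //; first exact: regularC.
by apply: regularM => //; apply: regular_leading_value.
Qed.

(* The finitely many sets of parameters satisfying the cross relations of a
   given permutation are closed and cover [S]. *)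
Lemma family_cross_relations : exists s : 'S_r,
  class_preserving_at_0 s /\ forall x, cross_relations s (iota \o a x).
Proof.
have a_inv x : exists b : {lrmorphism A -> A}, cancel (a x) b /\ cancel b (a x).
  have [/(_ x) phi_aut _] := phi_family.
  have [a' [b [a'E a'K bK]]] := automorphism_comorphism dualP v_full charK0 phi_aut.
  suff E : a x =1 a' by exists b; split=> f; rewrite E.
  move=> f; apply: (points_separate dualP v_full charK0) => p.
  by rewrite -aE a'E.
apply: boolp.contrapT => no_s.
have ex_G (s : 'S_r) : exists G : S -> K, [/\ regular G, exists x, G x != 0
    & forall x, class_preserving_at_0 s /\ cross_relations s (iota \o a x) -> G x = 0].
  have [s0|ns0] := boolp.pselect (class_preserving_at_0 s); last first.
    (* A permutation that does not preserve class 0 is valid for no parameter, so a nowhere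
       vanishing function serves. *)
    exists (fun=> 1); split; first exact: regularC.
      by have [[x] _] := S_irreducible; exists x; rewrite oner_neq0.
    by move=> x [].
  have [x nx] : exists x, ~ cross_relations s (iota \o a x).
    apply: boolp.contrapT => no_x; apply: no_s; exists s; split=> // x.
    by apply: boolp.contrapT => nx; apply: no_x; exists x.
  have [i [a1 [a2 [y1 [y2 [adm ne]]]]]] : exists i a1 a2 y1 y2,
      admissible v s i a1 a2 y1 y2 /\ cross_relation v (iota \o a x) a1 a2 y1 y2 <> 0.
    apply: boolp.contrapT => none; apply: nx => i a1 a2 y1 y2 adm.
    by apply: boolp.contrapT => ne; apply: none; exists i, a1, a2, y1, y2.
  exists (fun x => cross_relation v (iota \o a x) a1 a2 y1 y2); split.
  - exact: regular_cross_relation.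
  - by exists x; apply/eqP.
  - by move=> x' [_ H]; apply: H adm.
have [G GP] := boolp.choice ex_G.
have G_reg s : regular (G s) by have [] := GP s.
have G_neq0 s : exists x, G s x != 0 by have [] := GP s.
have [x] := irreducible_prod S_affine S_irreducible (enum {: 'S_r}) G_reg G_neq0.
have [b [abK baK]] := a_inv x.
have [s sP] := automorphism_cross_relations abK baK.
rewrite (big_rem s) ?mem_enum //=; have [_ _ /(_ x sP) ->] := GP s.
by rewrite mul0r eqxx.
Qed.

End Family.

(** At the parameter of the identity the common permutation [s] has [D (s k) = D k]; at that of the
    symmetry it has [D (s k) = D (l k)]. Hence [l] preserves all classes. *)
Lemma connected_no_symmetry : Aut_connected X -> ~ class_mixing_symmetry v sigma.
Proof.
move=> conn [L [LU Lsigma [i [j [Lij Dij]]]]].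
have [l lE] := symmetry_permutes_rays v_rays LU Lsigma.
have [g [gE g_aut]] := symmetry_automorphism LU lE.
have [S [S_aff S_irr [phi [phi_fam [s0 [s1 [phi0 phi1]]]]]]] := conn _ g_aut.
have ex_a s : exists a : {lrmorphism A -> A}, forall x f, phi s x f = x (a f).
  have [/(_ s) phi_aut _] := phi_fam.
  have [a [b [aE _ _]]] := automorphism_comorphism dualP v_full charK0 phi_aut.
  by exists a.
have [a aE] := boolp.choice ex_a.
have [s [s_0 sP]] := family_cross_relations S_aff S_irr phi_fam aE.
have l_class := symmetry_class_map LU lE.
have id_class (x : 'I_r -> int) : \sum_i D i *~ x i = 0 ->
    \sum_i D ((1 : 'S_r)%g i) *~ x i = 0.
  by under [X in _ -> X = _]eq_bigr do rewrite perm1.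
have detects (t : 'S_r) x : (forall x : 'I_r -> int,
    \sum_i D i *~ x i = 0 -> \sum_i D (t i) *~ x i = 0) ->
    (forall f, iota (a x f) = perm_subst t (iota f)) -> forall k, D (s k) = D (t k).
  move=> t_class axE; apply: (cross_relation_detects charK0 (dualP := dualP) v_facet v_primitive t_class).
  - by move=> k /s_0.
  - by move=> k /s_0.
  - move=> k a1 a2 y1 y2 adm.
    rewrite (_ : perm_subst t \o iota = iota \o a x); first exact: sP adm.
    by apply: boolp.funext => f /=; rewrite axE.
have a_s0 f : iota (a s0 f) = perm_subst 1%g (iota f).
  rewrite perm_subst1; congr (iota _); apply: (points_separate dualP v_full charK0) => x.
  by rewrite -aE phi0.
have a_s1 f : iota (a s1 f) = perm_subst l (iota f).
  rewrite -gE; congr (iota _); apply: (points_separate dualP v_full charK0) => x.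
  by rewrite -aE phi1.
have := detects _ _ id_class a_s0 i; rewrite perm1 (detects _ _ l_class a_s1 i).
have [v_inj _ _] := v_rays; have -> : l i = j by apply: v_inj; rewrite -lE.
by move=> E; apply: Dij.
Qed.

End ConnectedSymmetry.

(** * Non-degeneracy and full dimension *)

Section Nondegenerate.
Variables (K : closedFieldType) (charK0 : [pchar K] =i pred0) (n : nat).
Variable sigma : 'cV[rat]_n -> Prop.
Hypothesis X_nondegenerate : nondegenerate_variety (toric_variety K sigma).

Local Notation A := (semigroup_alg K (dual_monoid sigma)).

Lemma torus_point (t : 'I_n -> K) : (forall k, t k != 0) ->
  exists x : toric_variety K sigma, forall a, x (sgchi K a) = \prod_k t k ^ (val a 0 k).
Proof.
move=> t0; have [||x xE] := @ex_sglift K (dual_monoid sigma) K^o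
  (fun a => \prod_k t k ^ (val a 0 k)).
- by rewrite big1 // => k _; rewrite mxE expr0z.
- move=> a b; rewrite -big_split; apply: eq_bigr => k _.
  by rewrite val_dualD mxE expfzDr.
by exists x.
Qed.

(** The character is an invertible function on [X], hence constant; comparing the torus point with
    [k]-th coordinate 2 and all others 1 to the neutral point gives [2 ^ m 0 k = 1]. *)
Lemma nondegenerate_full (m : 'rV[int]_n) :
  m \in dual_semigroup sigma -> - m \in dual_semigroup sigma -> m = 0.
Proof.
move=> mS NmS; pose a : dual_monoid sigma := Sub m mS.
pose b : dual_monoid sigma := Sub (- m) NmS.
have ab : sgchi K a * sgchi K b = 1.
  rewrite -sgchiD -(sgchi0 K); congr (sgchi K _); apply: val_inj.
  by rewrite val_dualD !SubK subrr.
have [|||c cE] := X_nondegenerate (f := fun x => x (sgchi K a)) (g := fun x => x (sgchi K b)).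
- by exists (sgchi K a).
- by exists (sgchi K b).
- by move=> x; pose y : {lrmorphism A -> K^o} := x; rewrite -[LHS](rmorphM y) ab rmorph1.
have two0 : 2%:R != 0 :> K by rewrite ((pcharf0P K).1 charK0).
have tP k (z : 'I_n -> int) (t : K) : \prod_l (if l == k then t else 1) ^ z l = t ^ z k.
  rewrite (bigD1 k) //= eqxx big1 ?mulr1 // => l lk.
  by rewrite (negPf lk) exp1rz.
apply/rowP=> k; rewrite mxE.
have [x xE] := @torus_point (fun l => if l == k then 2%:R else 1) (fun l =>
  match l == k as e return (if e then 2%:R else 1 : K) != 0 with
  | true => two0 | false => oner_neq0 K end).
have [x' x'E] := @torus_point (fun=> 1) (fun=> oner_neq0 K).
have : x (sgchi K a) = x' (sgchi K a) by rewrite !cE.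
rewrite xE x'E tP [RHS]big1 => [|l _]; last by rewrite exp1rz.
rewrite SubK; case: (m 0 k) => e.
  rewrite -exprnP -natrX -[1 in RHS]/(1%:R) => /(natr_inj_pchar0 charK0).
  by case: e => // e /eqP; rewrite expnS muln_eq1.
rewrite NegzE -exprnN => /(congr1 (fun z => z^-1)); rewrite invrK invr1 -natrX.
by rewrite -[1 in RHS]/(1%:R) => /(natr_inj_pchar0 charK0); move=> /eqP; rewrite expnS muln_eq1.
Qed.

End Nondegenerate.

Theorem theorem1 (K : closedFieldType) (charK0 : [pchar K] =i pred0)
    (n : nat) (sigma : 'cV[rat]_n -> Prop)
    (sigma_polyhedral : polyhedral sigma)
    (sigma_strongly_convex : strongly_convex sigma)
    (r : nat) (v : 'I_r -> 'cV[int]_n)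
    (v_rays : lists_primitive_vectors sigma v)
    (X_nondegenerate : nondegenerate_variety (toric_variety K sigma)) :
  let connected := Aut_connected (toric_variety K sigma) in
  let normalizing_preserves :=
    forall phi : {lrmorphism {mpoly K[r]} -> {mpoly K[r]}},
      in_Aut_tilde v phi <-> in_Ker_gamma v phi in
  let no_class_mixing_symmetry :=
    ~ (exists L : 'M[int]_n,
         [/\ L \in unitmx, stabilizes_cone sigma L
           & exists i j : 'I_r, L *m v i = v j
               /\ divclass v (prime_div i) <> divclass v (prime_div j)]) in
  (connected <-> normalizing_preserves)
  /\ (normalizing_preserves <-> no_class_mixing_symmetry).
Proof.
move=> /=.
have dualP := dual_semigroupP sigma_polyhedral sigma_strongly_convex v_rays.
have sigmaP := cone_generatedP sigma_polyhedral sigma_strongly_convex v_rays.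
have v_facet := ex_facet sigma_polyhedral sigma_strongly_convex v_rays.
have v_primitive := ex_pairing_eq1 v_rays.
have v_full m : (forall i, pairing m (v i) = 0) -> m = 0.
  move=> m0; apply: (nondegenerate_full charK0 X_nondegenerate).
    by apply/dualP => i; rewrite m0.
  by apply/dualP => i; rewrite pairingNl m0 oppr0.
have no_symmetry := connected_no_symmetry charK0 v_rays dualP v_full v_facet v_primitive.
have preserves := @no_symmetry_preserves _ _ _ v_full _ sigmaP K.
have connected := preserves_connected charK0 dualP v_full v_facet v_primitive.
split; first by split=> [/no_symmetry/preserves | /connected].
by split=> [/connected/no_symmetry | /preserves].
Qed.
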